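(* Let $R$ be a commutative Noetherian ring with identity, let $\mathfrak{a}$ and $\mathfrak{b}$ be ideals of $R$ with $\mathfrak{b}\subseteq\mathfrak{a}$, and let $M$ be a finitely generated $R$-module such that the set $\operatorname{Ass}_R\bigl(H^{f_{\mathfrak{a}}^{\mathfrak{b}}(M)}_{\mathfrak{a}}(M)\bigr)$ is finite. Then $$f_{\mathfrak{a}}^{\mathfrak{b}}(M)=\inf\{f_{\mathfrak{a}R_{\mathfrak{p}}}^{\mathfrak{b}R_{\mathfrak{p}}}(M_{\mathfrak{p}})\mid \mathfrak{p}\in\operatorname{Spec}(R)\}.$$ In particular, $$f_{\mathfrak{a}}(M)=\inf\{f_{\mathfrak{a}R_{\mathfrak{p}}}(M_{\mathfrak{p}})\mid \mathfrak{p}\in\operatorname{Spec}(R)\}.$$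
   Context: $H^i_{\mathfrak{a}}(M)=\varinjlim_{n\ge 1}\operatorname{Ext}^i_R(R/\mathfrak{a}^n,M)$ is the $i$-th local cohomology module of $M$ with respect to $\mathfrak{a}$. The infimum of the empty set of integers is $\infty$. For ideals $\mathfrak{a},\mathfrak{b}$ of a commutative Noetherian ring $R$ and a finitely generated $R$-module $M$: - the finiteness dimension of $M$ relative to $\mathfrak{a}$ is $f_{\mathfrak{a}}(M)=\inf\{i\in\mathbb{N}_0\mid H^i_{\mathfrak{a}}(M)\text{ is not finitely generated}\}$; - the $\mathfrak{b}$-finiteness dimension of $M$ relative to $\mathfrak{a}$ is $f_{\mathfrak{a}}^{\mathfrak{b}}(M)=\inf\{i\in\mathbb{N}_0\mid \mathfrak{b}^nH^i_{\mathfrak{a}}(M)\neq 0\text{ for all }n\in\mathbb{N}\}$. The quantities $f_{\mathfrak{a}R_{\mathfrak{p}}}(M_{\mathfrak{p}})$ and $f_{\mathfrak{a}R_{\mathfrak{p}}}^{\mathfrak{b}R_{\mathfrak{p}}}(M_{\mathfrak{p}})$ are the same invariants computed over the ring $R_{\mathfrak{p}}$. If $f_{\mathfrak{a}}^{\mathfrak{b}}(M)=\infty$, the finiteness hypothesis on associated primes is regarded as vacuously satisfied. *)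

(* Defs.v *)
From HB Require Import structures.
From mathcomp Require Import all_boot all_order all_algebra generic_quotient.
From mathcomp Require Import ring_quotient.
From mathcomp Require Import all_classical finmap ring.

Set Implicit Arguments.
Unset Strict Implicit.
Unset Printing Implicit Defensive.

Import GRing.Theory.

Local Open Scope classical_set_scope.
Local Open Scope ring_scope.
Local Open Scope quotient_scope.

Section MkLinear.
Context (R : pzRingType) (U V : lmodType R).

Definition mklin (f : U -> V) (fL : linear f) : {linear U -> V} :=
  HB.pack f (GRing.isLinear.Build R U V *:%R f fL).

Lemma linear_ext (f g : {linear U -> V}) : f =1 g -> f = g.
Proof.
case: f g => [f [[Sf] [Lf]]] [g [[Sg] [Lg]]] /= /funext fg; subst g.
by rewrite (Prop_irrelevance Sg Sf) (Prop_irrelevance Lg Lf).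
Qed.

End MkLinear.

Section Submodules.
Context (R : comPzRingType).
Implicit Types V W : lmodType R.

Lemma mksubmod_subproof V (P : set V) (P0 : P 0)
    (PZD : forall a u v, P u -> P v -> P (a *: u + v)) :
  subsemimod_closed (fun v : V => `[< P v >]).
Proof.
split; first split; first exact/asboolP.
  move=> u v /asboolP Pu /asboolP Pv; apply/asboolP.
  by rewrite -[u]scale1r; exact: PZD.
by move=> a u /asboolP Pu; apply/asboolP; rewrite -[_ *: _]addr0; exact: PZD.
Qed.

Definition mksubmod V (P : set V) (P0 : P 0)
    (PZD : forall a u v, P u -> P v -> P (a *: u + v)) : submodClosed V :=
  HB.pack (fun v : V => `[< P v >])
    (GRing.isSubSemiModClosed.Build R V _ (mksubmod_subproof P0 PZD)).

Lemma mksubmodP V (P : set V) (P0 : P 0)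
    (PZD : forall a u v, P u -> P v -> P (a *: u + v)) v :
  (v \in mksubmod P0 PZD) <-> P v.
Proof. by split=> /asboolP. Qed.

Definition topm V : submodClosed V :=
  @mksubmod V setT I (fun _ _ _ _ _ => I).

Section Span.
Context (V : lmodType R) (S : set V).

Let P : set V := [set v | forall U : submodClosed V,
  (forall u, S u -> u \in U) -> v \in U].

Let P0 : P 0. Proof. by move=> U _; exact: rpred0. Qed.

Let PZD a u v : P u -> P v -> P (a *: u + v).
Proof. by move=> Pu Pv U SU; rewrite rpredD ?rpredZ ?Pu ?Pv. Qed.

Definition submod_gen : submodClosed V := mksubmod P0 PZD.

End Span.

Section Preimage.
Context (V W : lmodType R) (f : {linear V -> W}) (U : submodClosed W).

Let P : set V := [set v | f v \in U].

Let P0 : P 0. Proof. by rewrite /P /= linear0 rpred0. Qed.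

Let PZD a u v : P u -> P v -> P (a *: u + v).
Proof. by move=> Pu Pv; rewrite /P /= linearP rpredD ?rpredZ. Qed.

Definition premod : submodClosed V := mksubmod P0 PZD.

End Preimage.

Section Zero.
Context (V : lmodType R).

Let PZD a (u v : V) : [set 0 : V] u -> [set 0 : V] v -> [set 0 : V] (a *: u + v).
Proof. by move=> /= -> ->; rewrite scaler0 addr0. Qed.

Definition botm : submodClosed V := @mksubmod V [set 0] erefl PZD.

End Zero.

Definition kerm V W (f : {linear V -> W}) : submodClosed V :=
  premod f (botm W).

Lemma kermP V W (f : {linear V -> W}) v : v \in kerm f <-> f v = 0.
Proof. by split=> [/mksubmodP/mksubmodP|fv]; last exact/mksubmodP/mksubmodP. Qed.

Section Image.
Context (V W : lmodType R) (f : {linear V -> W}).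

Let P0 : range f 0. Proof. by exists 0 => //; rewrite linear0. Qed.

Let PZD a u v : range f u -> range f v -> range f (a *: u + v).
Proof. by move=> [x _ <-] [y _ <-]; exists (a *: x + y) => //; rewrite linearP. Qed.

Definition immod : submodClosed W := mksubmod P0 PZD.

End Image.

Definition finitely_generated V : Prop :=
  exists s : seq V, forall v, v \in submod_gen [set` s].

End Submodules.

Section SubModule.
Context (R : comPzRingType) (V : lmodType R) (U : submodClosed V).

Definition smod := {v : V | v \in U}.

HB.instance Definition _ := SubChoice.on smod.
HB.instance Definition _ := [SubChoice_isSubLmodule of smod by <:].

Definition sval_lin : {linear smod -> V} := val.

Lemma sval_linP a (x y : smod) : val (a *: x + y) = a *: val x + val y.
Proof. exact: (linearP sval_lin). Qed.

End SubModule.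

Section QuotientModule.
Context (R : comPzRingType) (V : lmodType R) (U : submodClosed V).

Definition zmodpred : {pred V} := U.

Lemma zmodpred_closed : zmod_closed zmodpred.
Proof.
split; first exact: (rpred0 U).
by move=> u v Uu Uv; rewrite -[_ \in _]/(_ \in U) -scaleN1r rpredD ?rpredZ.
Qed.

HB.instance Definition _ := GRing.isZmodClosed.Build V zmodpred zmodpred_closed.

Definition qmod := Quotient.quot zmodpred.

HB.instance Definition _ := GRing.Zmodule.on qmod.

Let pi (v : V) : qmod := \pi_(Quotient.quot zmodpred) v.
Let rep (x : qmod) : V := @repr _ (Quotient.quot zmodpred) x.

Let repK x : pi (rep x) = x. Proof. exact: reprK. Qed.

Let piP u v : (pi u = pi v) <-> (u - v \in U).
Proof.
rewrite -[_ \in U]/(_ \in zmodpred) Quotient.idealrBE.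
by split=> [?|/eqP//]; apply/eqP.
Qed.

Let piD : {morph pi : u v / u + v}.
Proof. by move=> u v; rewrite /pi [in RHS]piE. Qed.

Let scaleq a x : qmod := pi (a *: rep x).

Let pi_scale a v : scaleq a (pi v) = pi (a *: v).
Proof. by apply/piP; rewrite -scalerBr rpredZ//; apply/piP; rewrite repK. Qed.

Let scaleqA a b x : scaleq a (scaleq b x) = scaleq (a * b) x.
Proof. by rewrite -[x]repK !pi_scale scalerA. Qed.

Let scale1q x : scaleq 1 x = x.
Proof. by rewrite -[x]repK pi_scale scale1r. Qed.

Let scaleqDr : right_distributive scaleq +%R.
Proof.
by move=> a x y; rewrite -[x]repK -[y]repK -piD !pi_scale -piD scalerDr.
Qed.

Let scaleqDl x : {morph scaleq^~ x : a b / a + b}.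
Proof. by move=> a b; rewrite -[x]repK !pi_scale -piD scalerDl. Qed.

HB.instance Definition _ := GRing.Zmodule_isLmodule.Build R qmod
  scaleqA scale1q scaleqDr scaleqDl.

Let pi_linear : linear pi.
Proof. by move=> a u v; rewrite piD -pi_scale. Qed.

Definition qpi : {linear V -> qmod} := mklin pi_linear.

Lemma qpiP u v : (qpi u = qpi v) <-> (u - v \in U).
Proof. exact: piP. Qed.

Definition qrepr (x : qmod) : V := rep x.

Lemma qreprK x : qpi (qrepr x) = x.
Proof. exact: repK. Qed.

End QuotientModule.

Section QuotientMap.
Context (R : comPzRingType) (V W : lmodType R).
Context (U : submodClosed V) (U' : submodClosed W) (f : {linear V -> W}).
Hypothesis fU : forall u, u \in U -> f u \in U'.

Let g (x : qmod U) : qmod U' := qpi U' (f (qrepr x)).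

Let g_pi v : g (qpi U v) = qpi U' (f v).
Proof. by apply/qpiP; rewrite -linearB; apply/fU/qpiP; rewrite qreprK. Qed.

Let g_linear : linear g.
Proof.
by move=> a x y; rewrite -[x]qreprK -[y]qreprK -linearP !g_pi !linearP.
Qed.

Definition qmap : {linear qmod U -> qmod U'} := mklin g_linear.

Lemma qmapE v : qmap (qpi U v) = qpi U' (f v).
Proof. exact: g_pi. Qed.

End QuotientMap.

Section SubModuleMap.
Context (R : comPzRingType) (V W : lmodType R).
Context (U : submodClosed V) (U' : submodClosed W) (f : {linear V -> W}).
Hypothesis fU : forall u, u \in U -> f u \in U'.

Let g (x : smod U) : smod U' := exist _ (f (val x)) (fU (valP x)).

Let g_linear : linear g.
Proof. by move=> a x y; apply/val_inj; rewrite /= linearP. Qed.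

Definition smap : {linear smod U -> smod U'} := mklin g_linear.

End SubModuleMap.

Section Subquotient.
Context (R : comPzRingType).

Definition subquot (V : lmodType R) (Z B : submodClosed V) :=
  qmod (premod (sval_lin Z) B).

Context (V W : lmodType R) (Z B : submodClosed V) (Z' B' : submodClosed W).
Context (f : {linear V -> W}).
Hypothesis fZ : forall u, u \in Z -> f u \in Z'.
Hypothesis fB : forall u, u \in B -> f u \in B'.

Lemma subquot_map_subproof (u : smod Z) :
  u \in premod (sval_lin Z) B ->
  smap fZ u \in premod (sval_lin Z') B'.
Proof. by move=> /mksubmodP Bu; apply/mksubmodP; exact: fB. Qed.

Definition subquot_map : {linear subquot Z B -> subquot Z' B'} :=
  qmap subquot_map_subproof.

End Subquotient.

Notation ideal R := (submodClosed (R : comPzRingType)^o).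

Section Ideals.
Context (R : comPzRingType).
Implicit Types a b : ideal R.

Definition noetherian : Prop :=
  forall a, exists s : seq R^o, a =i submod_gen [set` s].

Definition ideal_mul a {V : lmodType R} (U : submodClosed V) : submodClosed V :=
  submod_gen [set v | exists x u, [/\ x \in a, u \in U & v = x *: u]].

Definition ideal_pow a (n : nat) : ideal R :=
  iter n (ideal_mul a) (topm R^o).

Lemma submod_gen_sub (V : lmodType R) (S : set V) (U : submodClosed V) :
  (forall v, S v -> v \in U) -> {subset submod_gen S <= U}.
Proof. by move=> SU v /mksubmodP; apply. Qed.

Lemma sub_submod_gen (V : lmodType R) (S : set V) v : S v -> v \in submod_gen S.
Proof. by move=> Sv; apply/mksubmodP => U; apply. Qed.

Lemma ideal_powS a n : {subset ideal_pow a n.+1 <= ideal_pow a n}.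
Proof.
apply: submod_gen_sub => _ [x [u [_ au ->]]]; exact: rpredZ.
Qed.

Definition prime_ideal (p : ideal R) : Prop :=
  1 \notin p /\ forall x y : R, x * y \in p -> x \in p \/ y \in p.

Record spec := Spec { spec_ideal :> ideal R; _ : prime_ideal spec_ideal }.

Lemma specP (p : spec) : prime_ideal p. Proof. by case: p. Qed.

Lemma submod_ext (V : lmodType R) (U U' : submodClosed V) : U =i U' -> U = U'.
Proof.
case: U U' => [U [[U0] [UZ]]] [U' [[U0'] [UZ']]] /= UU'.
have {UU'} UU' : U = U' by apply/funext => v; exact: (UU' v).
subst U'; by rewrite (Prop_irrelevance U0' U0) (Prop_irrelevance UZ' UZ).
Qed.

Lemma spec_ext (p q : spec) : p =i q -> p = q.
Proof.
case: p q => [p pP] [q qP] /= /submod_ext pq; subst q.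
by rewrite (Prop_irrelevance qP pP).
Qed.

(* Valued in sets of elements: [set (spec R)] raises the universe of [set]
   above that of [submodClosed]. *)
Definition Ass (V : lmodType R) : set (set R) :=
  [set P | exists2 p : spec, P = [set x | x \in (p : ideal R)] &
             exists v : V, P = [set x | x *: v = 0]].

End Ideals.

Section Localization.
Context (R : comPzRingType) (p : spec R).

Definition denom := {s : R | s \notin (p : ideal R)}.

HB.instance Definition _ := SubChoice.on denom.

Let mem_den1 : (1 : R) \notin (p : ideal R). Proof. by case: (specP p). Qed.

Let mem_denM (s t : R) : s \notin (p : ideal R) -> t \notin (p : ideal R) ->
  s * t \notin (p : ideal R).
Proof.
by case: (specP p) => _ pM sp tp; apply/negP => /pM [] h; rewrite h in sp tp.
Qed.

Definition denom1 : denom := exist _ 1 mem_den1.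

Definition denomM (s t : denom) : denom :=
  exist _ (val s * val t) (mem_denM (valP s) (valP t)).

Lemma denomE : (forall s t, val (denomM s t) = val s * val t) * (val denom1 = 1).
Proof. by []. Qed.

Section Module.
Context (M : lmodType R).
Implicit Types (m : M) (s t : denom).

Let eqv (x y : M * denom) : bool := `[< exists2 u : R, u \notin (p : ideal R) &
  (u * val y.2) *: x.1 = (u * val x.2) *: y.1 >].

Let act (a b c : R) m m' : a *: m = b *: m' -> (c * a) *: m = (c * b) *: m'.
Proof. by move=> e; rewrite -!scalerA e. Qed.

Let eqv_class : equiv_class_of eqv.
Proof.
have sym x y : eqv x y -> eqv y x.
  by move=> /asboolP [u up e]; apply/asboolP; exists u.
split=> [x|x y|y x z]; first by apply/asboolP; exists 1.
  by apply/idP/idP; exact: sym.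
move=> /asboolP[u up e] /asboolP[v vp f]; apply/asboolP.
exists (u * v * val y.2); first by rewrite !mem_denM// (valP y.2).
have -> : u * v * val y.2 * val z.2 = v * val z.2 * (u * val y.2) by ring.
rewrite (act _ e).
have -> : v * val z.2 * (u * val x.2) = u * val x.2 * (v * val z.2) by ring.
by rewrite (act _ f); congr (_ *: _); ring.
Qed.

Let eqvr := EquivRelPack eqv_class.
Let eqvm := defaultEncModRel eqvr.

Definition locmod := {eq_quot eqvm}.

HB.instance Definition _ := Choice.on locmod.

Definition frac m s : locmod := \pi_(locmod) (m, s).

Lemma fracP m s m' s' : frac m s = frac m' s' <->
  exists2 u : R, u \notin (p : ideal R) & (u * val s') *: m = (u * val s) *: m'.
Proof.
split=> [/eqP|h]; first by rewrite /frac piE => /asboolP.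
by apply/eqP; rewrite /frac piE; apply/asboolP.
Qed.

Lemma fracW (x : locmod) : exists m s, x = frac m s.
Proof. by exists (repr x).1, (repr x).2; rewrite /frac -surjective_pairing reprK. Qed.

Lemma frac_eq m s m' s' : val s' *: m = val s *: m' -> frac m s = frac m' s'.
Proof.
move=> e; apply/fracP; exists 1; first exact: valP denom1.
by rewrite !mul1r.
Qed.

Let num (x : locmod) : M := (repr x).1.
Let dnm (x : locmod) : denom := (repr x).2.

Let numK (x : locmod) : frac (num x) (dnm x) = x.
Proof. by rewrite /frac -surjective_pairing reprK. Qed.

Let add (x y : locmod) : locmod :=
  frac (val (dnm y) *: num x + val (dnm x) *: num y) (denomM (dnm x) (dnm y)).

Let opp (x : locmod) : locmod := frac (- num x) (dnm x).

Let addE m s m' s' :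
  add (frac m s) (frac m' s') = frac (val s' *: m + val s *: m') (denomM s s').
Proof.
rewrite /add.
have /fracP[u up] := numK (frac m s); have /fracP[v vp] := numK (frac m' s').
move: (num _) (dnm _) (num (frac m s)) (dnm (frac m s)) => m1' s1' m1 s1 e' e.
apply/fracP; exists (u * v); first exact: mem_denM.
rewrite !denomE !scalerDr !scalerA.
have -> : u * v * (val s * val s') * val s1' = v * val s' * val s1' * (u * val s)
  by ring.
rewrite (act _ e).
have -> : u * v * (val s * val s') * val s1 = u * val s * val s1 * (v * val s')
  by ring.
by rewrite (act _ e'); congr (_ *: _ + _ *: _); ring.
Qed.

Let oppE m s : opp (frac m s) = frac (- m) s.
Proof.
rewrite /opp; have /fracP[u up e] := numK (frac m s).
by apply/fracP; exists u => //; rewrite !scalerN e.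
Qed.

Let addA : associative add.
Proof.
move=> x y z; have [m [s ->]] := fracW x; have [m' [s' ->]] := fracW y.
have [m'' [s'' ->]] := fracW z; rewrite !addE; apply: frac_eq.
rewrite !denomE !scalerDr !scalerA !addrA.
by congr (_ *: _ + _ *: _ + _ *: _); ring.
Qed.

Let addC : commutative add.
Proof.
move=> x y; have [m [s ->]] := fracW x; have [m' [s' ->]] := fracW y.
rewrite !addE; apply: frac_eq; rewrite !denomE [X in _ = _ *: X]addrC.
by rewrite !scalerDr !scalerA; congr (_ *: _ + _ *: _); ring.
Qed.

Let add0 : left_id (frac 0 denom1) add.
Proof.
move=> x; have [m [s ->]] := fracW x; rewrite addE; apply: frac_eq.
by rewrite !denomE scaler0 add0r scalerA mulrC.
Qed.

Let addN : left_inverse (frac 0 denom1) opp add.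
Proof.
move=> x; have [m [s ->]] := fracW x; rewrite oppE addE; apply: frac_eq.
by rewrite !denomE scalerN addNr !scaler0.
Qed.

HB.instance Definition _ := GRing.isZmodule.Build locmod addA addC add0 addN.

Lemma fracD m s m' s' :
  frac m s + frac m' s' = frac (val s' *: m + val s *: m') (denomM s s').
Proof. exact: addE. Qed.

End Module.

(* (r / t) (m / s) = (r m) / (t s), also used as the product of [locmod R^o] *)
Definition locscale (M : lmodType R) (a : locmod R^o) (x : locmod M) : locmod M :=
  frac ((repr a).1 *: (repr x).1 : M) (denomM (repr a).2 (repr x).2).

Lemma locscaleE (M : lmodType R) (r : R^o) (t : denom) (m : M) s :
  locscale (frac r t) (frac m s) = frac ((r : R) *: m) (denomM t s).
Proof.
rewrite /locscale.
have /fracP[u up] : frac (repr (frac r t)).1 (repr (frac r t)).2 = frac r t.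
  by rewrite /frac -surjective_pairing reprK.
have /fracP[v vp] : frac (repr (frac m s)).1 (repr (frac m s)).2 = frac m s.
  by rewrite /frac -surjective_pairing reprK.
case: (repr (frac r t)) => r1 t1; case: (repr (frac m s)) => m1 s1.
rewrite -[(m1, s1).1]/m1 -[(m1, s1).2]/s1 -[(r1, t1).1]/r1 -[(r1, t1).2]/t1.
move=> e e'.
have {}e' : u * val t * (r1 : R) = u * val t1 * (r : R) := e'.
apply/fracP; exists (u * v); first exact: mem_denM.
rewrite !denomE !scalerA.
have -> : u * v * (val t * val s) * r1 = u * val t * r1 * (v * val s) by ring.
rewrite -scalerA e scalerA; congr (_ *: _).
by rewrite e'; ring.
Qed.

Definition locR : Type := locmod R^o.

HB.instance Definition _ := GRing.Zmodule.on locR.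

Let mul : locR -> locR -> locR := @locscale R^o.

Let mulE (r r' : R) (t t' : denom) :
  mul (frac (r : R^o) t) (frac (r' : R^o) t') = frac (r * r' : R^o) (denomM t t').
Proof. exact: (@locscaleE R^o). Qed.

Let eqR (r r' : R) (t t' : denom) :
  val t' * r = val t * r' -> frac (r : R^o) t = frac (r' : R^o) t'.
Proof. by move=> e; apply: (@frac_eq R^o). Qed.

Let mulA : associative mul.
Proof.
move=> x y z; have [m [s ->]] := fracW x; have [m' [s' ->]] := fracW y.
have [m'' [s'' ->]] := fracW z.
rewrite (mulE m' m'' s' s'') (mulE m m' s s') (mulE m) (mulE _ m''); apply: eqR; rewrite !denomE; ring.
Qed.

Let mulC : commutative mul.
Proof.
move=> x y; have [m [s ->]] := fracW x; have [m' [s' ->]] := fracW y.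
rewrite !mulE; apply: eqR; rewrite !denomE; ring.
Qed.

Let mul1 : left_id (frac (1 : R^o) denom1) mul.
Proof.
move=> x; have [m [s ->]] := fracW x; rewrite !mulE; apply: eqR; rewrite !denomE; ring.
Qed.

Let locscaleDl (M : lmodType R) (x : locmod M) :
  {morph (@locscale M)^~ x : a b / a + b}.
Proof.
move=> a b; have [m [s ->]] := fracW x; have [r [t ->]] := fracW a.
have [r' [t' ->]] := fracW b; rewrite fracD !locscaleE fracD.
apply: frac_eq; rewrite !denomE !scalerDr !scalerA -scalerDl.
rewrite -[(val t' *: r + val t *: r')]/(val t' * r + val t * r' : R).
by congr (_ *: _); ring.
Qed.

Let mulDl : left_distributive mul +%R.
Proof. by move=> a b x; exact: locscaleDl. Qed.

HB.instance Definition _ := GRing.Zmodule_isComPzRing.Build locR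
  mulA mulC mul1 mulDl.

Section Scale.
Context (M : lmodType R).

Let scl : locR -> locmod M -> locmod M := @locscale M.

Let sclA a b x : scl a (scl b x) = scl (a * b) x.
Proof.
have [m [s ->]] := fracW x; have [r [t ->]] := fracW a.
have [r' [t' ->]] := fracW b; rewrite -[_ * _]/(mul _ _) mulE /scl.
rewrite (locscaleE r' t') !locscaleE.
apply: frac_eq; rewrite !denomE !scalerA; congr (_ *: _).
by ring.
Qed.

Let scl1 x : scl 1 x = x.
Proof.
have [m [s ->]] := fracW x; rewrite -[1]/(frac (1 : R^o) denom1) /scl locscaleE.
by apply: frac_eq; rewrite !denomE !scalerA mulr1 mul1r.
Qed.

Let sclDr : right_distributive scl +%R.
Proof.
move=> a x y; have [m [s ->]] := fracW x; have [m' [s' ->]] := fracW y.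
have [r [t ->]] := fracW a; rewrite fracD /scl !locscaleE fracD.
apply: frac_eq; rewrite !denomE !scalerDr !scalerA.
by congr (_ *: _ + _ *: _); ring.
Qed.

Let sclDl x : {morph scl^~ x : a b / a + b}.
Proof. exact: locscaleDl. Qed.

HB.instance Definition _ := GRing.Zmodule_isLmodule.Build locR (locmod M)
  sclA scl1 sclDr sclDl.

End Scale.

(* the extension a R_p, generated by the r / 1 for r in a *)
Definition ideal_loc (a : ideal R) : ideal locR :=
  submod_gen
    [set x : locR^o | exists2 r : R, r \in a & x = frac (r : R^o) denom1].

End Localization.

Section Free.
Context (R : comPzRingType) (X : choiceType).

Let P : set (X -> R^o) := [set f | finite_set [set x | f x != 0]].

Let P0 : P 0.
Proof.
rewrite /P /= (_ : [set _ | _] = set0) //.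
by rewrite -subset0 => x /=; rewrite eqxx.
Qed.

Let PZD a u v : P u -> P v -> P (a *: u + v).
Proof.
move=> Pu Pv; apply: (@sub_finite_set _ _ ([set x | u x != 0] `|` [set x | v x != 0])).
  move=> x /=; apply: contra_neqP => /not_orP[/negP + /negP].
  by rewrite !negbK => /eqP ux /eqP vx; rewrite -[LHS]/(a *: u x + v x) ux vx scaler0 addr0.
by rewrite finite_setU.
Qed.

(* the free module on X, as the finitely supported functions X -> R *)
Definition freemod : lmodType R := smod (mksubmod P0 PZD).

Lemma freemod_finite (h : freemod) : finite_set [set x | val h x != 0].
Proof. exact: (iffLR (mksubmodP P0 PZD (val h)) (valP h)). Qed.

Let gen_subproof (x : X) : (fun y => (y == x)%:R : R^o) \in mksubmod P0 PZD.
Proof.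
apply/mksubmodP; apply: (@sub_finite_set _ _ [set x]); last exact: finite_set1.
by move=> y /=; case: (y =P x) => // _; rewrite eqxx.
Qed.

Definition freegen (x : X) : freemod :=
  exist (fun f => is_true (f \in _)) _ (gen_subproof x).

Section Lift.
Context (V : lmodType R) (g : X -> V).

Let lift (h : freemod) : V := \sum_(x \in [set: X]) (val h x : R) *: g x.

Let liftE (A : {fset X}) (h : freemod) : (forall x, x \notin A -> val h x = 0) ->
  lift h = \sum_(x <- A) (val h x : R) *: g x.
Proof. by move=> A0; apply: fsbigTE => x /A0 ->; rewrite scale0r. Qed.

Let supp (h : freemod) x : x \notin fset_set [set x | val h x != 0] -> val h x = 0.
Proof.
rewrite in_fset_set; last exact: freemod_finite.
by move=> xA; apply: contra_notP (negP xA) => /eqP hx; apply/mem_set.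
Qed.

Let lift_linear : linear lift.
Proof.
move=> a h k; pose A := (fset_set [set x | val h x != 0] `|`
  fset_set [set x | val k x != 0])%fset.
have hA x : x \notin A -> val h x = 0.
  by rewrite inE => /norP[/supp].
have kA x : x \notin A -> val k x = 0.
  by rewrite inE => /norP[_ /supp].
rewrite (liftE hA) (liftE kA) (@liftE A); last first.
  move=> x xA; rewrite sval_linP -[LHS]/(a * val h x + val k x).
  by rewrite hA// kA// mulr0 addr0.
rewrite scaler_sumr -big_split; apply: eq_bigr => x _.
rewrite sval_linP -[X in X *: _]/(a * val h x + val k x) scalerDl.
by congr (_ + _); exact/esym/scalerA.
Qed.

Definition freelift : {linear freemod -> V} := mklin lift_linear.

Lemma freelift_gen x : freelift (freegen x) = g x.
Proof.
rewrite -[LHS]/(lift _) (@liftE [fset x]%fset); last first.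
  by move=> y; rewrite inE /= => /negPf ->.
by rewrite big_seq_fset1 /= eqxx scale1r.
Qed.

End Lift.

Lemma freelift_comp (V W : lmodType R) (g : X -> V) (f : {linear V -> W}) h :
  f (freelift g h) = freelift (f \o g) h.
Proof.
pose A := fset_set [set x | val h x != 0].
have hA x : x \notin A -> val h x = 0.
  rewrite in_fset_set; last exact: freemod_finite.
  by move=> xA; apply: contra_notP (negP xA) => /eqP hx; apply/mem_set.
rewrite /freelift /= !(fsbigTE A) => [|x /hA ->|x /hA ->]; rewrite ?scale0r//.
by rewrite linear_sum; apply: eq_bigr => x _; rewrite linearZ.
Qed.

End Free.

Section Resolution.
Context (R : comPzRingType).
Implicit Types N : lmodType R.

Definition aug N : {linear freemod R N -> N} := freelift id.

Definition syz N : lmodType R := smod (kerm (aug N)).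

Section Map.
Context (N N' : lmodType R) (f : {linear N -> N'}).

Definition freemap : {linear freemod R N -> freemod R N'} :=
  freelift (fun x => freegen R (f x)).

Lemma aug_freemap h : aug N' (freemap h) = f (aug N h).
Proof.
rewrite /freemap !freelift_comp; congr (freelift _ h).
by apply/funext => x /=; exact: freelift_gen.
Qed.

Let kerfree h : h \in kerm (aug N) -> freemap h \in kerm (aug N').
Proof.
move=> /kermP h0; apply/kermP; by rewrite aug_freemap h0 linear0.
Qed.

Definition syzmap : {linear syz N -> syz N'} := smap kerfree.

Lemma syzmapE x : sval_lin _ (syzmap x) = freemap (sval_lin _ x).
Proof. by []. Qed.

End Map.

Fixpoint nsyz k N : lmodType R := if k is k'.+1 then syz (nsyz k' N) else N.

Fixpoint nsyzmap k N N' (f : {linear N -> N'}) :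
    {linear nsyz k N -> nsyz k N'} :=
  if k is k'.+1 then syzmap (nsyzmap k' f) else f.

(* The free resolution ... -> freeres 1 N -> freeres 0 N -> N -> 0, where
   freeres k N is the free module on the underlying set of the k-th syzygy
   module of N; it is functorial in N. *)
Definition freeres k N : lmodType R := freemod R (nsyz k N).

Definition freeresd k N : {linear freeres k.+1 N -> freeres k N} :=
  sval_lin (kerm (aug (nsyz k N))) \o aug (nsyz k.+1 N).

Definition freeresmap k N N' (f : {linear N -> N'}) :
    {linear freeres k N -> freeres k N'} :=
  freemap (nsyzmap k f).

Lemma aug_surj N (x : N) : exists h, aug N h = x.
Proof. by exists (freegen R x); exact: freelift_gen. Qed.

Lemma res_exact0 N (h : freeres 0 N) :
  aug N h = 0 <-> exists h', freeresd 0 N h' = h.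
Proof.
split=> [h0|[h' <-]].
  have hk : h \in kerm (aug N) by exact/kermP.
  have [h' e] := aug_surj (exist (fun h => is_true (h \in _)) h hk : syz N).
  by exists h'; exact: (congr1 val e).
exact: (iffLR (kermP _ _) (valP (aug _ h'))).
Qed.

Lemma res_exact k N (h : freeres k.+1 N) :
  freeresd k N h = 0 <-> exists h', freeresd k.+1 N h' = h.
Proof.
split=> [h0|[h' <-]].
  have hk : h \in kerm (aug (nsyz k.+1 N)).
    by apply/kermP/val_inj; exact: h0.
  have [h' e] := aug_surj (exist (fun h => is_true (h \in _)) h hk : syz (nsyz k.+1 N)).
  by exists h'; exact: (congr1 val e).
have /kermP e := valP (aug (nsyz k.+2 N) h').
apply: etrans (linear0 (sval_lin (kerm (aug (nsyz k N))))).
exact: (congr1 (sval_lin (kerm (aug (nsyz k N)))) e).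
Qed.

Lemma freeresdE k N N' (f : {linear N -> N'}) h :
  freeresd k N' (freeresmap k.+1 f h) = freeresmap k f (freeresd k N h).
Proof.
have E1 M h' : freeresd k M h' =
    sval_lin (kerm (aug (nsyz k M))) (aug (syz (nsyz k M)) h').
  by [].
rewrite !E1.
have E2 : freeresmap k.+1 f h = freemap (syzmap (nsyzmap k f)) h.
  by [].
have e := aug_freemap (syzmap (nsyzmap k f)) h.
by rewrite E2 e syzmapE.
Qed.

End Resolution.

Section Hom.
Context (R : comPzRingType) (N M : lmodType R).

Definition homod : Type := {linear N -> M}.

HB.instance Definition _ := gen_eqMixin homod.
HB.instance Definition _ := gen_choiceMixin homod.

Implicit Types f g : homod.

Let zero_linear : linear (fun _ : N => 0 : M).
Proof. by move=> a u v; rewrite scaler0 addr0. Qed.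

Let opp_linear f : linear (fun x => - f x).
Proof. by move=> a u v; rewrite linearP opprD scalerN. Qed.

Let add_linear f g : linear (fun x => f x + g x).
Proof. by move=> a u v; rewrite !linearP scalerDr addrACA. Qed.

Let scale_linear a f : linear (fun x => a *: f x).
Proof. by move=> b u v; rewrite linearP scalerDr !scalerA mulrC. Qed.

Let zero : homod := mklin zero_linear.
Let opp f : homod := mklin (opp_linear f).
Let add f g : homod := mklin (add_linear f g).
Let scale a f : homod := mklin (scale_linear a f).

Let addA : associative add.
Proof. by move=> f g h; apply: linear_ext => x /=; exact: addrA. Qed.

Let addC : commutative add.
Proof. by move=> f g; apply: linear_ext => x /=; exact: addrC. Qed.

Let add0 : left_id zero add.
Proof. by move=> f; apply: linear_ext => x /=; exact: add0r. Qed.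

Let addN : left_inverse zero opp add.
Proof. by move=> f; apply: linear_ext => x /=; exact: addNr. Qed.

HB.instance Definition _ := GRing.isZmodule.Build homod addA addC add0 addN.

Let scaleA a b f : scale a (scale b f) = scale (a * b) f.
Proof. by apply: linear_ext => x /=; exact: scalerA. Qed.

Let scale1 f : scale 1 f = f.
Proof. by apply: linear_ext => x /=; exact: scale1r. Qed.

Let scaleDr : right_distributive scale +%R.
Proof. by move=> a f g; apply: linear_ext => x /=; exact: scalerDr. Qed.

Let scaleDl f : {morph scale^~ f : a b / a + b}.
Proof. by move=> a b; apply: linear_ext => x /=; exact: scalerDl. Qed.

HB.instance Definition _ := GRing.Zmodule_isLmodule.Build R homod
  scaleA scale1 scaleDr scaleDl.

End Hom.

Section Precomp.
Context (R : comPzRingType) (N N' M : lmodType R) (f : {linear N -> N'}).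

Let pre (h : homod N' M) : homod N M := (h : {linear N' -> M}) \o f.

Let pre_linear : linear pre.
Proof. by move=> a h k; apply: linear_ext. Qed.

Definition precomp : {linear homod N' M -> homod N M} := mklin pre_linear.

Lemma precompE h x : precomp h x = h (f x).
Proof. by []. Qed.

End Precomp.

Section Ext.
Context (R : comPzRingType).
Implicit Types N M : lmodType R.

Definition cobd k N M :
    {linear homod (freeres k N) M -> homod (freeres k.+1 N) M} :=
  precomp M (freeresd k N).

Definition cocycles k N M : submodClosed (homod (freeres k N) M) :=
  kerm (cobd k N M).

Definition coboundaries k N M : submodClosed (homod (freeres k N) M) :=
  if k is k'.+1 then immod (cobd k' N M) else botm (homod (freeres 0 N) M).

Definition Ext k N M : lmodType R :=
  subquot (cocycles k N M) (coboundaries k N M).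

Section Map.
Context (k : nat) (N N' M : lmodType R) (f : {linear N -> N'}).

Let cocyc h : h \in cocycles k N' M ->
  precomp M (freeresmap k f) h \in cocycles k N M.
Proof.
move=> /kermP h0; apply/kermP/linear_ext => x.
rewrite !precompE -freeresdE.
exact: (congr1 (fun g : homod _ _ => g (freeresmap k.+1 f x)) h0).
Qed.

Let cobound h : h \in coboundaries k N' M ->
  precomp M (freeresmap k f) h \in coboundaries k N M.
Proof.
case: k h => [|k'] h /mksubmodP.
  by move=> ->; apply/mksubmodP; exact: linear0.
move=> [g _ <-]; apply/mksubmodP; exists (precomp M (freeresmap k' f) g) => //.
apply/linear_ext => x.
exact: (congr1 (g : {linear _ -> _}) (esym (freeresdE f x))).
Qed.

Definition Extmap : {linear Ext k N' M -> Ext k N M} :=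
  subquot_map cocyc cobound.

End Map.
End Ext.

Section Product.
Context (R : comPzRingType) (X : nat -> lmodType R).

Definition prodmod : Type := forall n, X n.

HB.instance Definition _ := gen_eqMixin prodmod.
HB.instance Definition _ := gen_choiceMixin prodmod.

Implicit Types x y : prodmod.

Let zero : prodmod := fun=> 0.
Let opp x : prodmod := fun n => - x n.
Let add x y : prodmod := fun n => x n + y n.
Let scale (a : R) x : prodmod := fun n => a *: x n.

Let addA : associative add.
Proof. by move=> x y z; apply: functional_extensionality_dep => n; exact: addrA. Qed.

Let addC : commutative add.
Proof. by move=> x y; apply: functional_extensionality_dep => n; exact: addrC. Qed.

Let add0 : left_id zero add.
Proof. by move=> x; apply: functional_extensionality_dep => n; exact: add0r. Qed.

Let addN : left_inverse zero opp add.
Proof. by move=> x; apply: functional_extensionality_dep => n; exact: addNr. Qed.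

HB.instance Definition _ := GRing.isZmodule.Build prodmod addA addC add0 addN.

Let scaleA a b x : scale a (scale b x) = scale (a * b) x.
Proof. by apply: functional_extensionality_dep => n; exact: scalerA. Qed.

Let scale1 x : scale 1 x = x.
Proof. by apply: functional_extensionality_dep => n; exact: scale1r. Qed.

Let scaleDr : right_distributive scale +%R.
Proof. by move=> a x y; apply: functional_extensionality_dep => n; exact: scalerDr. Qed.

Let scaleDl x : {morph scale^~ x : a b / a + b}.
Proof. by move=> a b; apply: functional_extensionality_dep => n; exact: scalerDl. Qed.

HB.instance Definition _ := GRing.Zmodule_isLmodule.Build R prodmod
  scaleA scale1 scaleDr scaleDl.

End Product.

Section DirectLimit.
Context (R : comPzRingType) (X : nat -> lmodType R).
Context (f : forall n, {linear X n -> X n.+1}).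

Let P : set (prodmod X) :=
  [set x | exists N, forall n, (N <= n)%N -> x n = 0].

Let P0 : P 0. Proof. by exists 0%N. Qed.

Let PZD a u v : P u -> P v -> P (a *: u + v).
Proof.
move=> [N uN] [N' vN]; exists (maxn N N') => n; rewrite geq_max => /andP[Nn N'n].
by rewrite -[LHS]/(a *: u n + v n) uN// vN// scaler0 addr0.
Qed.

Definition dsum : submodClosed (prodmod X) := mksubmod P0 PZD.

Definition dinj n (x : X n) : prodmod X :=
  @dfwith nat (fun n => X n) (0 : prodmod X) n x.

Definition dlrel : submodClosed (prodmod X) :=
  submod_gen [set z | exists n (x : X n), z = dinj x - dinj (f n x)].

(* the direct limit of X 0 -> X 1 -> ..., as the direct sum of the X n modulo
   the submodule generated by the x - f n x, for x in X n *)
Definition dirlim : lmodType R := subquot dsum dlrel.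

End DirectLimit.

Section LocalCohomology.
Context (R : comPzRingType).
Implicit Types (a b : ideal R) (M : lmodType R).

Definition quo_pow a n : lmodType R := qmod (ideal_pow a n).

Definition quo_powS a n : {linear quo_pow a n.+1 -> quo_pow a n} :=
  @qmap R R^o R^o (ideal_pow a n.+1) (ideal_pow a n) idfun (@ideal_powS R a n).

(* the direct limit over n of Ext^i(R / a^(n+1), M), so over exponents >= 1 *)
Definition local_cohomology a i M : lmodType R :=
  @dirlim R (fun n => Ext i (quo_pow a n.+1) M)
    (fun n => Extmap i M (quo_powS a n.+1)).

(* Elements of N u {oo} are encoded in [option nat], with [None] for oo. *)
Definition einf (A : set (option nat)) : option nat :=
  if pselect (exists n, `[< A (Some n) >]) is left An then Some (ex_minn An)
  else None.

Lemma einfP (A : set (option nat)) :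
  match einf A with
  | Some n => A (Some n) /\ (forall m, A (Some m) -> (n <= m)%N)
  | None => forall m, ~ A (Some m)
  end.
Proof.
rewrite /einf; case: pselect => [An|An].
  case: ex_minnP => n /asboolP An' nmin; split=> // m Am; exact/nmin/asboolP.
by move=> m Am; apply: An; exists m; apply/asboolP.
Qed.

Definition findim a M : option nat :=
  einf [set Some i | i in
    [set i | ~ finitely_generated (local_cohomology a i M)]].

Definition bfindim a b M : option nat :=
  einf [set Some i | i in [set i | forall n : nat,
    exists2 x : local_cohomology a i M,
      x \in ideal_mul (ideal_pow b n) (topm (local_cohomology a i M)) &
      x != 0]].

End LocalCohomology.

(* Main.v *)
Require Import Defs.
From mathcomp Require Import all_boot all_order all_algebra.
From mathcomp Require Import all_classical finmap.
From mathcomp Require Import ring zify.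
Import Defs.

Set Implicit Arguments.
Unset Strict Implicit.
Unset Printing Implicit Defensive.

Import GRing.Theory.

Local Open Scope ring_scope.

(** Let [x_1, ..., x_r] generate [a]. Both statements compare a property of
    [H = H^i_a(M)] with the same property of its localizations, so the two things
    to establish are that local cohomology commutes with localization, and that
    the property is of a local nature.

    For the first, let [N(M)] be the cokernel of [M -> M_(x_1) x ... x M_(x_r)].
    The kernel of this map is the torsion submodule [Gamma(M)]. Torsion modules
    have no local cohomology in positive degrees, by a weak form of the Artin-Rees
    lemma ([artin_rees_weak], [cob_on_smallP], [torsion_cob]), and the product has
    none in any degree, because a power of [x_j] acts on its [j]-th factor both
    bijectively and null-homotopically ([prod_acyclic]). Hence the long exact
    sequences give [H^(i+1)_a(M) = H^i_a(N(M))] ([coker_isom]), and [H^i_a(M)] is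
    [Gamma(N^i(M))] ([loccoh_isom]). The functors [Gamma] and [N] are made of
    fractions, kernels and cokernels, so that they commute with localization
    ([loccoh_is_loc]).

    For the second, assume that the associated primes of [H] are finitely many. If
    at each of them some power of [b] kills the localization of [H], then one power
    [b^n] serves all of them, and [b^n H = 0], as a nonzero element of [b^n H]
    would have a multiple whose annihilator is an associated prime
    ([kills_local_global]). This gives one inequality for [bfindim]; the other one
    holds because annihilation passes to localizations ([kills_loc]).

    For [findim], let [i] be the first degree where [H^i_a(M)] may fail to be
    finitely generated. The elements of [H^i_a(M)] killed by [a] are finitely
    generated ([killed_sfg]): with [E^k(M)] the cohomology of [Hom(L, M)] for a
    resolution [L] of [R / a] by finite free modules, finiteness of all [E^k(M)]
    and of [Gamma(M)] implies that of all [E^k(N(M))], since [E^k] of the product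
    vanishes; after [i] steps, [E^0(N^i(M))] consists of the elements of [N^i(M)]
    killed by [a]. All associated primes of [H^i_a(M)] contain [a] and so occur
    among those of this finitely generated submodule; they are finitely many. If
    [H^i_a(M)] is finitely generated at all primes, then a power of [a] kills it
    locally, hence globally, and the elements killed by a power of [a] are finitely
    generated as well ([loccoh_fg_local_global]). *)

(** * Linear relations and finite generation *)

Section Noetherian.
Context (R : comPzRingType).
Implicit Types V W : lmodType R.

Definition sfg V (U : submodClosed V) : Prop :=
  exists s : seq V, U =i submod_gen [set` s].

Definition noeth_mod V : Prop := forall U : submodClosed V, sfg U.

(** Submodules of [V x W]. Maps between modules of classes are used through their
    graphs, which relate two classes when suitable representatives of them exist,
    so that no choice of representatives has to be shown immaterial. *)
Definition linrel V W (rho : V -> W -> Prop) : Prop :=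
  rho 0 0 /\ forall a v w v' w',
    rho v w -> rho v' w' -> rho (a *: v + v') (a *: w + w').

Lemma linrelB V W (rho : V -> W -> Prop) v w v' w' : linrel rho ->
  rho v w -> rho v' w' -> rho (v - v') (w - w').
Proof.
move=> [_ h] p p'; have := h (-1) _ _ _ _ p' p.
by rewrite !scaleN1r ![- _ + _]addrC.
Qed.

Lemma linrelZ V W (rho : V -> W -> Prop) a v w : linrel rho ->
  rho v w -> rho (a *: v) (a *: w).
Proof. by move=> [r0 h] p; have := h a _ _ _ _ p r0; rewrite !addr0. Qed.

Lemma memB V (U : submodClosed V) u v : u \in U -> v \in U -> u - v \in U.
Proof. by move=> uU vU; rewrite -scaleN1r rpredD ?rpredZ. Qed.

Lemma scaleAC V (b c : R) (v : V) : b *: (c *: v) = c *: (b *: v).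
Proof. by rewrite !scalerA mulrC. Qed.

Section SmodVal.
Context (V : lmodType R) (U : submodClosed V).
Implicit Types x y : smod U.

Lemma smod_svalD c x y : sval (c *: x + y) = c *: sval x + sval y.
Proof. exact: sval_linP. Qed.

Lemma smod_svalZ c x : sval (c *: x) = c *: sval x.
Proof. exact: (linearZ_LR (sval_lin U)). Qed.

Lemma smod_sval_inj x y : sval x = sval y -> x = y.
Proof. exact: val_inj. Qed.

Lemma smod_svalP x : sval x \in U.
Proof. exact: valP. Qed.

End SmodVal.

Lemma qpi_surj V (U : submodClosed V) (y : qmod U) : exists v, qpi U v = y.
Proof. by exists (qrepr y); exact: qreprK. Qed.

Lemma qpi0 V (U : submodClosed V) (v : V) : qpi U v = 0 <-> v \in U.
Proof. by rewrite -(linear0 (qpi U)) qpiP subr0. Qed.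

Lemma botmP V (v : V) : v \in botm V <-> v = 0.
Proof. exact: mksubmodP. Qed.

Lemma premodP V W (f : {linear V -> W}) (U : submodClosed W) v :
  v \in premod f U <-> f v \in U.
Proof. exact: mksubmodP. Qed.

Lemma immodP V W (f : {linear V -> W}) w :
  w \in immod f <-> exists v, f v = w.
Proof.
split=> [/mksubmodP[v _ <-]|[v <-]]; first by exists v.
by apply/mksubmodP; exists v.
Qed.

Lemma gen_seq_sub V (s : seq V) (U : submodClosed V) :
  {subset s <= U} -> {subset submod_gen [set` s] <= U}.
Proof. by move=> sU; apply: submod_gen_sub => v /=; exact: sU. Qed.

Lemma mem_gen_seq V (s : seq V) v : v \in s -> v \in submod_gen [set` s].
Proof. by move=> vs; apply: sub_submod_gen. Qed.

(** An extension of finitely generated modules is finitely generated: [U] is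
    generated by generators of the kernel [K] together with lifts of generators
    of the image [I]. *)
Lemma sfg_rel V W (U : submodClosed V) (rho : V -> W -> Prop) :
    linrel rho -> (forall u, u \in U -> exists w, rho u w) ->
    (forall I : submodClosed W,
       (forall w, w \in I -> exists2 u, u \in U & rho u w) -> sfg I) ->
    (forall K : submodClosed V,
       (forall u, u \in K -> u \in U /\ rho u 0) -> sfg K) ->
  sfg U.
Proof.
move=> rhoL tot fgI fgK.
have [rho0 rhoD] := rhoL.
pose P w := exists2 u, u \in U & rho u w.
have P0 : P 0 by exists 0; rewrite ?rpred0.
have PZD a w w' : P w -> P w' -> P (a *: w + w').
  move=> [u uU r] [u' uU' r']; exists (a *: u + u'); last exact: rhoD.
  by rewrite rpredD ?rpredZ.
have [|t It] := fgI (mksubmod P0 PZD); first by move=> w /mksubmodP.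
pose Q u := u \in U /\ rho u 0.
have Q0 : Q 0 by split; rewrite ?rpred0.
have QZD a u u' : Q u -> Q u' -> Q (a *: u + u').
  move=> [uU r] [uU' r']; split; first by rewrite rpredD ?rpredZ.
  by have := rhoD a _ _ _ _ r r'; rewrite scaler0 addr0.
have [|k Kk] := fgK (mksubmod Q0 QZD); first by move=> u /mksubmodP.
have tP w : exists u, w \in t -> u \in U /\ rho u w.
  case: (boolP (w \in t)) => [/mem_gen_seq|_]; last by exists 0.
  by rewrite -It => /mksubmodP[u uU r]; exists u.
have [g gP] := choice tP.
exists (k ++ map g t) => u; apply/idP/idP; last first.
  apply: submod_gen_sub => v /=; rewrite mem_cat => /orP[vk|/mapP[w wt ->]].
    by move/mem_gen_seq: vk; rewrite -Kk => /mksubmodP[].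
  by have [] := gP w wt.
move=> uU; have [w uw] := tot _ uU.
pose S v := v \in submod_gen [set` k ++ map g t].
pose T w := exists2 v, S v & v \in U /\ rho v w.
have T0 : T 0 by exists 0; rewrite /S ?rpred0.
have TZD a x y : T x -> T y -> T (a *: x + y).
  move=> [v Sv [vU r]] [v' Sv' [vU' r']]; exists (a *: v + v').
    by rewrite /S rpredD ?rpredZ.
  by split; [rewrite rpredD ?rpredZ | exact: rhoD].
have : w \in mksubmod T0 TZD.
  have : w \in mksubmod P0 PZD by apply/mksubmodP; exists u.
  rewrite It; apply: submod_gen_sub => x /= xt; apply/(mksubmodP T0 TZD).
  have gx := gP x xt; exists (g x); last exact: gx.
  by apply: mem_gen_seq; rewrite mem_cat map_f ?orbT.
move=> /mksubmodP[v Sv [vU r]]; rewrite -[u](subrK v) rpredD//.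
have : u - v \in mksubmod Q0 QZD.
  apply/mksubmodP; split; first exact: memB.
  by have := linrelB rhoL uw r; rewrite subrr.
rewrite Kk; apply: submod_gen_sub => x /= xk; apply: mem_gen_seq.
by rewrite mem_cat xk.
Qed.

Lemma sfg0 V (U : submodClosed V) : (forall u, u \in U -> u = 0) -> sfg U.
Proof.
move=> U0; exists [::] => u; apply/idP/idP => [/U0->|]; first exact: rpred0.
by apply: submod_gen_sub => v /=; rewrite in_nil.
Qed.

Lemma noeth_rel V W (rho : V -> W -> Prop) : linrel rho ->
    (forall v, exists w, rho v w) -> noeth_mod W ->
    (forall K : submodClosed V, (forall u, u \in K -> rho u 0) -> sfg K) ->
  noeth_mod V.
Proof.
move=> rhoL tot nW hK U; apply: (sfg_rel rhoL) => [u _|I _|K KU].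
- exact: tot.
- exact: nW.
- by apply: hK => u /KU[].
Qed.

Lemma noeth_inj V W (rho : V -> W -> Prop) : linrel rho ->
    (forall v, exists w, rho v w) -> noeth_mod W ->
    (forall v, rho v 0 -> v = 0) ->
  noeth_mod V.
Proof.
move=> rhoL tot nW inj; apply: (noeth_rel rhoL) => // K KU.
by apply: sfg0 => u /KU/inj.
Qed.

(** By induction on the number of generators: modulo the span of the other
    generators, the submodule [U] is an ideal, the one of the coefficients of the
    first generator. *)
Lemma fg_noeth V : noetherian R -> finitely_generated V -> noeth_mod V.
Proof.
move=> Rn [s sV] U; have {sV} : {subset U <= submod_gen [set` s]} by move=> v _.
elim: s U => [|v s IH] U Us.
  apply: sfg0 => u /Us us; apply/botmP.
  by move: us; apply: submod_gen_sub => w; rewrite /= in_nil.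
pose rho (u : V) (r : R^o) := u - (r : R) *: v \in submod_gen [set` s].
have rhoL : linrel rho.
  split=> [|a u r u' r']; first by rewrite /rho scale0r subr0 rpred0.
  rewrite /rho => h h'; have -> : a *: u + u' - (a *: r + r' : R) *: v =
      a *: (u - (r : R) *: v) + (u' - (r' : R) *: v).
    by rewrite scalerDl scalerBr opprD addrACA -scalerA.
  by rewrite rpredD ?rpredZ.
apply: (sfg_rel rhoL).
- move=> u /Us uvs.
  pose P u := exists r, rho u r.
  have P0 : P 0 by exists 0; exact: rhoL.1.
  have PZD a x y : P x -> P y -> P (a *: x + y).
    by move=> [r h] [r' h']; exists (a *: r + r'); exact: rhoL.2.
  apply/(mksubmodP P0 PZD); move: uvs; apply: submod_gen_sub => w /=.
  rewrite inE => /orP[/eqP->|ws]; apply/(mksubmodP P0 PZD).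
    by exists (1 : R); rewrite /rho scale1r subrr rpred0.
  by exists (0 : R); rewrite /rho scale0r subr0; exact: mem_gen_seq.
- by move=> I _; exact: Rn.
- move=> K KU; apply: IH => u /KU[_].
  by rewrite /rho scale0r subr0.
Qed.

Lemma noeth_fg V : noeth_mod V -> finitely_generated V.
Proof.
move=> /(_ (topm V))[s sV]; exists s => v; rewrite -sV; exact/mksubmodP.
Qed.

(** Otherwise dependent choice yields a strictly increasing sequence; but its
    union has finitely many generators, all of which lie in one term. *)
Lemma noeth_max V (F : submodClosed V -> Prop) U0 : noeth_mod V -> F U0 ->
  exists2 U, F U & forall U', F U' -> {subset U <= U'} -> {subset U' <= U}.
Proof.
move=> nV FU0; apply: contrapT => noM.
pose X := {U : submodClosed V | F U}.
pose rel (x y : X) := {subset sval x <= sval y} /\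
  ~ {subset sval y <= sval x}.
have step (x : X) : {y | rel x y}.
  apply: cid; apply: contrapT => ny; apply: noM.
  exists (sval x); first exact: (svalP x).
  move=> U' FU' sub; apply: contrapT => nsub; apply: ny.
  by exists (exist _ U' FU').
have [f [_ fS]] := dependent_choice step (exist _ U0 FU0).
have mono n m : (n <= m)%N -> {subset sval (f n) <= sval (f m)}.
  move=> /subnK <-; elim: (m - n)%N => [//|k IH] u /IH.
  by rewrite addSn; apply: (fS _).1.
pose P v := exists n, v \in sval (f n).
have P0 : P 0 by exists 0%N; exact: rpred0.
have PZD a u v : P u -> P v -> P (a *: u + v).
  move=> [n un] [m vm]; exists (maxn n m).
  rewrite rpredD ?rpredZ//; first by apply: mono un; rewrite leq_maxl.
  by apply: mono vm; rewrite leq_maxr.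
have [s sP] := nV (mksubmod P0 PZD).
have [N sN] : exists N, {subset s <= sval (f N)}.
  have : {subset s <= mksubmod P0 PZD}.
    by move=> v vs; rewrite sP; exact: mem_gen_seq.
  elim: {sP} s => [|v s IH] vs; first by exists 0%N => v; rewrite in_nil.
  have [N sN] : exists N, {subset s <= sval (f N)}.
    by apply: IH => w ws; apply: vs; rewrite inE ws orbT.
  have /vs/mksubmodP[m vm] := mem_head v s.
  exists (maxn N m) => w; rewrite inE => /orP[/eqP->|/sN wN].
    by apply: mono vm; rewrite leq_maxr.
  by apply: mono wN; rewrite leq_maxl.
apply: (fS N).2 => v vN; have : v \in mksubmod P0 PZD.
  by apply/mksubmodP; exists N.+1.
by rewrite sP; apply: submod_gen_sub => w /sN.
Qed.

Lemma noeth_stab V (U : nat -> submodClosed V) : noeth_mod V ->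
    (forall n, {subset U n <= U n.+1}) ->
  exists N, forall n, (N <= n)%N -> {subset U n <= U N}.
Proof.
move=> nV UU; pose F (W : submodClosed V) := exists n, W = U n.
have [|_ [N ->] maxN] := @noeth_max V F (U 0) nV; first by exists 0%N.
exists N => n /subnK <-; apply: maxN; first by exists (n - N + N)%N.
by elim: (n - N)%N => [//|k IH] u /IH; rewrite addSn; apply: UU.
Qed.

End Noetherian.

Lemma noetherian_gen (R : comPzRingType) (a : ideal R) : noetherian R ->
  exists s : seq R, a = submod_gen [set` (s : seq R^o)].
Proof. by move=> /(_ a)[s sP]; exists s; exact: submod_ext. Qed.

(** * Ideals, their powers, and torsion *)

Section Powers.
Context (R : comPzRingType).
Implicit Types (V W : lmodType R) (a J : ideal R).

Lemma regZ (x : R) (y : R^o) : x *: y = x * y.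
Proof. by []. Qed.

Lemma ideal_mulM a V (U : submodClosed V) x u : x \in a -> u \in U ->
  x *: u \in ideal_mul a U.
Proof. by move=> xa uU; apply: sub_submod_gen; exists x, u. Qed.

Lemma ideal_mul_sub a V (U W : submodClosed V) :
  (forall x u, x \in a -> u \in U -> x *: u \in W) ->
  {subset ideal_mul a U <= W}.
Proof.
by move=> h; apply: submod_gen_sub => v [x [u [xa uU ->]]]; exact: h.
Qed.

Lemma mem_topm V (v : V) : v \in topm V.
Proof. exact/mksubmodP. Qed.

Lemma mem_pow a (x : R) k : x \in a -> (x ^+ k : R^o) \in ideal_pow a k.
Proof.
move=> xa; elim: k => [|k IH]; first exact: mem_topm.
by rewrite exprS; apply: ideal_mulM.
Qed.

Lemma ideal_pow_sub a m n : (m <= n)%N ->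
  {subset ideal_pow a n <= ideal_pow a m}.
Proof.
move=> /subnK <-; elim: (n - m)%N => [//|k IH] x.
by rewrite addSn => /ideal_powS/IH.
Qed.

Section Colon.
Context (V : lmodType R) (W : submodClosed V) (x : R).

Let P (v : V) : Prop := x *: v \in W.

Let P0 : P 0. Proof. by rewrite /P scaler0 rpred0. Qed.

Let PZD b u v : P u -> P v -> P (b *: u + v).
Proof.
by rewrite /P => Pu Pv; rewrite scalerDr scalerA mulrC -scalerA rpredD//; exact: rpredZ.
Qed.

Definition colon : submodClosed V := mksubmod P0 PZD.

Lemma colonP v : v \in colon <-> x *: v \in W.
Proof. exact: mksubmodP. Qed.

End Colon.

Section Ann.
Context (V : lmodType R) (v : V) (W : submodClosed V).

Let P (x : R^o) : Prop := (x : R) *: v \in W.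

Let P0 : P 0. Proof. by rewrite /P scale0r rpred0. Qed.

Let PZD b x y : P x -> P y -> P (b *: x + y).
Proof.
by rewrite /P => Px Py; rewrite scalerDl -scalerA rpredD//; exact: rpredZ.
Qed.

(** The transporter [(W : v)]; the annihilator of [v] for [W = 0]. *)
Definition annmod : ideal R := mksubmod P0 PZD.

Lemma annmodP (x : R) : x \in annmod <-> x *: v \in W.
Proof. exact: (mksubmodP P0 PZD). Qed.

End Ann.

(** The induction is on the total exponent: if all exponents are positive,
    the colon ideals [J : x] lower one of them. *)
Lemma ideal_pow_gen (s : seq R) n : forall J (k : R -> nat),
  (\sum_(x <- s) k x <= n)%N -> (forall x, x \in s -> (x ^+ k x : R^o) \in J) ->
  {subset ideal_pow (submod_gen [set` (s : seq R^o)]) n.+1 <= J}.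
Proof.
elim: n => [|n IH] J k kn kJ.
  have k0 x : x \in s -> (1 : R^o) \in J.
    move=> xs; have := kJ x xs.
    by move: kn; rewrite (big_rem x)//= leqn0 addn_eq0 => /andP[/eqP-> _].
  apply: ideal_mul_sub => x u xs _; suff : x \in J.
    by move=> xJ; rewrite regZ mulrC; exact: rpredZ.
  move: xs; apply: submod_gen_sub => y /= /k0 J1.
  by have := rpredZ y J1; rewrite regZ mulr1.
have [[x xs /eqP kx0]|kpos] := pselect (exists2 x, x \in s & k x == 0%N).
  move=> y _; have := rpredZ y (kJ x xs).
  by rewrite kx0 expr0 regZ mulr1.
apply: ideal_mul_sub => x u xs ux; apply/annmodP; move: x xs.
apply: submod_gen_sub => x /= xs; apply/annmodP.
suff : u \in colon J x by move/colonP.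
pose k' y := if y == x then (k y).-1 else k y.
apply: (IH _ k') ux => [|y ys].
  rewrite -ltnS; apply: leq_trans kn; rewrite (big_rem x)//= [leqRHS](big_rem x)//=.
  rewrite {1}/k' eqxx -addSn leq_add//.
    by rewrite prednK// lt0n; apply/negP => /= k0; apply: kpos; exists x.
  by apply: leq_sum => y _; rewrite /k'; case: ifP => // _; exact: leq_pred.
apply/colonP; rewrite /k'; case: (y =P x) => [->|_]; last exact/rpredZ/kJ.
rewrite regZ -exprS prednK; first exact: kJ.
by rewrite lt0n; apply/negP => /= k0; apply: kpos; exists x.
Qed.

Section Gamma.
Context (s : seq R) (M : lmodType R).

Let P (v : M) : Prop := forall x, x \in s -> exists k, x ^+ k *: v = 0.

Let P0 : P 0. Proof. by move=> x _; exists 0%N; rewrite scaler0. Qed.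

Let PZD b u v : P u -> P v -> P (b *: u + v).
Proof.
move=> Pu Pv x xs; have [k ku] := Pu x xs; have [l lv] := Pv x xs.
exists (k + l)%N; rewrite scalerDr scalerA mulrC -scalerA.
by rewrite {1}exprD mulrC -scalerA ku exprD -scalerA lv !scaler0 addr0.
Qed.

(** The torsion submodule of [M] with respect to the ideal generated by [s].
    Testing the generators separately is enough by [gamma_pow], and this form
    passes to localizations as it stands. *)
Definition gamma : submodClosed M := mksubmod P0 PZD.

Lemma gammaP v :
  v \in gamma <-> forall x, x \in s -> exists k, x ^+ k *: v = 0.
Proof. exact: mksubmodP. Qed.

End Gamma.

Lemma gamma_pow (s : seq R) V (v : V) : v \in gamma s V ->
  exists n, forall x, x \in ideal_pow (submod_gen [set` (s : seq R^o)]) n ->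
    x *: v = 0.
Proof.
move=> /gammaP vs.
have {}vs x : exists k, x \in s -> x ^+ k *: v = 0.
  by case: (boolP (x \in s)) => [/vs[k kP]|_]; [exists k | exists 0%N].
have [k kP] := choice vs.
exists (\sum_(x <- s) k x).+1 => x xs; apply/botmP/annmodP.
apply: (@ideal_pow_gen s _ (annmod v (botm V)) k) xs => // y ys.
by apply/annmodP/botmP; exact: kP.
Qed.

Lemma pow_gamma (s : seq R) V (v : V) n :
    (forall x, x \in ideal_pow (submod_gen [set` (s : seq R^o)]) n ->
      x *: v = 0) -> v \in gamma s V.
Proof.
move=> h; apply/gammaP => x xs; exists n; apply: h; apply: mem_pow.
exact: mem_gen_seq.
Qed.

End Powers.

Section FiniteGeneration.
Context (R : comPzRingType).
Implicit Types V W : lmodType R.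

(** [sfg_rel] iterated over finitely many maps, whose joint kernel remains. *)
Lemma sfg_maps V W (T : eqType) (phi : T -> {linear V -> W}) (s : seq T)
    (U : submodClosed V) :
    (forall x (I : submodClosed W), x \in s ->
       (forall w, w \in I -> exists2 u, u \in U & phi x u = w) -> sfg I) ->
    (forall K : submodClosed V,
       (forall u, u \in K -> u \in U /\ forall x, x \in s -> phi x u = 0) ->
       sfg K) ->
  sfg U.
Proof.
elim: s U => [|x s IH] U hI hK; first by apply: hK => u.
apply: (@sfg_rel R V W U (fun u w => phi x u = w)).
- split=> [|a v w v' w' <- <-]; first exact: linear0.
  exact: linearP.
- by move=> u _; exists (phi x u).
- by move=> I; apply: hI; rewrite mem_head.
- move=> K KU; apply: IH => [y I ys hyI|L LK].
    apply: (hI y); first by rewrite inE ys orbT.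
    by move=> w /hyI[u /KU[uU _]]; exists u.
  apply: hK => u /LK[/KU[uU ux] us]; split=> // y.
  by rewrite inE => /orP[/eqP->|/us].
Qed.

Lemma noeth_smod V (U : submodClosed V) :
  (forall K : submodClosed V, {subset K <= U} -> sfg K) -> noeth_mod (smod U).
Proof.
move=> hU K; apply: (@sfg_rel R (smod U) V K (fun u w => val u = w)).
- split=> [//|a v w v' w' <- <-]; exact: sval_linP.
- by move=> u _; exists (val u).
- by move=> I IU; apply: hU => w /IU[u _ <-]; exact: (valP u).
- by move=> L LK; apply: sfg0 => u /LK[_ u0]; exact: val_inj.
Qed.

End FiniteGeneration.

(** * Associated primes and the Artin-Rees lemma *)

Section AssociatedPrimes.
Context (R : comPzRingType) (R_noetherian : noetherian R).
Implicit Types V W : lmodType R.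

Definition is_ann V (p : ideal R) (v : V) : Prop :=
  forall x : R, x \in p <-> x *: v = 0.

(** A maximal annihilator among the nonzero multiples of [v] is prime. *)
Lemma ann_prime_exists V (v : V) : v != 0 ->
  exists (r : R) (p : spec R), is_ann p (r *: v).
Proof.
move=> v0; pose ann (w : V) := annmod w (botm V).
have annP (w : V) (x : R) : x \in ann w <-> x *: w = 0.
  by split=> [/annmodP/botmP|h]; last exact/annmodP/botmP.
pose F (I : ideal R) := exists2 r : R, r *: v != 0 & I = ann (r *: v).
have [|_ [r rv0 ->] maxr] := @noeth_max R R^o F (ann v) R_noetherian.
  by exists 1; rewrite ?scale1r.
have pr : prime_ideal (ann (r *: v)).
  split=> [|x y xy].
    by apply/negP => /annP; rewrite scale1r; exact/eqP.
  have [/annP yv|yv] := pselect (y *: (r *: v) = 0); [by right | left].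
  have Fy : F (ann ((y * r) *: v)).
    by exists (y * r) => //; rewrite -scalerA; apply/eqP.
  apply: (maxr _ Fy) => [z /annP zv|].
    by apply/annP; rewrite -scalerA scalerA mulrC -scalerA zv scaler0.
  by apply/annP; rewrite -scalerA scalerA; apply/annP.
by exists r, (Spec pr) => x; exact: annP.
Qed.

Lemma AssP V (P : set R) : Ass V P <->
  exists (p : spec R) (v : V),
    P = [set x | x \in (p : ideal R)]%classic /\ is_ann p v.
Proof.
split=> [[p -> [v pv]]|[p [v [-> pv]]]].
  exists p, v; split=> // x.
  have e : (x \in (p : ideal R)) = (x *: v = 0) :> Prop :=
    congr1 (fun A : set R => A x) pv.
  by rewrite e.
by exists p => //; exists v; apply/funext => x; apply/propext; exact: pv.
Qed.

Definition AssU V (U : submodClosed V) : set (set R) :=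
  [set P | exists (p : spec R) (v : V), v \in U /\
    (P = [set x | x \in (p : ideal R)]%classic /\ is_ann p v)]%classic.

Lemma is_ann_neq0 V (p : spec R) (v : V) : is_ann p v -> v != 0.
Proof.
move=> pv; apply/eqP => v0; have [/negP p1 _] := specP p.
by apply: p1; apply/pv; rewrite v0 scaler0.
Qed.

(** A submodule maximal among those with finitely many associated primes is
    everything: otherwise an associated prime of the quotient would allow one to
    enlarge it, adding only that prime. *)
Lemma finite_Ass V : noeth_mod V -> finite_set (Ass V).
Proof.
move=> nV.
pose F (U : submodClosed V) := finite_set (AssU U).
have F0 : F (botm V).
  rewrite /F (_ : AssU _ = set0)//; apply/seteqP; split=> // P.
  by move=> [p [v [/botmP v0 [_ /is_ann_neq0]]]]; rewrite v0 eqxx.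
have [U FU maxU] := noeth_max nV F0.
suff allU v : v \in U.
  apply: sub_finite_set FU => P /AssP[p [v pv]].
  by exists p, v.
apply: contrapT => vU.
have v0 : qpi U v != 0.
  by apply/eqP; rewrite -(linear0 (qpi U)) => /qpiP; rewrite subr0.
have [r [p]] := ann_prime_exists v0; rewrite -linearZ; set w := r *: v => pw.
have {}pw x : x \in (p : ideal R) <-> x *: w \in U.
  apply: iff_trans (pw x) _; rewrite -linearZ -(linear0 (qpi U)).
  by apply: iff_trans (qpiP _ _ _) _; rewrite subr0.
pose P v := exists u x, u \in U /\ v = u + x *: w.
have P0 : P 0 by exists 0, 0; rewrite scale0r addr0 rpred0.
have PZD b u u' : P u -> P u' -> P (b *: u + u').
  move=> [y [x [yU ->]]] [y' [x' [yU' ->]]].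
  exists (b *: y + y'), (b * x + x'); split.
    by rewrite rpredD//; exact: rpredZ.
  by rewrite scalerDr scalerDl scalerA addrACA.
have [p1 pM] := specP p.
suff /maxU sub : F (mksubmod P0 PZD).
  apply: (negP p1); apply/pw; rewrite scale1r; apply: sub.
    move=> u uU; apply/(mksubmodP P0 PZD); exists u, 0.
    by rewrite scale0r addr0.
  by apply/(mksubmodP P0 PZD); exists 0, 1; rewrite rpred0 scale1r add0r.
suff : (AssU (mksubmod P0 PZD) `<=`
    AssU U `|` [set [set x | x \in (p : ideal R)]])%classic.
  by move=> /sub_finite_set; apply; rewrite finite_setU; split.
move=> Q [q [v' [/(mksubmodP P0 PZD)[u [x [uU v'E]]] [-> qv']]]].
have [q1 qM] := specP q.
have [[y yv0 yvU]|nU] := pselect (exists2 y : R, y *: v' <> 0 & y *: v' \in U).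
  left; exists q, (y *: v'); split=> //; split=> // z.
  split=> [/qv' zv|]; first by rewrite scalerA mulrC -scalerA zv scaler0.
  by rewrite scalerA => /qv'/qM[//|/qv'].
have {}nU y : y *: v' \in U <-> y *: v' = 0.
  split=> [yU|->]; last exact: rpred0.
  by apply: contrapT => yv; apply: nU; exists y.
have wU y : y *: v' \in U <-> y * x \in (p : ideal R).
  rewrite v'E scalerDr scalerA.
  split=> [h|/pw h]; last by rewrite rpredD//; exact: rpredZ.
  apply/pw; rewrite -[_ *: w](addKr (y *: u)) addrC.
  by apply: memB => //; exact: rpredZ.
right; apply/seteqP; split=> y /=.
  move=> /qv'/nU/wU/pM[//|xp]; case: (negP q1); apply/qv'/nU/wU.
  by rewrite mul1r.
by move=> yp; apply/qv'/nU/wU; rewrite mulrC; exact: (rpredZ x yp).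
Qed.

End AssociatedPrimes.

Section ArtinRees.
Context (R : comPzRingType) (R_noetherian : noetherian R).
Implicit Types V W : lmodType R.

(** The weak form of the Artin-Rees lemma follows Krull's argument: a submodule
    [W] that contains [a^c K], and is maximal with [W :&: K] inside [a^c K], contains
    [x^k V] for each [x] in [a] and some [k]; for otherwise [W + x^k V] would be
    larger, where [k] is such that [x^n v \in W] implies [x^k v \in W] for all
    [n >= k]. *)
Lemma artin_rees_weak V (K : submodClosed V) (a : ideal R) c : noeth_mod V ->
  exists m, forall v, v \in K -> v \in ideal_mul (ideal_pow a m) (topm V) ->
    v \in ideal_mul (ideal_pow a c) K.
Proof.
move=> nV; set B := ideal_mul (ideal_pow a c) K.
pose F (W : submodClosed V) := {subset B <= W} /\
  forall v, v \in W -> v \in K -> v \in B.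
have FB : F B by split.
have [W [BW WK] maxW] := noeth_max nV FB.
have key (x : R) : x \in a -> exists k, forall v, x ^+ k *: v \in W.
  move=> xa; have [|k kP] := @noeth_stab R V (fun k => colon W (x ^+ k)) nV.
    move=> n v /colonP xv; apply/colonP; rewrite exprS -scalerA.
    exact: rpredZ.
  exists k => v0.
  pose P u := exists v w, w \in W /\ u = x ^+ k *: v + w.
  have P0 : P 0 by exists 0, 0; rewrite scaler0 addr0 rpred0.
  have PZD b u u' : P u -> P u' -> P (b *: u + u').
    move=> [v [w [wW ->]]] [v' [w' [wW' ->]]].
    exists (b *: v + v'), (b *: w + w'); split.
      by rewrite rpredD//; exact: rpredZ.
    rewrite !scalerDr !scalerA addrACA.
    by congr (_ + _); congr (_ *: _ + _); rewrite mulrC.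
  apply: (maxW (mksubmod P0 PZD)).
  - split=> [u uB|u /(mksubmodP P0 PZD)[v [w [wW uvw]]] uK].
      apply/(mksubmodP P0 PZD); exists 0, u; rewrite scaler0 add0r.
      by split=> //; exact: BW.
    apply: WK => //; rewrite uvw rpredD//.
    suff /colonP : v \in colon W (x ^+ k) by [].
    apply: (kP (c + k)%N); first by rewrite leq_addl.
    apply/colonP; rewrite exprD -scalerA.
    have -> : x ^+ k *: v = u - w by rewrite uvw addrK.
    rewrite scalerBr; apply: memB; last exact: rpredZ.
    apply: BW; apply: ideal_mulM => //; exact: mem_pow.
  - move=> w wW; apply/(mksubmodP P0 PZD); exists 0, w.
    by rewrite scaler0 add0r.
  - apply/(mksubmodP P0 PZD); exists v0, 0.
    by rewrite rpred0 addr0.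
have [s aE] := noetherian_gen a R_noetherian.
have {}key x : exists k, x \in s -> forall v, x ^+ k *: v \in W.
  case: (boolP (x \in s)) => [xs|_]; last by exists 0%N.
  have [|k kP] := key x; last by exists k.
  by rewrite aE; exact: mem_gen_seq.
have [k kP] := choice key.
exists (\sum_(x <- s) k x).+1 => v vK va; apply: WK => //.
move: va; apply: ideal_mul_sub => x u xa _; apply/annmodP.
move: xa; rewrite aE.
apply: (@ideal_pow_gen _ _ _ (annmod u W) k) => // y ys.
by apply/annmodP; exact: kP.
Qed.

End ArtinRees.

(** * Complexes of projective modules *)

Section Complexes.
Context (R : comPzRingType).
Implicit Types (V W M N : lmodType R).

Definition projective (P : lmodType R) : Prop :=
  forall V W (g : {linear V -> W}) (f : {linear P -> W}),
    (forall x, exists v, g v = f x) ->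
    exists h : {linear P -> V}, forall x, g (h x) = f x.

(** The coordinates of [freelift freegen h] are computed by [freelift_comp], as
    taking a coordinate is linear. *)
Lemma freelift_freegen (X : choiceType) (h : freemod R X) :
  freelift (freegen R (X := X)) h = h.
Proof.
apply: val_inj; apply/funext => y.
pose ev (h : freemod R X) : R^o := val h y.
have evL : linear ev by move=> a u v; rewrite /ev sval_linP.
rewrite -[LHS]/(mklin evL _) freelift_comp /freelift /=.
rewrite (fsbigTE [fset y]%fset) => [|x].
  by rewrite big_seq_fset1 /ev /= eqxx; exact: mulr1.
by rewrite inE /ev /= eq_sym => /negPf->; exact: scaler0.
Qed.

Lemma freemod_ext (X : choiceType) V (f g : {linear freemod R X -> V}) :
  (forall x, f (freegen R x) = g (freegen R x)) -> f =1 g.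
Proof.
move=> fg h; rewrite -[h]freelift_freegen !freelift_comp.
by congr (freelift _ h); apply/funext => x; exact: fg.
Qed.

Lemma freemod_projective (X : choiceType) : projective (freemod R X).
Proof.
move=> V W g f gf.
have [h hP] := choice (fun x : X => gf (freegen R x)).
exists (freelift h) => x; rewrite freelift_comp.
have -> : g \o h = f \o freegen R (X := X) by apply/funext => y; exact: hP.
by rewrite -freelift_comp freelift_freegen.
Qed.

(** Complexes of projective modules, concentrated in nonnegative degrees. *)
Record pcx := Pcx {
  cm :> nat -> lmodType R;
  cd : forall k, {linear cm k.+1 -> cm k};
  cdd : forall k x, cd k (cd k.+1 x) = 0;
  cproj : forall k, projective (cm k) }.

Implicit Types P Q : pcx.

Definition resolves Q N (e : {linear Q 0%N -> N}) : Prop :=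
  [/\ forall x, exists h, e h = x,
      forall h, e h = 0 <-> exists h', cd Q 0 h' = h &
      forall k h, cd Q k h = 0 -> exists h', cd Q k.+1 h' = h].

Definition chain P Q (t : forall k, {linear P k -> Q k}) : Prop :=
  forall k x, cd Q k (t k.+1 x) = t k (cd P k x).

Definition iscoc P k M (f : homod (P k) M) : Prop :=
  forall x, f (cd P k x) = 0.

(** In degree zero, where no smaller degree provides coboundaries, only the zero
    map is one. *)
Definition iscob P k M : homod (P k) M -> Prop :=
  match k return homod (P k) M -> Prop with
  | 0 => fun f => forall x, f x = 0
  | k'.+1 => fun f => exists g : homod (P k') M, forall x, f x = g (cd P k' x)
  end.

Section Comparison.
Context (P Q : pcx) (N : lmodType R) (e : {linear Q 0%N -> N}).
Hypothesis eQ : resolves e.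

(** The comparison theorem. The components are constructed by recursion, each
    together with the property that it maps boundaries to boundaries, which is
    what allows the next one to be lifted. *)
Lemma lift_chain (th : {linear P 0%N -> N}) :
    (forall x, th (cd P 0 x) = 0) ->
  exists2 t : (forall k, {linear P k -> Q k}), chain t &
    forall x, e (t 0%N x) = th x.
Proof.
have [esurj e0 eex] := eQ.
move=> th0.
pose X k := {t : {linear P k -> Q k} |
  forall x, exists y, cd Q k y = t (cd P k x)}.
have [t0 t0P] := @cproj P 0%N _ _ e th (fun x => esurj (th x)).
have t0X x : exists y, cd Q 0 y = t0 (cd P 0 x).
  by apply/e0; rewrite t0P.
have step k (t : X k) :
    {t' : X k.+1 | forall x, cd Q k (sval t' x) = sval t (cd P k x)}.
  apply: cid.
  have [t' t'P] := @cproj P k.+1 _ _ (cd Q k) (sval t \o cd P k) (svalP t).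
  have t'X x : exists y, cd Q k.+1 y = t' (cd P k.+1 x).
    by apply: eex; rewrite t'P /= cdd linear0.
  by exists (exist _ t' t'X).
pose F := nat_rect X (exist _ t0 t0X) (fun k t => sval (step k t)).
exists (fun k => sval (F k)); last exact: t0P.
by move=> k x; exact: (svalP (step k (F k))).
Qed.

(** A chain map covering zero is null-homotopic, so it kills cohomology. The
    homotopy [s] is built by recursion, and the invariant [t d = d s d] is what
    remains of the homotopy identity in the next degree. *)
Lemma cob_chain0 (t : forall k, {linear P k -> Q k}) k M (f : homod (Q k) M) :
    chain t -> (forall x, e (t 0%N x) = 0) -> iscoc f ->
  iscob ((f \o t k) : {linear _ -> _}).
Proof.
have [esurj e0 eex] := eQ.
move=> ct t0 cf.
pose X k := {s : {linear P k -> Q k.+1} |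
  forall x, t k (cd P k x) = cd Q k (s (cd P k x))}.
have [s0 s0P] := @cproj P 0%N _ _ (cd Q 0) (t 0%N) (fun x => (e0 _).1 (t0 x)).
have s0X x : t 0%N (cd P 0 x) = cd Q 0 (s0 (cd P 0 x)) by rewrite s0P.
have step k' (s : X k') : {s' : X k'.+1 | forall x,
    t k'.+1 x = cd Q k'.+1 (sval s' x) + sval s (cd P k' x)}.
  apply: cid.
  have [|s' s'P] := @cproj P k'.+1 _ _ (cd Q k'.+1)
    ((t k'.+1 : homod (P k'.+1) (Q k'.+1)) -
      ((sval s \o cd P k' : {linear P k'.+1 -> Q k'.+1}) : homod _ _)).
    by move=> x; apply: eex; rewrite linearB /= ct -(svalP s) subrr.
  have {}s'P x : t k'.+1 x = cd Q k'.+1 (s' x) + sval s (cd P k' x).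
    by rewrite s'P /= subrK.
  have s'X x : t k'.+1 (cd P k'.+1 x) = cd Q k'.+1 (s' (cd P k'.+1 x)).
    by rewrite s'P cdd linear0 addr0.
  by exists (exist _ s' s'X).
pose F := nat_rect X (exist _ s0 s0X) (fun k s => sval (step k s)).
case: k f cf => [|k] f cf.
  by move=> x /=; rewrite -s0P; exact: cf.
exists (f \o sval (F k) : {linear _ -> _}) => x /=.
by rewrite (svalP (step k (F k))) linearD cf add0r.
Qed.

End Comparison.

Lemma iscobD P k M (f g h : homod (P k) M) : iscob f -> iscob g ->
  (forall x, h x = f x + g x) -> iscob h.
Proof.
case: k f g h => [|k] f g h.
  by move=> f0 g0 hE x; rewrite hE f0 g0 addr0.
move=> [f' f'P] [g' g'P] hE; exists (f' + g') => x.
by rewrite hE f'P g'P.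
Qed.

Lemma cob_homotopic P Q N (e : {linear Q 0%N -> N}) k M (f : homod (Q k) M)
    (t u : forall k, {linear P k -> Q k}) :
    resolves e -> chain t -> chain u ->
    (forall x, e (t 0%N x) = e (u 0%N x)) -> iscoc f ->
  iscob (f \o u k : {linear _ -> _}) -> iscob (f \o t k : {linear _ -> _}).
Proof.
move=> eQ ct cu tu cf fu.
pose w k : {linear P k -> Q k} := ((t k : homod (P k) (Q k)) - (u k : homod (P k) (Q k))).
have cw : chain w by move=> i x; rewrite /w /= linearB /= ct cu.
have w0 x : e (w 0%N x) = 0 by rewrite /w /= linearB /= tu subrr.
apply: (iscobD (cob_chain0 eQ cw w0 cf) fu) => x /=.
by rewrite /w /= linearB /= subrK.
Qed.

Lemma canres_dd N k (x : freeres k.+2 N) : freeresd k N (freeresd k.+1 N x) = 0.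
Proof. by apply/res_exact; exists x. Qed.

Definition canres N : pcx :=
  @Pcx (fun k => freeres k N) (fun k => freeresd k N) (@canres_dd N)
    (fun k => @freemod_projective (nsyz k N)).

Lemma canres_resolves N : @resolves (canres N) N (aug N).
Proof.
split; [exact: aug_surj | exact: res_exact0 | by move=> k h /res_exact].
Qed.

Definition shift_cx P : pcx :=
  @Pcx (fun k => P k.+1) (fun k => cd P k.+1) (fun k => @cdd P k.+1)
    (fun k => @cproj P k.+1).

Section Splice.
Context (G : lmodType R) (G_proj : projective G) (K : submodClosed G).

(** The resolution of [G / K] that begins with [G] and continues with the
    canonical resolution of [K]. *)
Definition splice_cm k : lmodType R :=
  if k is k'.+1 then freeres k' (smod K) else G.

Definition splice_cd k : {linear splice_cm k.+1 -> splice_cm k} :=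
  match k return {linear splice_cm k.+1 -> splice_cm k} with
  | 0 => sval_lin K \o aug (smod K)
  | k'.+1 => freeresd k' (smod K)
  end.

Lemma splice_dd k x : splice_cd k (splice_cd k.+1 x) = 0.
Proof.
case: k x => [|k] x; last exact: canres_dd.
have e : aug (smod K) (freeresd 0 (smod K) x) = 0.
  by apply/res_exact0; exists x.
exact: etrans (congr1 (sval_lin K) e) (linear0 (sval_lin K)).
Qed.

Lemma splice_proj k : projective (splice_cm k).
Proof. by case: k => [|k]; [exact: G_proj | exact: freemod_projective]. Qed.

Definition splice : pcx := @Pcx splice_cm splice_cd splice_dd splice_proj.

End Splice.

Lemma corestrict V W (U : submodClosed W) (f : {linear V -> W}) :
  (forall x, f x \in U) ->
  exists g : {linear V -> smod U}, forall x, val (g x) = f x.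
Proof.
move=> fU; pose g x : smod U := exist _ (f x) (fU x).
have gL : linear g by move=> a x y; apply: val_inj; exact: linearP.
by exists (mklin gL).
Qed.

Lemma ideal_mul_smod (A : ideal R) V (U : submodClosed V) (v : smod U) :
  val v \in ideal_mul A U -> v \in ideal_mul A (topm (smod U)).
Proof.
pose P w := exists2 v : smod U, v \in ideal_mul A (topm (smod U)) & val v = w.
have P0 : P 0 by exists 0; rewrite ?rpred0.
have PZD a w w' : P w -> P w' -> P (a *: w + w').
  move=> [x xA <-] [x' xA' <-]; exists (a *: x + x'); last exact: sval_linP.
  by rewrite rpredD//; exact: rpredZ.
move=> vA; have : val v \in mksubmod P0 PZD.
  move: vA; apply: ideal_mul_sub => x u xA uU; apply/(mksubmodP P0 PZD).
  pose u' : smod U := exist _ u uU.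
  exists ((x : R) *: u'); first exact: ideal_mulM xA (mem_topm _).
  exact: (linearZ_LR (sval_lin U)).
by move=> /(mksubmodP P0 PZD)[w wA /val_inj <-].
Qed.

Lemma ideal_mul_surj (A : ideal R) V W (g : {linear V -> W}) w :
    (forall w, exists v, g v = w) -> w \in ideal_mul A (topm W) ->
  exists2 v, v \in ideal_mul A (topm V) & g v = w.
Proof.
move=> gs; pose P y := exists2 v, v \in ideal_mul A (topm V) & g v = y.
have P0 : P 0 by exists 0; rewrite ?rpred0 ?linear0.
have PZD a y y' : P y -> P y' -> P (a *: y + y').
  move=> [x xA <-] [x' xA' <-]; exists (a *: x + x'); last exact: linearP.
  by rewrite rpredD//; exact: rpredZ.
move=> wA; apply/(mksubmodP P0 PZD).
move: wA; apply: ideal_mul_sub => x u xA _; apply/(mksubmodP P0 PZD).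
have [v <-] := gs u; exists (x *: v); last exact: linearZ.
exact: ideal_mulM xA (mem_topm _).
Qed.

Lemma ideal_pow_mul (a : ideal R) c n :
  {subset ideal_pow a (c + n) <= ideal_mul (ideal_pow a c) (ideal_pow a n)}.
Proof.
elim: c => [|c IH] x.
  move=> xn; rewrite -[x]scale1r; apply: ideal_mulM => //; exact: mem_topm.
apply: ideal_mul_sub => {}x u xa /IH un; apply/colonP.
move: un; apply: ideal_mul_sub => y v yc vn; apply/colonP.
by rewrite scalerA; apply: ideal_mulM => //; exact: ideal_mulM.
Qed.

Lemma regular_projective : projective R^o.
Proof.
move=> V W g f gf; have [v gv] := gf 1.
have hL : linear (fun x : R^o => (x : R) *: v).
  by move=> a x y; rewrite scalerDl -scalerA.
exists (mklin hL) => x /=.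
rewrite linearZ gv -[in RHS](_ : (x : R) *: (1 : R^o) = x) ?linearZ//.
exact: mulr1.
Qed.

End Complexes.

(** * Cohomology with coefficients in a torsion module *)

Section TorsionCoefficients.
Context (R : comPzRingType) (R_noetherian : noetherian R).
Implicit Types (V W N : lmodType R) (P Q : pcx R).

Lemma freemod_fg (X : finType) : finitely_generated (freemod R X).
Proof.
pose s := [seq freegen R x | x <- enum X]; exists s => h.
suff : qpi (submod_gen [set` s]) h = (0 : homod _ _) h.
  by rewrite -[RHS](linear0 (qpi (submod_gen [set` s]))) => /qpiP; rewrite subr0.
move: h; apply: freemod_ext => x; rewrite -[RHS](linear0 (qpi (submod_gen [set` s]))).
apply/qpiP; rewrite subr0; apply: mem_gen_seq; apply: map_f.
by rewrite mem_enum.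
Qed.

Lemma fg_cover N : finitely_generated N ->
  exists n (g : {linear freemod R 'I_n -> N}), forall x, exists h, g h = x.
Proof.
move=> [s sN]; exists (size s), (freelift (fun i : 'I_(size s) => s`_i)) => x.
apply/immodP; move: (sN x); apply: gen_seq_sub => y /(nthP 0)[i si <-].
by apply/immodP; exists (freegen R (Ordinal si)); exact: freelift_gen.
Qed.

Lemma fg_ker V N (g : {linear V -> N}) : finitely_generated V ->
  finitely_generated (smod (kerm g)).
Proof.
move=> fgV; apply: noeth_fg; apply: noeth_smod => K _; exact: fg_noeth.
Qed.

Context (a : ideal R) (M : lmodType R).
Hypothesis M_tors : forall v : M,
  exists n, forall x : R, x \in ideal_pow a n -> x *: v = 0.

(** Cocycles of degree [i] with torsion coefficients become coboundaries on every
    complex that is mapped into a sufficiently small neighbourhood [a^c N] of zero.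
    Fixing the cocycle before [c], and letting the resolution, the module and the
    complex vary, makes the induction on the degree work. *)
Definition cob_on_small i : Prop := forall N P (e : {linear P 0%N -> N})
    (f : homod (P i) M), finitely_generated N -> resolves e -> iscoc f ->
  exists c, forall Q (t : forall k, {linear Q k -> P k}), chain t ->
    (forall x, e (t 0%N x) \in ideal_mul (ideal_pow a c) (topm N)) ->
  iscob (f \o t i : {linear _ -> _}).

(** In degree zero a cocycle is a linear map on [N]; its image is finitely
    generated and torsion, hence killed by a power of [a]. *)
Lemma cob_on_small0 : cob_on_small 0.
Proof.
move=> N P e f [s sN] [esurj e0 _] cf.
have inv h h' : e h = e h' -> f h = f h'.
  move=> ehh'; have /e0[y yE] : e (h - h') = 0 by rewrite linearB ehh' subrr.
  by apply/eqP; rewrite -subr_eq0 -linearB -yE; apply/eqP; exact: cf.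
have kill (v : N) : exists n, forall h, e h = v ->
    forall x : R, x \in ideal_pow a n -> x *: f h = 0.
  have [h0 h0v] := esurj v; have [n nP] := M_tors (f h0).
  by exists n => h hv x xn; rewrite (inv h h0) ?nP// hv h0v.
have [n nP] := choice kill.
pose c := (\max_(v <- s) n v)%N; exists c => Q t _ tN x /=.
pose P1 v := forall h, e h = v ->
  forall x : R, x \in ideal_pow a c -> x *: f h = 0.
have P10 : P1 0.
  move=> h eh y _; rewrite (inv h 0) ?linear0 ?scaler0//.
have P1ZD b u v : P1 u -> P1 v -> P1 (b *: u + v).
  move=> Pu Pv h eh y yc; have [hu hu1] := esurj u; have [hv hv1] := esurj v.
  rewrite (inv h (b *: hu + hv)); last by rewrite linearP hu1 hv1.
  rewrite linearP scalerDr (Pv hv)// scalerA mulrC -scalerA (Pu hu)//.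
  by rewrite scaler0 addr0.
have all1 v : P1 v.
  apply/(mksubmodP P10 P1ZD); move: (sN v); apply: gen_seq_sub => u us.
  apply/(mksubmodP P10 P1ZD) => h hu y yc; apply: (nP u) => //.
  by apply: ideal_pow_sub yc; exact: leq_bigmax_seq.
pose P2 v := forall h, e h = v -> f h = 0.
have P20 : P2 0 by move=> h eh; rewrite (inv h 0) ?linear0.
have P2ZD b u v : P2 u -> P2 v -> P2 (b *: u + v).
  move=> Pu Pv h eh; have [hu hu1] := esurj u; have [hv hv1] := esurj v.
  rewrite (inv h (b *: hu + hv)); last by rewrite linearP hu1 hv1.
  by rewrite linearP (Pv hv)// (Pu hu)// scaler0 addr0.
suff /(mksubmodP P20 P2ZD) : e (t 0%N x) \in mksubmod P20 P2ZD by apply.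
move: (tN x); apply: ideal_mul_sub => y u yc _.
apply/(mksubmodP P20 P2ZD) => h hu; have [hv hv1] := esurj u.
rewrite (inv h ((y : R) *: hv)) ?linearZ ?hv1//=.
exact: (all1 u).
Qed.

(** Dimension shifting: on [splice] a cocycle of degree [i.+1] is a cocycle of
    degree [i] on the resolution of [K], the kernel of [pi]. The chain map [t] is
    homotopic to one that factors through [splice], beginning with [u0]. *)
Lemma cob_shift i N (G : lmodType R) (pi : {linear G -> N}) P (e : {linear P 0%N -> N})
    (f : homod (P i.+1) M) :
    cob_on_small i -> projective G -> (forall x, exists h, pi h = x) ->
    finitely_generated (smod (kerm pi)) -> resolves e -> iscoc f ->
  exists c, forall Q (t : forall k, {linear Q k -> P k})
      (u0 : {linear Q 0%N -> G}), chain t ->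
      (forall x, pi (u0 x) = e (t 0%N x)) ->
      (forall x, u0 (cd Q 0 x) \in ideal_mul (ideal_pow a c) (kerm pi)) ->
    iscob (f \o t i.+1 : {linear _ -> _}).
Proof.
move=> IH projG pis fgK eP cf.
pose S := splice projG (kerm pi).
have piS (x : S 1%N) : pi (cd S 0 x) = 0.
  exact/kermP/(valP (aug (smod (kerm pi)) x)).
have [h ch h0] := @lift_chain R S P N e eP pi piS.
have cfh : @iscoc R (canres (smod (kerm pi))) i M (f \o h i.+1 : {linear _ -> _}).
  by move=> x; have := ch i.+1 x => /= <-; exact: cf.
have [c cP] := IH _ _ _ _ fgK (canres_resolves _) cfh.
exists c => Q t u0 ct tu0 u0c.
have u0K x : (u0 \o cd Q 0) x \in kerm pi.
  by apply/kermP; rewrite /= tu0 -ct; have [_ e0 _] := eP; apply/e0; eexists.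
have [th thE] := corestrict u0K.
have th0 (x : shift_cx Q 1%N) : th (cd (shift_cx Q) 0 x) = 0.
  by apply: val_inj; rewrite thE /= cdd linear0.
have [u cu uE] := @lift_chain R (shift_cx Q) _ _ _ (canres_resolves _) th th0.
have fhu : iscob (((f \o h i.+1 : {linear _ -> _}) \o u i) : {linear _ -> _}).
  apply: cP => // x; apply: ideal_mul_smod; rewrite uE thE; exact: u0c.
pose T k : {linear Q k -> S k} :=
  match k return {linear Q k -> S k} with 0 => u0 | k'.+1 => u k' end.
have cT : chain T.
  case=> [|k] x; last exact: cu.
  by rewrite -[RHS]/((u0 \o cd Q 0) x) -thE -uE.
pose hT k : {linear Q k -> P k} := h k \o T k.
apply: (cob_homotopic (u := hT) eP) => //.
- by move=> k x; rewrite /hT /= ch cT.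
- by move=> x; rewrite /hT /= h0 tu0.
case: i f cf h ch cfh {IH cP} h0 fhu @hT => [|i] f cf h ch cfh h0 fhu hT.
  by exists 0 => x; exact: fhu.
exact: fhu.
Qed.

(** A map to [a^m N] lifts to [a^m G], where [G] is a finite free cover of [N] with
    kernel [K]; its boundaries then lie in [K] and in [a^m G], hence in [a^c K] by
    the Artin-Rees lemma. *)
Lemma cob_on_smallP i : cob_on_small i.
Proof.
elim: i => [|i IH]; first exact: cob_on_small0.
move=> N P e f fgN eP cf.
have [n [g gs]] := fg_cover fgN.
have fgG : finitely_generated (freemod R 'I_n) by exact: freemod_fg.
have [c cP] := cob_shift IH (@freemod_projective R 'I_n) gs (fg_ker g fgG) eP cf.
have [m mP] := artin_rees_weak R_noetherian (kerm g) a c (fg_noeth R_noetherian fgG).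
exists m => Q t ct tm.
pose J := ideal_mul (ideal_pow a m) (topm (freemod R 'I_n)).
have [x|u0 u0P] := @cproj R Q 0%N _ _ (g \o sval_lin J) (e \o t 0%N).
  by have [v vJ vE] := ideal_mul_surj gs (tm x); exists (exist _ v vJ).
apply: (cP Q t (sval_lin J \o u0)) => // x; apply: mP; last exact: valP.
apply/kermP; apply: etrans (u0P _) _ => /=; rewrite -ct.
by have [_ e0 _] := eP; apply/e0; eexists.
Qed.

(** [cob_shift] for the cover of [R / I] by [R]. The boundary condition holds when
    [I] is a power of [a] and [Q] resolves the quotient by a power that is higher
    by [c]. *)
Lemma cob_torsion i (I : ideal R) P (e : {linear P 0%N -> qmod I})
    (f : homod (P i.+1) M) : resolves e -> iscoc f ->
  exists c, forall Q (t : forall k, {linear Q k -> P k})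
      (u0 : {linear Q 0%N -> R^o}), chain t ->
      (forall x, qpi I (u0 x) = e (t 0%N x)) ->
      (forall x, u0 (cd Q 0 x) \in ideal_mul (ideal_pow a c) I) ->
    iscob (f \o t i.+1 : {linear _ -> _}).
Proof.
move=> eP cf.
have kI : kerm (qpi I) = I.
  apply: submod_ext => x; apply/idP/idP => [/kermP|xI].
    by rewrite -(linear0 (qpi I)) => /qpiP; rewrite subr0.
  by apply/kermP; rewrite -(linear0 (qpi I)); apply/qpiP; rewrite subr0.
have qs x : exists h, qpi I h = x by exists (qrepr x); exact: qreprK.
have fgR : finitely_generated R^o by apply: noeth_fg.
have := cob_shift (@cob_on_smallP i) (@regular_projective R) qs (fg_ker (qpi I) fgR) eP cf.
by rewrite kI.
Qed.

End TorsionCoefficients.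

(** Elements of [M] killed by [I] are maps from [R / I] to [M], that is, cocycles
    of degree zero. *)
Lemma cocycle_of_killed (R : comPzRingType) (I : ideal R) (P : pcx R)
    (e : {linear P 0%N -> qmod I}) (M : lmodType R) (m : M) : resolves e ->
    (forall r : R, r \in I -> r *: m = 0) ->
  exists2 f : homod (P 0%N) M, iscoc f &
    forall x r, e x = qpi I r -> f x = (r : R) *: m.
Proof.
move=> eP Im.
have [x|u0 u0P] := @cproj R P 0%N _ _ (qpi I) e.
  by have [r <-] := qpi_surj (e x); exists r.
have kill (r r' : R^o) : qpi I r = qpi I r' -> (r : R) *: m = (r' : R) *: m.
  move=> /qpiP rr'; apply/eqP; rewrite -subr_eq0 -scalerBl; apply/eqP.
  exact: Im.
have fL : linear (fun x => (u0 x : R) *: m).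
  by move=> c x x'; rewrite linearP scalerDl -scalerA.
exists (mklin fL : homod (P 0%N) M); last by move=> x r xr; apply: kill; rewrite u0P.
move=> x; rewrite -[LHS]/((u0 _ : R) *: m) -[RHS](scale0r m).
apply: kill; rewrite u0P linear0.
by have [_ e0 _] := eP; apply/e0; eexists.
Qed.

(** * Representatives in subquotients and direct limits *)

Section SubquotRel.
Context (R : comPzRingType) (V : lmodType R) (Z B : submodClosed V).

(** The element [v] of [Z] represents the class [y]. *)
Definition sqrel (y : subquot Z B) (v : V) : Prop :=
  exists vZ : v \in Z, y = qpi (premod (sval_lin Z) B) (exist _ v vZ).

Lemma sqrel_lin : linrel sqrel.
Proof.
split=> [|a y v z w [vZ ->] [wZ ->]].
  exists (rpred0 Z); rewrite -[LHS](linear0 (qpi (premod (sval_lin Z) B))).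
  by congr (qpi _ _); apply: val_inj.
have uZ : a *: v + w \in Z by rewrite rpredD//; exact: rpredZ.
exists uZ; rewrite -linearP; congr (qpi _ _); apply: val_inj.
exact: sval_linP.
Qed.

Lemma sqrel_total y : exists v, sqrel y v.
Proof.
exists (val (qrepr y)), (valP (qrepr y)); rewrite -[LHS]qreprK.
by congr (qpi _ _); exact: val_inj.
Qed.

Lemma sqrel_ex v : v \in Z -> exists y, sqrel y v.
Proof. by move=> vZ; exists (qpi (premod (sval_lin Z) B) (exist _ v vZ)), vZ. Qed.

Lemma sqrel_mem y v : sqrel y v -> v \in Z. Proof. by case. Qed.

Lemma sqrel0 y v : sqrel y v -> y = 0 <-> v \in B.
Proof.
move=> [vZ ->]; rewrite -(linear0 (qpi (premod (sval_lin Z) B))).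
by rewrite qpiP subr0 premodP.
Qed.

Lemma sqrel_fun y z v : sqrel y v -> sqrel z v -> y = z.
Proof.
by move=> [vZ ->] [vZ' ->]; congr (qpi _ _); exact: val_inj.
Qed.

End SubquotRel.

Lemma sqrel_map (R : comPzRingType) (V W : lmodType R) (Z B : submodClosed V)
    (Z' B' : submodClosed W) (f : {linear V -> W})
    (fZ : forall u, u \in Z -> f u \in Z') (fB : forall u, u \in B -> f u \in B')
    (y : subquot Z B) v :
  sqrel y v -> sqrel (subquot_map fZ fB y) (f v).
Proof.
move=> [vZ ->]; exists (fZ v vZ); rewrite /subquot_map qmapE.
by congr (qpi _ _); exact: val_inj.
Qed.

Section DirlimRel.
Context (R : comPzRingType) (X : nat -> lmodType R).
Context (f : forall n, {linear X n -> X n.+1}).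

Lemma dinj_same n (x : X n) : dinj x n = x.
Proof. exact: dfwithin. Qed.

Lemma dinj_other n (x : X n) m : n != m -> dinj x m = 0.
Proof. exact: dfwithout. Qed.

Lemma dinj_linear n : linear (@dinj R X n).
Proof.
move=> a x y; apply: functional_extensionality_dep => m.
rewrite -[RHS]/(a *: dinj x m + dinj y m).
case: (n =P m) => [{m}<-|/eqP nm]; first by rewrite !dinj_same.
by rewrite !dinj_other// scaler0 addr0.
Qed.

Definition dinjl n : {linear X n -> prodmod X} := mklin (@dinj_linear n).

Lemma dinj_dsum n (x : X n) : dinjl n x \in dsum X.
Proof.
apply/mksubmodP; exists n.+1 => m nm; apply: dinj_other.
by rewrite neq_ltn nm.
Qed.

(** The canonical map of the [n]-th module to the direct limit. *)
Definition dlin n (x : X n) : dirlim f :=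
  qpi (premod (sval_lin (dsum X)) (dlrel f))
    (exist (fun v => is_true (v \in _)) _ (dinj_dsum x)).

Lemma dlin_sqrel n (x : X n) : sqrel (dlin x) (dinj x).
Proof. by exists (dinj_dsum x). Qed.

Lemma dlin_linear n : linear (@dlin n).
Proof.
move=> a x y; apply: sqrel_fun (dlin_sqrel _) _.
rewrite (dinj_linear a x y); apply: (@sqrel_lin R _ _ _).2; exact: dlin_sqrel.
Qed.

Lemma dlin_push n (x : X n) : dlin (f n x) = dlin x.
Proof.
apply/esym/eqP; rewrite -subr_eq0; apply/eqP.
have h : sqrel (dlin x - dlin (f n x)) (dinj x - dinj (f n x)).
  by apply: linrelB (dlin_sqrel _) (dlin_sqrel _); exact: sqrel_lin.
by apply/(sqrel0 h); apply: sub_submod_gen; exists n, x.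
Qed.

Fixpoint dlmap n l : {linear X n -> X (l + n)} :=
  if l is l'.+1 then f (l' + n) \o dlmap n l' else idfun.

Lemma dlin_pushl n l (x : X n) : dlin (dlmap n l x) = dlin x.
Proof. by elim: l => [//|l IH]; rewrite [LHS]dlin_push. Qed.

(** The components of a finite sum are pushed one stage at a time to a stage [n]
    above all of them. *)
Lemma dlin_rep y : exists N, forall n, (N <= n)%N -> exists x : X n, y = dlin x.
Proof.
have [z yz] := sqrel_total y.
have /mksubmodP[N zN] := sqrel_mem yz.
exists N => n Nn.
have {zN} zn m : (n <= m)%N -> z m = 0 by move=> nm; apply/zN/(leq_trans Nn).
suff [x xP] : exists x : X n, z - dinj x \in dlrel f.
  exists x; apply/eqP; rewrite -subr_eq0; apply/eqP.
  have h := linrelB (@sqrel_lin R _ _ _) yz (dlin_sqrel x).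
  exact/(sqrel0 h).
elim: n z zn {N y yz Nn} => [|n IH] z zn.
  exists 0; rewrite (_ : z - _ = 0) ?rpred0//.
  apply: functional_extensionality_dep => m.
  by rewrite -[LHS]/(z m - (dinjl 0 0) m) linear0 zn// subr0.
have [|x xP] := IH (z - dinj (z n)).
  move=> m; rewrite leq_eqVlt => /orP[/eqP<-|nm].
    by rewrite -[LHS]/(z n - dinj (z n) n) dinj_same subrr.
  by rewrite -[LHS]/(z m - dinj (z n) m) zn// dinj_other ?subr0// neq_ltn nm.
exists (f n (z n + x)).
have -> : z - dinj (f n (z n + x)) = (z - dinj (z n) - dinj x) +
    (dinj (z n + x) - dinj (f n (z n + x))).
  rewrite -[dinj (z n + x)]/(dinjl n _) (linearD (dinjl n)) addrA; congr (_ - _).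
  have -> : z - dinj (z n) - dinj x = z - (dinj (z n) + dinj x) by rewrite opprD addrA.
  exact/esym/subrK.
by rewrite rpredD//; apply: sub_submod_gen; exists n, (z n + x).
Qed.

(** The partial sums pushed to stage [m]; on a relation they eventually vanish,
    which is how elements that die in the limit are detected. *)
Fixpoint dlsum m (z : prodmod X) : X m :=
  match m return X m with 0 => z 0%N | m'.+1 => f m' (dlsum m' z) + z m'.+1 end.

Lemma dlsum_linear m : linear (dlsum m).
Proof.
elim: m => [//|m IH] a x y.
by rewrite [LHS]/= IH linearP scalerDr addrACA.
Qed.

Lemma dlsum_dinj_lt n (x : X n) m : (m < n)%N -> dlsum m (dinj x) = 0.
Proof.
elim: m => [|m IH] mn /=; first by rewrite dinj_other// neq_ltn mn orbT.
by rewrite IH 1?ltnW// linear0 add0r dinj_other// neq_ltn mn orbT.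
Qed.

Lemma dlsum_dinj_eq n (x : X n) : dlsum n (dinj x) = x.
Proof.
case: n x => [|n] x /=; first exact: dinj_same.
by rewrite dlsum_dinj_lt// linear0 add0r dinj_same.
Qed.

Lemma dlsum_dinj n l (x : X n) : dlsum (l + n) (dinj x) = dlmap n l x.
Proof.
elim: l => [|l IH] /=; first exact: dlsum_dinj_eq.
by rewrite IH dinj_other ?addr0// neq_ltn ltnS leq_addl.
Qed.

Lemma dlrel_dlsum z : z \in dlrel f ->
  exists N, forall m, (N <= m)%N -> dlsum m z = 0.
Proof.
pose P z := exists N, forall m, (N <= m)%N -> dlsum m z = 0.
have P0 : P 0.
  by exists 0%N => m _; exact: (linear0 (mklin (@dlsum_linear m))).
have PZD a u v : P u -> P v -> P (a *: u + v).
  move=> [n un] [n' vn]; exists (maxn n n') => m; rewrite geq_max => /andP[h h'].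
  by rewrite dlsum_linear un// vn// scaler0 addr0.
move=> zr; apply/(mksubmodP P0 PZD); move: zr; apply: submod_gen_sub.
move=> _ [n [x ->]]; apply/(mksubmodP P0 PZD); exists n.+1 => m /subnK <-.
elim: (m - n.+1)%N => [|l IH]; last first.
  rewrite addSn /= IH linear0 add0r.
  rewrite -[LHS]/(dinj x (l + n.+1).+1 - dinj (f n x) (l + n.+1).+1).
  rewrite !dinj_other ?subr0// neq_ltn; apply/orP; left; lia.
have e := linearB (mklin (@dlsum_linear (0 + n.+1)%N)) (dinj x) (dinj (f n x)).
rewrite [LHS]e [X in _ - X]dlsum_dinj_eq /= dlsum_dinj_eq.
by rewrite dinj_other ?addr0 ?subrr// neq_ltn ltnSn.
Qed.

Lemma dlin0 n (x : X n) : dlin x = 0 -> exists l, dlmap n l x = 0.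
Proof.
move=> /(sqrel0 (dlin_sqrel x))/dlrel_dlsum[N NP].
by exists N; rewrite -dlsum_dinj NP// leq_addr.
Qed.

End DirlimRel.

(** * Cocycles representing local cohomology classes *)

Section Cocycles.
Context (R : comPzRingType) (a : ideal R).
Implicit Types M N : lmodType R.

(** The exponent is shifted as in [local_cohomology], which starts with [R / a]. *)
Definition res_pow n : pcx R := canres (quo_pow a n.+1).

Definition aug_pow n : {linear res_pow n 0%N -> quo_pow a n.+1} :=
  aug (quo_pow a n.+1).

Lemma res_pow_resolves n : resolves (aug_pow n).
Proof. exact: canres_resolves. Qed.

Fixpoint trans n l k : {linear res_pow (l + n) k -> res_pow n k} :=
  match l return {linear res_pow (l + n) k -> res_pow n k} with
  | 0 => idfun
  | l'.+1 => trans n l' k \o freeresmap k (quo_powS a (l' + n).+1)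
  end.

Lemma transS n l k x : trans n l.+1 k x =
  trans n l k (freeresmap k (quo_powS a (l + n).+1) x).
Proof. by []. Qed.

Lemma trans_chain n l : chain (trans n l).
Proof.
elim: l => [//|l IH] k x; rewrite transS [RHS]transS.
apply: etrans (IH _ _) _.
have e : cd (res_pow (l + n)) k (freeresmap k.+1 (quo_powS a (l + n).+1) x) =
    freeresmap k (quo_powS a (l + n).+1) (cd (res_pow (l.+1 + n)) k x).
  exact: freeresdE.
by rewrite e.
Qed.

Lemma trans_aug n l (x : res_pow (l + n) 0%N) (r : R^o) :
    aug_pow (l + n) x = qpi (ideal_pow a (l + n).+1) r ->
  aug_pow n (trans n l 0%N x) = qpi (ideal_pow a n.+1) r.
Proof.
elim: l x => [//|l IH] x xr; apply: IH.
apply: etrans (aug_freemap _ _) _; rewrite -[aug _ x]/(aug_pow _ x) xr.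
exact: qmapE.
Qed.

Lemma aug_pow_pi n (x : res_pow n 0%N) :
  exists r : R^o, aug_pow n x = qpi (ideal_pow a n.+1) r.
Proof. by exists (qrepr (aug_pow n x)); rewrite qreprK. Qed.

Section Classes.
Context (k : nat) (M : lmodType R).

Lemma cocyclesP n (f : homod (res_pow n k) M) :
  f \in cocycles k (quo_pow a n.+1) M <-> iscoc f.
Proof.
split=> [/kermP h x|h]; first exact: (congr1 (fun g : homod _ _ => g x) h).
by apply/kermP/linear_ext => x; exact: h.
Qed.

Lemma coboundariesP n (f : homod (res_pow n k) M) :
  f \in coboundaries k (quo_pow a n.+1) M <-> iscob f.
Proof.
case: k f => [|k'] f.
  split=> [/botmP -> //|h]; apply/botmP/linear_ext => x; exact: h.
split=> [/immodP[g <-]|[g gP]]; first by exists g.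
by apply/immodP; exists g; apply/linear_ext => x; rewrite gP.
Qed.

Let X n := Ext k (quo_pow a n.+1) M.
Let F n : {linear X n -> X n.+1} := Extmap k M (quo_powS a n.+1).

(** [hrel n y f]: the cocycle [f] on the resolution of [R / a^(n+1)] represents
    the local cohomology class [y]. *)
Definition hrel n (y : local_cohomology a k M) (f : homod (res_pow n k) M) :=
  exists2 x : X n, sqrel x f & y = dlin F x.

Lemma hrel_lin n : linrel (@hrel n).
Proof.
split=> [|c y f z g [x xf ->] [w wg ->]].
  exists 0; first exact: (@sqrel_lin R _ _ _).1.
  exact: esym (linear0 (mklin (dlin_linear F (n := n)))).
exists (c *: x + w); first exact: (@sqrel_lin R _ _ _).2.
by rewrite [RHS]dlin_linear.
Qed.

Lemma hrel_coc n y f : hrel (n := n) y f -> iscoc f.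
Proof. by move=> [x xf _]; exact: (cocyclesP f).1 (sqrel_mem xf). Qed.

Lemma hrel_ex n (f : homod (res_pow n k) M) : iscoc f -> exists y, hrel y f.
Proof.
move=> cf; have [x xf] := sqrel_ex (coboundaries _ _ _) ((cocyclesP f).2 cf).
by exists (dlin F x), x.
Qed.

Lemma hrel_rep y : exists n0, forall n, (n0 <= n)%N -> exists f, @hrel n y f.
Proof.
have [n0 n0P] := dlin_rep y; exists n0 => n /n0P[x ->].
by have [f xf] := sqrel_total x; exists f, x.
Qed.

Lemma sqrel_dlmap n l (x : X n) f : sqrel x f ->
  sqrel (dlmap F n l x) (f \o trans n l k : {linear _ -> _}).
Proof.
move=> xf; elim: l => [|l IH].
  have -> : (f \o trans n 0 k : {linear _ -> _}) = f :> homod _ _.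
    exact: linear_ext.
  by [].
have h : sqrel (F (l + n) (dlmap F n l x))
    (precomp M (freeresmap k (quo_powS a (l + n).+1)) (f \o trans n l k : {linear _ -> _})).
  exact: sqrel_map IH.
suff -> : (f \o trans n l.+1 k : {linear _ -> _}) =
    precomp M (freeresmap k (quo_powS a (l + n).+1))
      (f \o trans n l k : {linear _ -> _}) by [].
exact: linear_ext.
Qed.

Lemma hrel_push n l y f : hrel (n := n) y f ->
  hrel (n := (l + n)%N) y (f \o trans n l k : {linear _ -> _}).
Proof.
move=> [x xf ->]; exists (dlmap F n l x); first exact: sqrel_dlmap.
by rewrite dlin_pushl.
Qed.

Lemma hrel0 n y f : hrel (n := n) y f -> y = 0 ->
  exists l, iscob (f \o trans n l k : {linear _ -> _}).
Proof.
move=> [x xf ->] /dlin0[l lx]; exists l; apply/coboundariesP.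
by apply/(sqrel0 (sqrel_dlmap l xf)).
Qed.

Lemma hrel_cob n y f : hrel (n := n) y f -> iscob f -> y = 0.
Proof.
move=> [x xf ->] /coboundariesP/(sqrel0 xf) ->.
exact: (linear0 (mklin (dlin_linear F (n := n)))).
Qed.

End Classes.

End Cocycles.

(** * Lowering the cohomological degree *)

Section Isom.
Context (R : comPzRingType).
Implicit Types U V W : lmodType R.

(** Isomorphism, witnessed by its graph: the maps in question are given by
    choices of representatives, and their graphs by formulas. *)
Definition isom V W : Prop := exists rho : V -> W -> Prop,
  [/\ linrel rho, (forall v, exists w, rho v w), (forall w, exists v, rho v w),
      (forall v, rho v 0 -> v = 0) & (forall w, rho 0 w -> w = 0)].

Lemma isom_trans U V W : isom U V -> isom V W -> isom U W.
Proof.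
move=> [r [rL rt rs ri rj]] [q [qL qt qs qi qj]].
exists (fun u w => exists2 v, r u v & q v w); split.
- split=> [|a u w u' w' [v uv vw] [v' uv' vw']].
    by exists 0; [exact: rL.1 | exact: qL.1].
  by exists (a *: v + v'); [exact: rL.2 | exact: qL.2].
- by move=> u; have [v uv] := rt u; have [w vw] := qt v; exists w, v.
- by move=> w; have [v vw] := qs w; have [u uv] := rs v; exists u, v.
- by move=> u [v uv /qi v0]; apply: ri; rewrite -v0.
- by move=> w [v /rj -> /qj].
Qed.

Lemma isom_sym V W : isom V W -> isom W V.
Proof.
move=> [r [rL rt rs ri rj]]; exists (fun w v => r v w); split=> //.
by split=> [|a v w v' w']; [exact: rL.1 | exact: rL.2].
Qed.

Lemma isom_noeth V W : isom V W -> noeth_mod W -> noeth_mod V.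
Proof. by move=> [r [rL rt _ ri _]] nW; exact: noeth_inj rL rt nW ri. Qed.

End Isom.

Lemma compE (R : comPzRingType) (U V W : lmodType R) (f : {linear V -> W})
  (g : {linear U -> V}) x : (f \o g : {linear U -> W}) x = f (g x).
Proof. by []. Qed.

Section DegreeShift.
Context (R : comPzRingType) (R_noetherian : noetherian R) (a : ideal R).
Implicit Types M N E : lmodType R.

Definition torsion M : Prop := forall v : M,
  exists n, forall x : R, x \in ideal_pow a n -> x *: v = 0.

(** The transition maps from stage [l + n] to stage [n], restated for arbitrary
    stages, so that classes given at different stages can be compared. *)
Lemma push_le n m : (n <= m)%N ->
  exists2 t : (forall k, {linear res_pow a m k -> res_pow a n k}), chain t &
    forall k M (y : local_cohomology a k M) f, hrel (n := n) y f ->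
      hrel (n := m) y (f \o t k : {linear _ -> _}).
Proof.
move=> /subnK <-; exists (trans a n (m - n)); first exact: trans_chain.
by move=> k M y f; exact: hrel_push.
Qed.

(** Torsion modules have no local cohomology in positive degrees. The augmentation
    at stage [c + n] lifts to a map [u0] with values in [R], which sends boundaries
    into [a^(c + n + 1)], a part of [a^c a^(n + 1)]. *)
Lemma torsion_cob M n k (f : homod (res_pow a n k.+1) M) : torsion M ->
  iscoc f -> exists l, iscob (f \o trans a n l k.+1 : {linear _ -> _}).
Proof.
move=> tM cf.
have [c cP] := cob_torsion R_noetherian tM (res_pow_resolves a n) cf.
exists c.
have [x|u0 u0P] := @cproj R (res_pow a (c + n)) 0%N _ _
    (qpi (ideal_pow a (c + n).+1)) (aug_pow a (c + n)).
  by have [r ->] := aug_pow_pi x; exists r.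
apply: (cP _ (trans a n c) u0); first exact: trans_chain.
  by move=> x; apply/esym/trans_aug; rewrite u0P.
move=> x; apply: ideal_pow_mul; rewrite addnS -[X in X \in _]subr0.
apply/qpiP; rewrite linear0; apply: etrans (u0P _) _.
by have [_ e0 _] := res_pow_resolves a (c + n); apply/e0; eexists.
Qed.

Lemma iscob_comp (P : pcx R) k M N (g : {linear M -> N}) (f : homod (P k) M) :
  iscob f -> iscob (g \o f : {linear _ -> _}).
Proof.
case: k f => [|k] f; first by move=> h x /=; rewrite h linear0.
by move=> [h hP]; exists (g \o h : {linear _ -> _}) => x; rewrite !compE hP.
Qed.

(** A coboundary with values in a quotient lifts to a coboundary, in particular to
    a cocycle. *)
Lemma lift_cob (P : pcx R) k M N (g : {linear M -> N}) (f : homod (P k) N) :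
    (forall w, exists u, g u = w) -> iscob f ->
  exists2 e : {linear P k -> M}, (forall x, g (e x) = f x) &
    (forall x, e (cd P k x) = 0).
Proof.
move=> gs; case: k f => [|k] f.
  by move=> f0; exists (0 : homod _ _) => x //; rewrite f0 linear0.
move=> [h hP]; have [h' h'P] := @cproj R P k _ _ g h (fun x => gs (h x)).
exists (h' \o cd P k) => x; rewrite compE; first by rewrite h'P hP.
by rewrite cdd linear0.
Qed.

Lemma iscob_pull (P Q : pcx R) k M (t : forall k, {linear P k -> Q k})
    (f : homod (Q k) M) : chain t ->
  iscob f -> iscob (f \o t k : {linear _ -> _}).
Proof.
move=> ct; case: k f => [|k] f; first by move=> h x /=; rewrite h.
move=> [h hP]; exists (h \o t k : {linear _ -> _}) => x /=.
by rewrite hP ct.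
Qed.

Context (M E N : lmodType R) (phi : {linear M -> E}) (pi : {linear E -> N}).
Hypothesis ker_tors : torsion (smod (kerm phi)).
Hypothesis E_acyclic : forall n k (f : homod (res_pow a n k) E),
  iscoc f -> iscob f.
Hypothesis pi0 : forall u, pi u = 0 <-> exists v, phi v = u.
Hypothesis pi_surj : forall w, exists u, pi u = w.

(* The connecting map at stage [n], as a relation: [e] lifts the cocycle [f] to
   [E], and [g] lifts the coboundary of [e] to [M]. *)
Let conn n k (y : local_cohomology a k N) (z : local_cohomology a k.+1 M) :=
  exists (f : homod (res_pow a n k) N) (e : {linear res_pow a n k -> E})
         (g : homod (res_pow a n k.+1) M),
  [/\ hrel y f, hrel z g, (forall x, pi (e x) = f x) &
      (forall x, phi (g x) = e (cd (res_pow a n) k x))].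

Let conn_push n m k y z : (n <= m)%N -> @conn n k y z -> @conn m k y z.
Proof.
move=> nm [f [e [g [yf zg ef ge]]]]; have [t ct tP] := push_le nm.
exists (f \o t k : {linear _ -> _}), (e \o t k), (g \o t k.+1 : {linear _ -> _}).
split; [exact: tP | exact: tP | by move=> x; rewrite !compE ef |].
by move=> x; rewrite !compE ge ct.
Qed.

Let conn_lin n k : linrel (@conn n k).
Proof.
split=> [|c y z y' z' [f [e [g [yf zg ef ge]]]] [f' [e' [g' [yf' zg' ef' ge']]]]].
  exists 0, (0 : homod _ _), 0; split.
  - exact: (hrel_lin _ _ _ _).1.
  - exact: (hrel_lin _ _ _ _).1.
  - by move=> x; rewrite linear0.
  - by move=> x; rewrite linear0.
exists (c *: f + f'), (c *: (e : homod _ _) + (e' : homod _ _) : homod _ _),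
  (c *: g + g'); split.
- exact: (hrel_lin _ _ _ _).2.
- exact: (hrel_lin _ _ _ _).2.
- by move=> x; apply: etrans (linearP pi c (e x) (e' x)) _; rewrite ef ef'.
- by move=> x; apply: etrans (linearP phi c (g x) (g' x)) _; rewrite ge ge'.
Qed.

(* The coboundary [g0] of [e] lifts to [M] only up to the torsion module
   [kerm phi]: its own coboundary [g1] has values there, and at a later stage it
   is the coboundary of some [ga], by which [g0] is corrected. *)
Let conn_total k y : exists n z, @conn n k y z.
Proof.
have [n /(_ n (leqnn n))[f yf]] := hrel_rep y.
have [e ef] := @cproj R _ k _ _ pi f (fun x => pi_surj (f x)).
have cf := hrel_coc yf.
have [x|g0 g0e] := @cproj R _ k.+1 _ _ phi (e \o cd (res_pow a n) k).
  by apply/pi0; rewrite ef; exact: cf.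
have g0K x : (g0 \o cd (res_pow a n) k.+1) x \in kerm phi.
  by apply/kermP; rewrite compE g0e compE cdd linear0.
have [g1 g1E] := corestrict g0K.
have cg1 : iscoc (g1 : homod _ _).
  by move=> x; apply: val_inj; rewrite g1E compE cdd linear0.
have [l [ga gaP]] := torsion_cob ker_tors cg1.
pose T k := trans a n l k; have cT : chain T := @trans_chain R a n l.
pose g : homod (res_pow a (l + n) k.+1) M :=
  ((g0 \o T k.+1 : {linear _ -> _}) : homod _ _) -
  ((sval_lin (kerm phi) \o ga : {linear _ -> _}) : homod _ _).
have gE x : g x = g0 (T k.+1 x) - val (ga x) by [].
have cg : iscoc g.
  by move=> x; rewrite gE -cT -gaP compE g1E compE subrr.
have [z zg] := hrel_ex cg; exists (l + n)%N, z.
exists (f \o T k : {linear _ -> _}), (e \o T k), g; split=> //.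
- exact: hrel_push.
- by move=> x; rewrite !compE ef.
- move=> x; rewrite gE linearB g0e compE cT.
  by rewrite ((kermP _ _).1 (valP (ga x))) subr0.
Qed.

Let conn_surj k z : exists n y, @conn n k y z.
Proof.
have [n /(_ n (leqnn n))[g zg]] := hrel_rep z.
have cg := hrel_coc zg.
have [|e ge] := @E_acyclic n k.+1 (phi \o g : {linear _ -> _}).
  by move=> x; rewrite !compE cg linear0.
pose f : homod (res_pow a n k) N := pi \o e : {linear _ -> _}.
have cf : iscoc f.
  by move=> x; rewrite /f compE -ge; apply/pi0; eexists.
by have [y yf] := hrel_ex cf; exists n, y, f, e, g; split.
Qed.

(* If [g] is the coboundary of [ga], then subtracting [phi \o ga] makes [e] a
   cocycle, hence a coboundary, which does not change [f]. *)
Let conn_inj n k y : @conn n k y 0 -> y = 0.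
Proof.
move=> [f [e [g [yf zg ef ge]]]].
have [l [ga gaP]] := hrel0 zg erefl.
pose T k := trans a n l k; have cT : chain T := @trans_chain R a n l.
pose w : homod (res_pow a (l + n) k) E :=
  ((e \o T k : {linear _ -> _}) : homod _ _) -
  ((phi \o ga : {linear _ -> _}) : homod _ _).
have wE x : w x = e (T k x) - phi (ga x) by [].
have cw : iscoc w by move=> x; rewrite wE -cT -ge -gaP compE subrr.
have /(iscob_comp pi) pw := E_acyclic cw.
apply: (hrel_cob (hrel_push l yf)).
have -> // : (f \o trans a n l k : {linear _ -> _}) = (pi \o w : {linear _ -> _}).
apply: linear_ext => x; rewrite !compE wE linearB ef.
by rewrite (iffRL (pi0 _)) ?subr0//; eexists.
Qed.

(* If [f] is a coboundary, then [e] is a cocycle [e'] plus the image of some [ga],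
   so [g] is the coboundary of [ga] plus a cocycle with torsion values. *)
Let conn_fun n k z : @conn n k 0 z -> z = 0.
Proof.
move=> [f [e [g [yf zg ef ge]]]].
have [l fl] := hrel0 yf erefl.
pose T k := trans a n l k; have cT : chain T := @trans_chain R a n l.
have [e' e'f e'd] := lift_cob pi_surj fl.
pose w : homod (res_pow a (l + n) k) E :=
  ((e \o T k : {linear _ -> _}) : homod _ _) - (e' : homod _ _).
have wE x : w x = e (T k x) - e' x by [].
have [x|ga gaP] := @cproj R _ k _ _ phi w.
  by apply/pi0; rewrite wE linearB ef e'f subrr.
pose g2 : homod (res_pow a (l + n) k.+1) M :=
  ((g \o T k.+1 : {linear _ -> _}) : homod _ _) -
  ((ga \o cd (res_pow a (l + n)) k : {linear _ -> _}) : homod _ _).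
have g2E x : g2 x = g (T k.+1 x) - ga (cd (res_pow a (l + n)) k x) by [].
have g2K x : g2 x \in kerm phi.
  by apply/kermP; rewrite g2E linearB ge gaP wE cT e'd subr0 subrr.
have cg := hrel_coc zg.
have [g3 g3E] := corestrict g2K.
have cg3 : iscoc (g3 : homod _ _).
  move=> x; apply: val_inj; rewrite g3E g2E cdd linear0 subr0 -cT.
  exact: cg.
have [l' h3] := torsion_cob ker_tors cg3.
have h2 := iscob_comp (sval_lin (kerm phi)) h3.
apply: (hrel_cob (hrel_push l' (hrel_push l zg))).
have h4 : iscob ((ga \o cd (res_pow a (l + n)) k : {linear _ -> _}) :
    homod (res_pow a (l + n) k.+1) M).
  by exists ga.
have h5 := iscob_pull (@trans_chain R a (l + n)%N l') h4.
apply: (@iscobD R (res_pow a (l' + (l + n))) k.+1 M _ _ _ h2 h5) => x.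
rewrite !compE; set u := trans a (l + n) l' k.+1 x.
apply: etrans (esym (subrK (ga (cd (res_pow a (l + n)) k u)) _)) _.
by rewrite -g2E -g3E.
Qed.

(** With [I] the image of [phi], the cohomology of [N] in degree [k] is that of [I]
    in degree [k.+1], because [E] is acyclic; and the latter is that of [M], because
    the torsion kernel has no cohomology in positive degrees. *)
Theorem coker_isom k :
  isom (local_cohomology a k N) (local_cohomology a k.+1 M).
Proof.
exists (fun y z => exists n, @conn n k y z); split.
- split; first by exists 0%N; exact: (conn_lin _ _).1.
  move=> c y z y' z' [n h] [m h']; exists (maxn n m).
  by apply: (conn_lin _ _).2; [apply: conn_push h; rewrite leq_maxl |
    apply: conn_push h'; rewrite leq_maxr].
- by move=> y; have [n [z h]] := conn_total y; exists z, n.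
- by move=> z; have [n [y h]] := conn_surj z; exists y, n.
- by move=> y [n /conn_inj].
- by move=> z [n /conn_fun].
Qed.

End DegreeShift.

(** * Local cohomology as iterated torsion *)

Section MultiplicativeLocalization.
Context (R : comPzRingType) (x : R) (M : lmodType R).

Lemma mul_linear : linear (fun v : M => x *: v).
Proof. by move=> c u v; rewrite scalerDr !scalerA mulrC. Qed.

(** The module of fractions [M_x], as the direct limit of [M] under
    multiplication by [x]; [dlin n v] stands for [v / x^n]. *)
Definition locx : lmodType R := dirlim (fun _ : nat => mklin mul_linear).

Definition locx_frac n : {linear M -> locx} :=
  mklin (@dlin_linear R (fun=> M) (fun=> mklin mul_linear) n).

Lemma dlmap_mul n l (v : M) :
  dlmap (fun _ : nat => mklin mul_linear) n l v = x ^+ l *: v.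
Proof.
elim: l => [|l IH]; first by rewrite scale1r.
by rewrite exprS -scalerA -IH.
Qed.

Lemma locx_frac0 n v : locx_frac n v = 0 <-> exists l, x ^+ l *: v = 0.
Proof.
split=> [/dlin0[l e]|[l e]]; first by exists l; rewrite -e dlmap_mul.
rewrite -[LHS](dlin_pushl (fun=> mklin mul_linear) l) dlmap_mul e.
exact: (linear0 (locx_frac (l + n))).
Qed.

Lemma locx_rep (y : locx) : exists n v, y = locx_frac n v.
Proof. by have [n /(_ n (leqnn n))[v ->]] := dlin_rep y; exists n, v. Qed.

Lemma locx_fracS n v : x *: locx_frac n.+1 v = locx_frac n v.
Proof. by rewrite -linearZ; exact: (dlin_push (fun=> mklin mul_linear)). Qed.

Lemma locx_mul_inj (y : locx) k : x ^+ k *: y = 0 -> y = 0.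
Proof.
have [n [v ->]] := locx_rep y; rewrite -linearZ => /locx_frac0[l].
by rewrite scalerA -exprD => e; apply/locx_frac0; exists (l + k)%N.
Qed.

Lemma locx_mul_surj k (y : locx) : exists z : locx, x ^+ k *: z = y.
Proof.
elim: k y => [|k IH] y; first by exists y; rewrite scale1r.
have [z <-] := IH y; have [n [v ->]] := locx_rep z.
by exists (locx_frac n.+1 v); rewrite exprSr -scalerA locx_fracS.
Qed.

End MultiplicativeLocalization.

Section LocProd.
Context (R : comPzRingType) (s : seq R).
Implicit Types M : lmodType R.

(** The product of the [M_x], for [x] in [s]. The index runs over [nat],
    which is harmless: beyond the size of [s] the factors are [M_0 = 0]. *)
Definition loc_prod M : lmodType R := prodmod (fun j => locx s`_j M).

Lemma to_loc_prod_linear M :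
  linear (fun v => (fun j => locx_frac s`_j M 0 v) : loc_prod M).
Proof.
by move=> c u v; apply: functional_extensionality_dep => j; rewrite linearP.
Qed.

Definition to_loc_prod M : {linear M -> loc_prod M} := mklin (@to_loc_prod_linear M).

(** The functor [N] that lowers cohomological degrees. *)
Definition loc_coker M : lmodType R := qmod (immod (to_loc_prod M)).

Lemma to_loc_prod_ker M v : v \in kerm (to_loc_prod M) <-> v \in gamma s M.
Proof.
split=> [/kermP v0|/gammaP h]; last apply/kermP.
  apply/gammaP => x /(nthP 0)[j js <-]; apply/(locx_frac0 _ 0).
  exact: (congr1 (fun f : loc_prod M => f j) v0).
apply: functional_extensionality_dep => j; apply/locx_frac0.
case: (ltnP j (size s)) => js; first by apply: h; exact: mem_nth.
by exists 1%N; rewrite nth_default// scale0r.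
Qed.

End LocProd.

(** If [y] kills the resolved module, then multiplication by [y] is
    null-homotopic; hence cohomology vanishes when [y] acts bijectively on the
    coefficients. The element [y] may depend on the factor of the product. *)
Lemma prod_acyclic (R : comPzRingType) (X : nat -> lmodType R) (P : pcx R)
    (N : lmodType R) (e : {linear P 0%N -> N}) k (f : homod (P k) (prodmod X)) :
    resolves e ->
    (forall j, exists y : R, [/\ forall z : N, y *: z = 0,
      forall z : X j, y *: z = 0 -> z = 0 &
      forall z : X j, exists w, y *: w = z]) ->
  iscoc f -> iscob f.
Proof.
move=> eP hX cf.
have fL j : linear (fun x => (f x : prodmod X) j).
  by move=> c u v; rewrite linearP.
pose fj j : {linear P k -> X j} := mklin (fL j).
have fjc j : iscob (fj j : homod _ _).
  have [y [yN yinj ysurj]] := hX j.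
  pose t i : {linear P i -> P i} := mklin (@mul_linear R y (P i)).
  have ct : chain t by move=> i x; exact: linearZ.
  have t0 x : e (t 0%N x) = 0.
    by apply: etrans (linearZ_LR e y x) _; exact: yN.
  have cfj : iscoc (fj j : homod _ _).
    by move=> x; exact: (congr1 (fun g : prodmod X => g j) (cf x)).
  have := cob_chain0 eP ct t0 cfj.
  case: k f cf fL @fj {cfj} => [|k] f cf fL fj.
    by move=> h x; apply: yinj; apply: etrans (esym (linearZ_LR (fj j) y x)) (h x).
  move=> [g gP].
  have [g' g'P] := @cproj R P k _ _ (mklin (@mul_linear R y (X j))) g
    (fun x => ysurj (g x)).
  exists (g' : homod _ _) => x; apply/eqP; rewrite -subr_eq0; apply/eqP; apply: yinj.
  rewrite scalerBr; apply/eqP; rewrite subr_eq0; apply/eqP.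
  apply: etrans (esym (linearZ_LR (fj j) y x)) _.
  exact: etrans (gP x) (esym (g'P _)).
case: k f cf fL @fj fjc => [|k] f cf fL fj fjc.
  by move=> x; apply: functional_extensionality_dep => j; exact: fjc.
have {fjc} H j : exists g : {linear P k -> X j}, forall x, fj j x = g (cd P k x).
  by have [g gP] := fjc j; exists g.
pose g j := sval (cid (H j)).
have gE j x : fj j x = g j (cd P k x) by exact: (svalP (cid (H j))).
have gL : linear (fun x => (fun j => g j x) : prodmod X).
  by move=> c u v; apply: functional_extensionality_dep => j; rewrite linearP.
exists (mklin gL : homod _ _) => x.
by apply: functional_extensionality_dep => j; exact: gE.
Qed.

Section IteratedCokernel.
Context (R : comPzRingType) (R_noetherian : noetherian R) (s : seq R).
Implicit Types M : lmodType R.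

Local Notation a := (submod_gen [set` (s : seq R^o)]).

Lemma quo_pow_ann n (x : R) (z : quo_pow a n) : x \in a -> x ^+ n *: z = 0.
Proof.
move=> xa; rewrite -[z]qreprK -linearZ_LR -(linear0 (qpi _)); apply/qpiP.
rewrite subr0 regZ mulrC; apply: (rpredZ (qrepr z : R)); exact: mem_pow.
Qed.

Lemma loc_prod_acyclic M n k (f : homod (res_pow a n k) (loc_prod s M)) :
  iscoc f -> iscob f.
Proof.
apply: prod_acyclic (res_pow_resolves a n) _ => j.
exists (s`_j ^+ n.+1); split.
- move=> z; apply: quo_pow_ann; case: (ltnP j (size s)) => js.
    by apply: mem_gen_seq; exact: mem_nth.
  by rewrite nth_default//; exact: (rpred0 a).
- by move=> z; exact: locx_mul_inj.
- exact: locx_mul_surj.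
Qed.

Lemma loccoh_succ M k :
  isom (local_cohomology a k (loc_coker s M)) (local_cohomology a k.+1 M).
Proof.
apply: (@coker_isom R R_noetherian a M (loc_prod s M) (loc_coker s M) (to_loc_prod s M)
  (qpi (immod (to_loc_prod s M)))).
- move=> v; have /to_loc_prod_ker/gamma_pow[n nP] := valP v.
  exists n => x xn; apply: val_inj.
  exact: etrans (linearZ_LR (sval_lin _) x v) (nP x xn).
- exact: loc_prod_acyclic.
- move=> u; rewrite -(linear0 (qpi _)) qpiP subr0; exact: immodP.
- by move=> w; exists (qrepr w); exact: qreprK.
Qed.

(* The cocycle [f] is the map from [R / a^(n+1)] given by the torsion element
   [m]. *)
Let deg0 M n (y : local_cohomology a 0 M) (m : smod (gamma s M)) :=
  exists2 f : homod (res_pow a n 0) M, hrel y f &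
    forall x r, aug_pow a n x = qpi (ideal_pow a n.+1) r ->
      f x = (r : R) *: val m.

Lemma loccoh0 M : isom (local_cohomology a 0 M) (smod (gamma s M)).
Proof.
have push n m y v : (n <= m)%N -> deg0 n y v -> deg0 (M := M) m y v.
  move=> /subnK <- [f yf fP].
  exists (f \o trans a n (m - n) 0%N : {linear _ -> _}); first exact: hrel_push.
  by move=> x r xr; rewrite compE; apply: fP; exact: trans_aug.
have dL n : linrel (deg0 (M := M) n).
  split=> [|c y v y' v' [f yf fP] [f' yf' fP']].
    exists 0; first exact: (hrel_lin _ _ _ _).1.
    by move=> x r _; rewrite scaler0.
  exists (c *: f + f'); first exact: (hrel_lin _ _ _ _).2.
  move=> x r xr; rewrite sval_linP scalerDr scalerA mulrC -scalerA.
  by rewrite -(fP x r xr) -(fP' x r xr).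
exists (fun y v => exists n, deg0 n y v); split.
- split; first by exists 0%N; exact: (dL _).1.
  move=> c y v y' v' [n h] [n' h']; exists (maxn n n').
  by apply: (dL _).2; [apply: push h; rewrite leq_maxl |
    apply: push h'; rewrite leq_maxr].
- move=> y; have [n /(_ n (leqnn n))[f yf]] := hrel_rep y.
  have [es e0 _] := res_pow_resolves a n.
  have [x1 x1E] := es (qpi (ideal_pow a n.+1) 1).
  have key x r : aug_pow a n x = qpi (ideal_pow a n.+1) r ->
      f x = (r : R) *: f x1.
    move=> xr; have /e0[h hE] : aug_pow a n (x - (r : R) *: x1) = 0.
      rewrite linearB linearZ_LR x1E xr -linearZ_LR regZ mulr1 subrr//.
    apply/eqP; rewrite -subr_eq0 -linearZ_LR -linearB -hE; apply/eqP.
    exact: (hrel_coc yf).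
  have mG : f x1 \in gamma s M.
    apply: (@pow_gamma R s M _ n.+1) => r rn; rewrite -(key 0) ?linear0//.
    by apply/esym; rewrite -(linear0 (qpi _)); apply/qpiP; rewrite subr0.
  by exists (exist _ (f x1) mG), n, f.
- move=> v; have [n nP] := gamma_pow (valP v).
  have [|f cf fP] := cocycle_of_killed (m := val v) (res_pow_resolves a n).
    by move=> r /ideal_powS; exact: nP.
  by have [y yf] := hrel_ex cf; exists y, n, f.
- move=> y [n [f yf fP]]; apply: (hrel_cob yf) => x.
  have [r xr] := aug_pow_pi x.
  by rewrite (fP x r xr) scaler0.
- move=> v [n [f yf fP]]; have [l fl] := hrel0 yf erefl.
  have [es _ _] := res_pow_resolves a (l + n).
  have [x1 x1E] := es (qpi (ideal_pow a (l + n).+1) 1).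
  apply: val_inj; rewrite -[LHS]scale1r -(fP _ _ (trans_aug x1E)).
  exact: fl.
Qed.

(** Local cohomology in degree [i] is the torsion of the [i]-th iterated cokernel;
    this description replaces resolutions by fractions. *)
Theorem loccoh_isom i M :
  isom (local_cohomology a i M) (smod (gamma s (iter i (loc_coker s) M))).
Proof.
elim: i M => [|i IH] M; first exact: loccoh0.
rewrite iterSr; apply: isom_trans (IH _); apply: isom_sym.
exact: loccoh_succ.
Qed.

End IteratedCokernel.

(** * Localization at a prime *)

Section Localization.
Context (R : comPzRingType) (p : spec R).

Definition toloc (r : R) : locR p := frac (r : R^o) (denom1 p).

Lemma frac_eqR (r r' : R) (t t' : denom p) : val t' * r = val t * r' ->
  frac (r : R^o) t = frac (r' : R^o) t'.
Proof. exact: (@frac_eq R p R^o). Qed.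

Lemma locmulE (r r' : R) (t t' : denom p) :
  (frac (r : R^o) t : locR p) * frac (r' : R^o) t' =
  frac (r * r' : R^o) (denomM t t').
Proof. exact: (@locscaleE R p R^o). Qed.

Lemma toloc0 : toloc 0 = 0. Proof. by []. Qed.

Lemma toloc1 : toloc 1 = 1. Proof. by []. Qed.

Lemma tolocM r r' : toloc (r * r') = toloc r * toloc r'.
Proof. rewrite [RHS]locmulE; apply: frac_eqR; rewrite /=; ring. Qed.

Lemma tolocD r r' : toloc (r + r') = toloc r + toloc r'.
Proof.
rewrite [RHS]fracD; apply: frac_eqR; rewrite /= !regZ; ring.
Qed.

Lemma tolocX r n : toloc (r ^+ n) = toloc r ^+ n.
Proof.
elim: n => [|n IH]; first by rewrite !expr0 toloc1.
by rewrite exprS tolocM IH -exprS.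
Qed.

Lemma toloc_inv r : r \notin (p : ideal R) -> exists u, u * toloc r = 1.
Proof.
move=> rp; exists (frac (1 : R^o) (exist _ r rp)).
by rewrite locmulE; apply: frac_eqR; rewrite /=; ring.
Qed.

Lemma toloc_rep z : exists t r, t \notin (p : ideal R) /\ toloc t * z = toloc r.
Proof.
have [r [t ->]] := fracW z; exists (val t), r; split; first exact: (valP t).
by rewrite locmulE; apply: frac_eqR; rewrite /=; ring.
Qed.

Lemma mem_denomM s t : s \notin (p : ideal R) -> t \notin (p : ideal R) ->
  s * t \notin (p : ideal R).
Proof.
have [_ pM] := specP p.
by move=> sp tp; apply/negP => /pM[] h; [rewrite h in sp | rewrite h in tp].
Qed.

Lemma mem_denom1 : 1 \notin (p : ideal R).
Proof. by have [] := specP p. Qed.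

Lemma toloc_cancel (Y : lmodType (locR p)) r (y : Y) : r \notin (p : ideal R) ->
  toloc r *: y = 0 -> y = 0.
Proof.
move=> /toloc_inv[u uE] e; rewrite -[y]scale1r -uE -scalerA e.
exact: scaler0.
Qed.

(** [locrel rho]: the relation [rho x y], read as [y = x / 1], exhibits [Y] as
    the localization of [X] at [p]. *)
Record locrel (X : lmodType R) (Y : lmodType (locR p)) (rho : X -> Y -> Prop) :
    Prop := LocRel {
  locrel00 : rho 0 0;
  locrelP : forall r x y x' y', rho x y -> rho x' y' ->
    rho (r *: x + x') (toloc r *: y + y');
  locrel_total : forall x, exists y, rho x y;
  locrel_fun : forall y, rho 0 y -> y = 0;
  locrel_ker : forall x, rho x 0 ->
    exists2 s : R, s \notin (p : ideal R) & s *: x = 0;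
  locrel_surj : forall y, exists (s : R) x,
    s \notin (p : ideal R) /\ rho x (toloc s *: y) }.

Definition is_loc X Y : Prop := exists rho, @locrel X Y rho.

Lemma locrelZ X Y rho r x y : @locrel X Y rho -> rho x y ->
  rho (r *: x) (toloc r *: y).
Proof.
by move=> h xy; have := locrelP h r xy (locrel00 h); rewrite !addr0.
Qed.

Lemma locrelB X Y rho x y x' y' : @locrel X Y rho -> rho x y -> rho x' y' ->
  rho (x - x') (y - y').
Proof.
move=> h xy xy'; have := locrelP h (-1) xy' xy.
have -> : toloc (-1) = -1.
  by apply/eqP; rewrite -subr_eq0 opprK -toloc1 -tolocD addNr.
by rewrite !scaleN1r ![- _ + _]addrC.
Qed.

Lemma locrel_uniq X Y rho x y y' : @locrel X Y rho -> rho x y -> rho x y' ->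
  y = y'.
Proof.
move=> h xy xy'; apply/eqP; rewrite -subr_eq0; apply/eqP.
by apply: (locrel_fun h); rewrite -(subrr x); exact: locrelB.
Qed.

Lemma is_loc_locmod M : is_loc M (locmod p M).
Proof.
exists (fun m y => y = frac m (denom1 p)).
have scl r (m : M) t : toloc r *: frac m t = frac (r *: m) t.
  apply: etrans (locscaleE _ _ _ _) _; apply: frac_eq.
  by rewrite /= mul1r.
split=> [//|r m y m' y' -> ->|m|y ->//|m|y].
- rewrite scl fracD; apply: frac_eq.
  by rewrite /= !scalerDr !scalerA !mulr1 !mul1r.
- by exists (frac m (denom1 p)).
- move=> /esym/fracP[u up]; rewrite scaler0 /= mulr1 => e.
  by exists u.
- have [m [t ->]] := fracW y; exists (val t), m; split; first exact: (valP t).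
  rewrite scl; apply: frac_eq.
  by rewrite /= scale1r.
Qed.

Lemma is_loc_isom X X' Y Y' : isom X' X -> isom Y Y' -> is_loc X Y ->
  is_loc X' Y'.
Proof.
move=> [q [qL qt qs qi qj]] [r [rL rt rs ri rj]] [rho h].
exists (fun x' y' => exists x y, [/\ q x' x, rho x y & r y y']); split.
- by exists 0, 0; split; [exact: qL.1 | exact: locrel00 h | exact: rL.1].
- move=> c x' y' z' w' [x [y [qx xy ry]]] [z [w [qz zw rw]]].
  exists (c *: x + z), (toloc c *: y + w).
  by split; [exact: qL.2 | exact: locrelP | exact: rL.2].
- move=> x'; have [x qx] := qt x'; have [y xy] := locrel_total h x.
  by have [y' ry] := rt y; exists y', x, y.
- move=> y' [x [y [/qj -> /(locrel_fun h) -> ]]].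
  exact: rj.
- move=> x' [x [y [qx + /ri y0]]]; rewrite y0 => /(locrel_ker h)[s sp sx].
  exists s => //; apply: qi; rewrite -sx; exact: linrelZ.
- move=> y'; have [y ry] := rs y'; have [s [x [sp xy]]] := locrel_surj h y.
  have [x' qx] := qs x; exists s, x'; split=> //; exists x, (toloc s *: y).
  by split=> //; exact: linrelZ.
Qed.

(** Finitely many denominators have a common multiple. *)
Lemma common_denom (Q : nat -> R -> Prop) n :
    (forall j c s, Q j s -> Q j (c * s)) ->
    (forall j, (j < n)%N -> exists2 s : R, s \notin (p : ideal R) & Q j s) ->
  exists2 s : R, s \notin (p : ideal R) & forall j, (j < n)%N -> Q j s.
Proof.
move=> QM; elim: n => [|n IH] h; first by exists 1; first exact: mem_denom1.
have [j jn|s sp sQ] := IH; first by apply: h; exact: ltnW.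
have [t tp tQ] := h n (ltnSn n).
exists (s * t); first exact: mem_denomM.
move=> j; rewrite ltnS leq_eqVlt => /orP[/eqP->|jn]; first exact: QM.
by rewrite mulrC; apply: QM; exact: sQ.
Qed.

Section LocX.
Context (X : lmodType R) (Y : lmodType (locR p)) (rho : X -> Y -> Prop).
Context (x : R) (x' : locR p) (xE : x' = toloc x).

Definition locx_rel (u : locx x X) (v : locx x' Y) : Prop :=
  exists n m y, [/\ u = locx_frac x X n m, v = locx_frac x' Y n y & rho m y].

Hypothesis h : locrel rho.

Let push n l m : locx_frac x X n m = locx_frac x X (l + n) (x ^+ l *: m).
Proof.
by rewrite -[LHS](dlin_pushl (fun=> mklin (mul_linear x (M := X))) l) dlmap_mul.
Qed.

Let push' n l y : locx_frac x' Y n y = locx_frac x' Y (l + n) (x' ^+ l *: y).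
Proof.
by rewrite -[LHS](dlin_pushl (fun=> mklin (mul_linear x' (M := Y))) l) dlmap_mul.
Qed.

Let rhoX l m y : rho m y -> rho (x ^+ l *: m) (x' ^+ l *: y).
Proof. by rewrite xE -tolocX; exact: locrelZ. Qed.

Lemma locx_locrel : locrel locx_rel.
Proof.
split.
- exists 0%N, 0, 0; rewrite !linear0; split=> //; exact: locrel00 h.
- move=> r _ _ _ _ [n [m [y [-> -> my]]]] [n' [m' [y' [-> -> my']]]].
  exists (n + n')%N, (r *: (x ^+ n' *: m) + x ^+ n *: m'),
    (toloc r *: (x' ^+ n' *: y) + x' ^+ n *: y'); split.
  + by rewrite linearP (push n n') (push n' n) [(n' + n)%N]addnC.
  + by rewrite linearP (push' n n') (push' n' n) [(n' + n)%N]addnC.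
  + by apply: (locrelP h); exact: rhoX.
- move=> u; have [n [m ->]] := locx_rep u; have [y my] := locrel_total h m.
  by exists (locx_frac x' Y n y), n, m, y.
- move=> _ [n [m [y [/esym/locx_frac0[l lm] -> my]]]].
  apply/locx_frac0; exists l; apply: (locrel_fun h); rewrite -lm; exact: rhoX.
- move=> _ [n [m [y [-> /esym/locx_frac0[l ly] my]]]].
  have [|s sp sm] := locrel_ker h (x := x ^+ l *: m).
    by rewrite -ly; exact: rhoX.
  exists s => //; rewrite -linearZ.
  apply/locx_frac0; exists l.
  by rewrite -sm !scalerA mulrC.
- move=> v; have [n [y ->]] := locx_rep v.
  have [s [m [sp my]]] := locrel_surj h y.
  exists s, (locx_frac x X n m); split=> //; exists n, m, (toloc s *: y).
  by rewrite linearZ.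
Qed.

End LocX.

Lemma nth_toloc (s : seq R) j : (map toloc s)`_j = toloc s`_j.
Proof.
case: (ltnP j (size s)) => js; first by rewrite (nth_map 0).
by rewrite !nth_default ?size_map// toloc0.
Qed.

Section LocProd.
Context (X : lmodType R) (Y : lmodType (locR p)) (rho : X -> Y -> Prop).
Hypothesis h : locrel rho.
Context (s : seq R).

Let s' := map toloc s.

Definition loc_prod_rel (u : loc_prod s X) (v : loc_prod s' Y) : Prop :=
  forall j, locx_rel rho (u j) (v j).

Let hj j := locx_locrel (nth_toloc s j) h.

Let cover0 j (u : locx s`_j X) : (size s <= j)%N -> u = 0.
Proof.
move=> js; have [n [m ->]] := locx_rep u; apply/locx_frac0; exists 1%N.
by rewrite nth_default// scale0r.
Qed.

Let cover0' j (v : locx s'`_j Y) : (size s <= j)%N -> v = 0.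
Proof.
move=> js; have [n [m ->]] := locx_rep v; apply/locx_frac0; exists 1%N.
by rewrite nth_default ?size_map// scale0r.
Qed.

(** Infinite products do not commute with localization, but here only the first
    [size s] factors are nonzero, and these have common denominators. *)
Lemma loc_prod_locrel : locrel loc_prod_rel.
Proof.
split.
- by move=> j; exact: locrel00 (hj j).
- by move=> r u v u' v' uv uv' j; exact: locrelP (hj j) _ _ _ _ _ (uv j) (uv' j).
- move=> u; pose v : loc_prod s' Y := fun j => sval (cid (locrel_total (hj j) (u j))).
  by exists v => j; exact: svalP (cid (locrel_total (hj j) (u j))).
- move=> v v0; apply: functional_extensionality_dep => j.
  exact: locrel_fun (hj j) _ (v0 j).
- move=> u u0; have [||t tp tP] := @common_denom (fun j t => t *: u j = 0) (size s).
  + by move=> j c t e; rewrite -scalerA e scaler0.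
  + by move=> j _; exact: locrel_ker (hj j) _ (u0 j).
  exists t => //; apply: functional_extensionality_dep => j.
  case: (ltnP j (size s)) => [/tP//|/cover0]; exact.
- move=> v; pose Q j t := exists u : locx s`_j X, locx_rel rho u (toloc t *: v j).
  have QM j c t : Q j t -> Q j (c * t).
    move=> [u uv]; exists (c *: u); rewrite tolocM -scalerA.
    exact: locrelZ (hj j) uv.
  have Qex j : (j < size s)%N -> exists2 t : R, t \notin (p : ideal R) & Q j t.
    move=> _; have [t [u [tp uv]]] := locrel_surj (hj j) (v j).
    by exists t => //; exists u.
  have [t tp tP] := common_denom QM Qex.
  have H j : exists u : locx s`_j X, locx_rel rho u (toloc t *: v j).
    case: (ltnP j (size s)) => [/tP//|js]; exists 0.
    by rewrite (cover0' (v j) js) scaler0; exact: locrel00 (hj j).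
  pose u : loc_prod s X := fun j => sval (cid (H j)).
  by exists t, u; split=> // j; exact: svalP (cid (H j)).
Qed.

Lemma to_loc_prod_rel m y : rho m y -> loc_prod_rel (to_loc_prod s X m) (to_loc_prod s' Y y).
Proof. by move=> my j; exists 0%N, m, y. Qed.

Lemma loc_coker_is_loc : is_loc (loc_coker s X) (loc_coker s' Y).
Proof.
have hc := loc_prod_locrel.
pose pi := qpi (immod (to_loc_prod s X)); pose pi' := qpi (immod (to_loc_prod s' Y)).
have pi0 u : pi u = 0 <-> exists m, to_loc_prod s X m = u.
  by rewrite -(linear0 pi) qpiP subr0; exact: immodP.
have pi0' u : pi' u = 0 <-> exists m, to_loc_prod s' Y m = u.
  by rewrite -(linear0 pi') qpiP subr0; exact: immodP.
exists (fun u v => exists x y, [/\ u = pi x, v = pi' y & loc_prod_rel x y]); split.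
- by exists 0, 0; rewrite !linear0; split=> //; exact: locrel00 hc.
- move=> r _ _ _ _ [x [y [-> -> xy]]] [x' [y' [-> -> xy']]].
  exists (r *: x + x'), (toloc r *: y + y'); rewrite !linearP.
  by split=> //; exact: locrelP hc _ _ _ _ _ xy xy'.
- move=> u; have [x <-] := qpi_surj u; have [y xy] := locrel_total hc x.
  by exists (pi' y), x, y.
- move=> _ [x [y [/esym/pi0[m mx] -> xy]]]; apply/pi0'.
  have [z mz] := locrel_total h m; exists z.
  by apply: locrel_uniq hc (to_loc_prod_rel mz) _; rewrite mx.
- move=> _ [x [y [-> /esym/pi0'[z zy] xy]]].
  have [t [m [tp mz]]] := locrel_surj h z.
  have := locrelB hc (locrelZ t hc xy) (to_loc_prod_rel mz).
  rewrite linearZ zy subrr => /(locrel_ker hc)[c cp cE].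
  exists (c * t); first exact: mem_denomM.
  rewrite -linearZ; apply/pi0; exists (c *: m); rewrite linearZ.
  by apply/eqP; rewrite eq_sym -subr_eq0 -scalerA -scalerBr cE.
- move=> v; have [y <-] := qpi_surj v.
  have [t [x [tp xy]]] := locrel_surj hc y.
  exists t, (pi x); split; first exact: tp.
  exists x, (toloc t *: y); split; [by [] | | exact: xy].
  exact: esym (linearZ_LR pi' _ _).
Qed.

Lemma gamma_is_loc : is_loc (smod (gamma s X)) (smod (gamma s' Y)).
Proof.
exists (fun u v => rho (sval u) (sval v)); split.
- exact: locrel00 h.
- by move=> r u v u' v' uv uv'; rewrite !smod_svalD; exact: locrelP.
- move=> u; have [y uy] := locrel_total h (sval u).
  have yG : y \in gamma s' Y.
    apply/gammaP => _ /mapP[x xs ->].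
    have [k ku] := (gammaP _ _).1 (smod_svalP u) x xs; exists k.
    apply: (locrel_fun h); rewrite -ku -tolocX; exact: locrelZ.
  by exists (exist _ y yG).
- by move=> v /(locrel_fun h) v0; exact: smod_sval_inj.
- move=> u /(locrel_ker h)[t tp tu]; exists t => //; apply: smod_sval_inj.
  by rewrite smod_svalZ.
- move=> v; have := smod_svalP v; have := smod_svalZ _ v; move: (sval v) => y vZ yG.
  have [t [x [tp xy]]] := locrel_surj h y.
  pose Q j c := exists k, s`_j ^+ k *: (c *: x) = 0.
  have QM j c d : Q j d -> Q j (c * d).
    move=> [k kE]; exists k; rewrite -[(c * d) *: x]scalerA.
    by rewrite scaleAC kE scaler0.
  have Qex j : (j < size s)%N -> exists2 c : R, c \notin (p : ideal R) & Q j c.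
    move=> js; have [k kE] := (gammaP _ _).1 yG _ (map_f toloc (mem_nth 0 js)).
    have [|c cp cE] := locrel_ker h (x := s`_j ^+ k *: x).
      have := locrelZ (s`_j ^+ k) h xy.
      by rewrite scaleAC tolocX kE scaler0.
    by exists c => //; exists k; rewrite scaleAC.
  have [c cp cP] := common_denom QM Qex.
  have xG : c *: x \in gamma s X by apply/gammaP => z /(nthP 0)[j js <-]; exact: cP.
  exists (c * t), (exist _ (c *: x) xG); split; first exact: mem_denomM.
  rewrite vZ tolocM -scalerA; exact: locrelZ.
Qed.

End LocProd.

Lemma iter_loc_coker_is_loc s X Y i : is_loc X Y ->
  is_loc (iter i (loc_coker s) X) (iter i (loc_coker (map toloc s)) Y).
Proof.
move=> h; elim: i => [//|i [rho IH]]; exact: loc_coker_is_loc IH s.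
Qed.

Lemma ideal_loc_gen (s : seq R) :
  ideal_loc p (submod_gen [set` (s : seq R^o)]) =
  submod_gen [set` (map toloc s : seq (locR p)^o)].
Proof.
apply: submod_ext => z; apply/idP/idP; last first.
  apply: gen_seq_sub => _ /mapP[x xs ->]; apply: sub_submod_gen.
  by exists x => //; exact: mem_gen_seq.
apply: submod_gen_sub => _ [r rs ->].
pose J := submod_gen [set` (map toloc s : seq (locR p)^o)].
pose P (r : R^o) : Prop := (toloc r : (locR p)^o) \in J.
have P0 : P 0 by exact: (rpred0 J).
have PZD c u v : P u -> P v -> P (c *: u + v).
  move=> Pu Pv; rewrite /P tolocD regZ tolocM; apply: (rpredD (S := J)) => //.
  exact: (rpredZ (toloc c) Pu).
have sub : {subset submod_gen [set` (s : seq R^o)] <= mksubmod P0 PZD}.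
  apply: gen_seq_sub => x xs.
  by apply/(mksubmodP P0 PZD); apply: mem_gen_seq; exact: map_f.
exact/(mksubmodP P0 PZD)/sub.
Qed.

(** An ideal of [R_p] is generated by its contraction to [R]. *)
Lemma locR_noetherian : noetherian R -> noetherian (locR p).
Proof.
move=> nR J.
pose P (r : R^o) : Prop := (toloc r : (locR p)^o) \in J.
have P0 : P 0 by exact: (rpred0 J).
have PZD c u v : P u -> P v -> P (c *: u + v).
  move=> Pu Pv; rewrite /P tolocD regZ tolocM; apply: (rpredD (S := J)) => //.
  exact: (rpredZ (toloc c) Pu).
have [s sP] := nR (mksubmod P0 PZD).
exists (map toloc s) => z; apply/idP/idP; last first.
  apply: gen_seq_sub => _ /mapP[x xs ->].
  by apply/(mksubmodP P0 PZD); rewrite sP; exact: mem_gen_seq.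
move=> zJ; have [t [r [tp tz]]] := toloc_rep z.
have rJ : r \in submod_gen [set` (s : seq R^o)].
  rewrite -sP; apply/(mksubmodP P0 PZD); rewrite /P -tz.
  exact: (rpredZ (toloc t) zJ).
have : (toloc r : (locR p)^o) \in ideal_loc p (submod_gen [set` (s : seq R^o)]).
  by apply: sub_submod_gen; exists r.
rewrite ideal_loc_gen -tz => /(rpredZ (sval (cid (toloc_inv tp)))).
by rewrite regZ mulrA (svalP (cid (toloc_inv tp))) mul1r.
Qed.

(** Local cohomology commutes with localization, because iterated cokernels and
    torsion submodules do. *)
Theorem loccoh_is_loc (a : ideal R) i M : noetherian R ->
  is_loc (local_cohomology a i M)
    (local_cohomology (ideal_loc p a) i (locmod p M)).
Proof.
move=> nR; have [s ->] := noetherian_gen a nR.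
rewrite ideal_loc_gen.
apply: is_loc_isom (loccoh_isom nR s i M) _ _.
  exact: isom_sym (loccoh_isom (locR_noetherian nR) (map toloc s) i (locmod p M)).
have [rho h] := iter_loc_coker_is_loc s i (is_loc_locmod M).
exact: gamma_is_loc h s.
Qed.

End Localization.

(** * Finiteness of the elements killed by the ideal *)

Section FiniteResolution.
Context (R : comPzRingType) (R_noetherian : noetherian R).
Implicit Types M V : lmodType R.

(** The free modules of the canonical resolution need not have finite rank. Over a
    noetherian ring a finitely generated module also has a resolution by finite
    free modules, and maps from those to a noetherian module form a noetherian
    module. *)
Definition fgmod : Type := {N : lmodType R | finitely_generated N}.

Implicit Types N : fgmod.

Definition cover_size (N : fgmod) : nat := sval (cid (fg_cover (svalP N))).

Definition cover_map (N : fgmod) :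
    {linear freemod R 'I_(cover_size N) -> sval N} :=
  sval (cid (svalP (cid (fg_cover (svalP N))))).

Lemma cover_map_surj N x : exists h, cover_map N h = x.
Proof. exact: svalP (cid (svalP (cid (fg_cover (svalP N))))) x. Qed.

Definition fgsyz (N : fgmod) : fgmod :=
  exist (fun N : lmodType R => finitely_generated N) (smod (kerm (cover_map N)))
    (fg_ker R_noetherian (cover_map N) (freemod_fg R 'I_(cover_size N))).

Definition fgres_cm (N : fgmod) k : lmodType R :=
  freemod R 'I_(cover_size (iter k fgsyz N)).

Definition fgres_cd N k : {linear fgres_cm N k.+1 -> fgres_cm N k} :=
  sval_lin (kerm (cover_map (iter k fgsyz N))) \o
  cover_map (iter k.+1 fgsyz N).

Lemma fgres_exact N k (h : fgres_cm N k) :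
  cover_map (iter k fgsyz N) h = 0 <-> exists h', fgres_cd N k h' = h.
Proof.
split=> [h0|[h' <-]]; last exact/kermP/smod_svalP.
have hk : h \in kerm (cover_map (iter k fgsyz N)) by exact/kermP.
have [h' e] := @cover_map_surj (iter k.+1 fgsyz N) (exist _ h hk).
by exists h'; exact: (congr1 sval e).
Qed.

Lemma fgres_cd0 N k (h : fgres_cm N k.+1) :
  fgres_cd N k h = 0 <-> cover_map (iter k.+1 fgsyz N) h = 0.
Proof.
split=> [e|e]; first exact: smod_sval_inj.
exact: etrans (congr1 (sval_lin _) e) (linear0 (sval_lin _)).
Qed.

Lemma fgres_dd N k x : fgres_cd N k (fgres_cd N k.+1 x) = 0.
Proof. by apply/fgres_cd0/fgres_exact; exists x. Qed.

Definition fgres N : pcx R :=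
  @Pcx R (fgres_cm N) (fgres_cd N) (@fgres_dd N)
    (fun k => @freemod_projective R _).

Lemma fgres_resolves N : @resolves R (fgres N) _ (cover_map N).
Proof.
split; [exact: cover_map_surj | exact: (@fgres_exact N 0) |].
by move=> k h /fgres_cd0/fgres_exact.
Qed.

Lemma noeth_hom n M : noeth_mod M -> noeth_mod (homod (freemod R 'I_n) M).
Proof.
move=> nM U.
have evL (i : 'I_n) :
    linear (fun f : homod (freemod R 'I_n) M => f (freegen R i)) by [].
apply: (@sfg_maps R _ M _ (fun i => mklin (evL i)) (enum 'I_n)) => [i I _ _|K KU].
  exact: nM.
apply: sfg0 => f /KU[_ f0]; apply: linear_ext => x.
apply: (@freemod_ext R 'I_n M f (0 : homod _ _)) x => i.
by apply: (f0 i); rewrite mem_enum.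
Qed.

End FiniteResolution.

Section Cohomology.
Context (R : comPzRingType) (P : pcx R) (k : nat) (M : lmodType R).

Let cocP0 : @iscoc R P k M 0. Proof. by []. Qed.

Let cocPZD c (f g : homod (P k) M) : iscoc f -> iscoc g -> iscoc (c *: f + g).
Proof.
move=> cf cg x; rewrite -[LHS]/(c *: f (cd P k x) + g (cd P k x)).
by rewrite cf cg scaler0 addr0.
Qed.

Let cobP0 : @iscob R P k M 0.
Proof. by case: k => [//|k']; exists 0. Qed.

Let cobPZD c (f g : homod (P k) M) : iscob f -> iscob g -> iscob (c *: f + g).
Proof.
case: k f g => [|k'] f g.
  move=> f0 g0 x; rewrite -[LHS]/(c *: f x + g x).
  by rewrite f0 g0 scaler0 addr0.
move=> [f' fE] [g' gE]; exists (c *: f' + g') => x.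
by rewrite -[LHS]/(c *: f x + g x) fE gE.
Qed.

(** The cohomology of the complex [Hom(P, M)] in degree [k]. *)
Definition coh : lmodType R := subquot (mksubmod cocP0 cocPZD) (mksubmod cobP0 cobPZD).

Definition cohrel (y : coh) (f : homod (P k) M) : Prop := sqrel y f.

Lemma cohrel_lin : linrel cohrel. Proof. exact: sqrel_lin. Qed.

Lemma cohrel_total y : exists f, cohrel y f. Proof. exact: sqrel_total. Qed.

Lemma cohrel_coc y f : cohrel y f -> iscoc f.
Proof. by move=> /sqrel_mem h; apply/(mksubmodP cocP0 cocPZD). Qed.

Lemma cohrel_ex f : iscoc f -> exists y, cohrel y f.
Proof. by move=> h; apply: sqrel_ex; apply/(mksubmodP cocP0 cocPZD). Qed.

Lemma cohrel0 y f : cohrel y f -> y = 0 <-> iscob f.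
Proof.
move=> h; apply: iff_trans (sqrel0 h) _; exact: (mksubmodP cobP0 cobPZD).
Qed.

Lemma noeth_coh : noeth_mod (homod (P k) M) -> noeth_mod coh.
Proof.
move=> nH; apply: (noeth_inj cohrel_lin cohrel_total nH) => y y0.
exact/(cohrel0 y0).
Qed.

End Cohomology.

Section CohomologyStep.
Context (R : comPzRingType) (P : pcx R).
Context (M E N : lmodType R) (phi : {linear M -> E}) (pi : {linear E -> N}).
Hypothesis pi0 : forall u, pi u = 0 <-> exists v, phi v = u.
Hypothesis pi_surj : forall w, exists u, pi u = w.
Hypothesis E_acyclic : forall k (f : homod (P k) E), iscoc f -> iscob f.
Hypothesis noeth_M : forall k, noeth_mod (coh P k M).
Hypothesis noeth_ker : forall k, noeth_mod (coh P k (smod (kerm phi))).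

(* The data of the connecting map, for representatives. *)
Let lift k (f : homod (P k) N) (e : {linear P k -> E})
    (g : {linear P k.+1 -> M}) : Prop :=
  (forall x, pi (e x) = f x) /\ (forall x, phi (g x) = e (cd P k x)).

Let lift0 k : @lift k 0 (0 : homod _ _) (0 : homod _ _).
Proof. by split=> x; rewrite linear0. Qed.

Let liftZD k c f (e : homod _ _) (g : homod _ _) f' (e' : homod _ _)
    (g' : homod _ _) : @lift k f e g -> lift f' e' g' ->
  lift (c *: f + f') (c *: e + e' : homod _ _) (c *: g + g' : homod _ _).
Proof.
move=> [ef ge] [ef' ge']; split=> x.
  by apply: etrans (linearP pi c (e x) (e' x)) _; rewrite ef ef'.
by apply: etrans (linearP phi c (g x) (g' x)) _; rewrite ge ge'.
Qed.

(* The obstruction to making [g] a cocycle: the connecting map followed by that of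
   [kerm phi -> M]. *)
Let obstr k (y : coh P k N) (w : coh P k.+2 (smod (kerm phi))) : Prop :=
  exists f (e : homod _ _) (g : homod _ _) h, [/\ cohrel y f, cohrel w h,
    lift f e g & forall x, sval (h x) = g (cd P k.+1 x)].

Let obstr_lin k : linrel (@obstr k).
Proof.
split.
  exists 0, 0, 0, 0; split; [| | exact: lift0 | by []].
    exact: (@cohrel_lin _ _ _ _).1.
  exact: (@cohrel_lin _ _ _ _).1.
move=> c y w y' w' [f [e [g [h [yf wh l hg]]]]].
move=> [f' [e' [g' [h' [yf' wh' l' hg']]]]].
exists (c *: f + f'), (c *: e + e'), (c *: g + g'), (c *: h + h'); split.
- exact: (@cohrel_lin _ _ _ _).2.
- exact: (@cohrel_lin _ _ _ _).2.
- exact: liftZD.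
- by move=> x; apply: etrans (smod_svalD c (h x) (h' x)) _; rewrite hg hg'.
Qed.

Let obstr_total k y : exists w, @obstr k y w.
Proof.
have [f yf] := cohrel_total y; have cf := cohrel_coc yf.
have [e ef] := @cproj R P k _ _ pi f (fun x => pi_surj (f x)).
have [x|g ge] := @cproj R P k.+1 _ _ phi (e \o cd P k).
  by apply/pi0; rewrite ef; exact: cf.
have gK x : (g \o cd P k.+1) x \in kerm phi.
  by apply/kermP; rewrite /= ge /= cdd linear0.
have [h hE] := corestrict gK.
have ch : iscoc (h : homod (P k.+2) (smod (kerm phi))).
  move=> x; apply: smod_sval_inj; have := hE (cd P k.+2 x).
  by rewrite /= cdd linear0.
have [w wh] := cohrel_ex ch.
by exists w, f, e, g, h.
Qed.

Let conn k (y : coh P k N) (z : coh P k.+1 M) : Prop :=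
  exists f (e : homod _ _) g, [/\ cohrel y f, cohrel z g & lift f e g].

Let conn_lin k : linrel (@conn k).
Proof.
split.
  exists 0, 0, 0; split; last exact: lift0.
    exact: (@cohrel_lin _ _ _ _).1.
  exact: (@cohrel_lin _ _ _ _).1.
move=> c y z y' z' [f [e [g [yf zg l]]]] [f' [e' [g' [yf' zg' l']]]].
exists (c *: f + f'), (c *: e + e'), (c *: g + g'); split.
- exact: (@cohrel_lin _ _ _ _).2.
- exact: (@cohrel_lin _ _ _ _).2.
- exact: liftZD.
Qed.

(** The classes without obstruction inject into the cohomology of [M] in the next
    degree, as that of [E] vanishes, and obstructions are classes of [kerm phi]. *)
Lemma noeth_coh_coker k : noeth_mod (coh P k N).
Proof.
refine (noeth_rel (@obstr_lin k) (@obstr_total k) (@noeth_ker k.+2) _) => K K0.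
apply: (sfg_rel (@conn_lin k)) => [y /K0|I _|L LK].
- move=> [f [e [g [h [yf w0 [ef ge] hg]]]]].
  have [ga gaE] := (cohrel0 w0).1 erefl.
  pose g' : homod (P k.+1) M :=
    g - ((sval_lin (kerm phi) \o ga : {linear _ -> _}) : homod _ _).
  have g'E x : g' x = g x - sval (ga x) by [].
  have cg' : iscoc g' by move=> x; rewrite g'E -gaE hg subrr.
  have [z zg'] := cohrel_ex cg'; exists z, f, e, g'; split=> //; split=> // x.
  by rewrite g'E linearB ge ((kermP _ _).1 (smod_svalP (ga x))) subr0.
- exact: noeth_M.
- apply: sfg0 => y /LK[_ [f [e [g [yf z0 [ef ge]]]]]].
  have [ga gaE] := (cohrel0 z0).1 erefl.
  pose w : homod (P k) E := e - ((phi \o ga : {linear _ -> _}) : homod _ _).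
  have wE x : w x = e x - phi (ga x) by [].
  have cw : iscoc w by move=> x; rewrite wE -ge -gaE subrr.
  have pw := iscob_comp pi (E_acyclic cw).
  apply/(cohrel0 yf).
  have -> // : f = (pi \o w : {linear _ -> _}).
  apply: linear_ext => x; rewrite -[RHS]/(pi (w x)) wE linearB ef.
  by rewrite (iffRL (pi0 _)) ?subr0//; eexists.
Qed.

End CohomologyStep.

Section AnnihilatedFinite.
Context (R : comPzRingType) (R_noetherian : noetherian R) (s : seq R).
Implicit Types M : lmodType R.

Local Notation a := (submod_gen [set` (s : seq R^o)]).

Let fgR : finitely_generated R^o. Proof. exact: noeth_fg. Qed.

Let Ra_fg : finitely_generated (qmod a).
Proof.
have [t tP] := fgR; exists (map (qpi a) t) => y; have [x <-] := qpi_surj y.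
apply/premodP; move: (tP x); apply: gen_seq_sub => u ut; apply/premodP.
by apply: mem_gen_seq; exact: map_f.
Qed.

Let Ra : fgmod R := exist (fun N : lmodType R => finitely_generated N) (qmod a) Ra_fg.
Let L := fgres R_noetherian Ra.
Let eL : {linear L 0%N -> qmod a} := cover_map Ra.
Let LP : resolves eL. Proof. exact: fgres_resolves. Qed.

Let noeth_cohL k M : noeth_mod M -> noeth_mod (coh L k M).
Proof. by move=> nM; apply: noeth_coh; apply: noeth_hom. Qed.

Let L_acyclic M k (f : homod (L k) (loc_prod s M)) : iscoc f -> iscob f.
Proof.
apply: prod_acyclic LP _ => j; exists s`_j; split.
- move=> z; have [r <-] := qpi_surj z; rewrite -linearZ; apply/qpi0.
  rewrite regZ mulrC; apply: (rpredZ (r : R)).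
  case: (ltnP j (size s)) => js; first by apply: mem_gen_seq; exact: mem_nth.
  by rewrite nth_default//; exact: (rpred0 a).
- by move=> z; exact: (@locx_mul_inj _ _ _ z 1).
- exact: (@locx_mul_surj _ _ _ 1).
Qed.

Lemma noeth_coh_iter M i : noeth_mod M ->
    (forall j, (j < i)%N ->
      noeth_mod (smod (gamma s (iter j (loc_coker s) M)))) ->
  forall k, noeth_mod (coh L k (iter i (loc_coker s) M)).
Proof.
move=> nM; elim: i => [|i IH] nG k; first exact: noeth_cohL.
have {}IH := IH (fun j ji => nG j (ltnW ji)).
set X := iter i _ M in IH nG *.
apply: (@noeth_coh_coker R L X (loc_prod s X) _ (to_loc_prod s X)
  (qpi (immod (to_loc_prod s X)))) => [u|w|||k'].
- by apply: iff_trans (qpi0 _ _) _; exact: immodP.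
- exact: qpi_surj.
- exact: L_acyclic.
- exact: IH.
- apply: noeth_cohL.
  have -> : kerm (to_loc_prod s X) = gamma s X.
    by apply: submod_ext => v; apply/idP/idP => /to_loc_prod_ker.
  exact: nG.
Qed.

(** The elements killed by [a] are the maps from [R / a], that is, the cohomology
    of degree zero for a resolution of [R / a], which [noeth_coh_iter] controls. *)
Lemma killed_sfg M i (K : submodClosed (iter i (loc_coker s) M)) :
    noeth_mod M ->
    (forall j, (j < i)%N ->
      noeth_mod (smod (gamma s (iter j (loc_coker s) M)))) ->
    (forall u x, u \in K -> x \in s -> x *: u = 0) -> sfg K.
Proof.
move=> nM nG Ks; have nC : noeth_mod (coh L 0 (iter i (loc_coker s) M)).
  exact: noeth_coh_iter.
set X := iter i _ M in K Ks nC *.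
pose rho (u : X) (y : coh L 0 X) := exists2 f, cohrel y f &
  forall x r, eL x = qpi a r -> f x = (r : R) *: u.
have rhoL : linrel rho.
  split=> [|c u y u' y' [f yf fP] [f' yf' fP']].
    by exists 0 => [|x r _]; [exact: (@cohrel_lin _ _ _ _).1 | rewrite scaler0].
  exists (c *: f + f') => [|x r xr]; first exact: (@cohrel_lin _ _ _ _).2.
  by rewrite scalerDr scaleAC -(fP x r xr) -(fP' x r xr).
apply: (sfg_rel rhoL) => [u uK|I _|J JK].
- have [|f cf fP] := @cocycle_of_killed R a L eL X u LP.
    have sub : {subset a <= annmod u (botm X)}.
      by apply: gen_seq_sub => x xs; apply/annmodP/botmP; exact: Ks.
    by move=> r /sub/annmodP/botmP.
  by have [y yf] := cohrel_ex cf; exists y, f.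
- exact: nC.
- apply: sfg0 => u /JK[_ [f y0 fP]].
  have f0 := (cohrel0 y0).1 erefl.
  have [es _ _] := LP; have [x xE] := es (qpi a 1).
  by rewrite -[u]scale1r -(fP x 1 xE); exact: f0.
Qed.

(** If the elements killed by [a] are finitely generated, then so are those
    killed by a power: multiplication by the generators lowers the power. *)
Lemma killed_pow_sfg (X : lmodType R) n (K : submodClosed X) :
    (forall K : submodClosed X,
      (forall u x, u \in K -> x \in s -> x *: u = 0) -> sfg K) ->
    (forall (u : X) (r : R), u \in K -> r \in ideal_pow a n -> r *: u = 0) ->
  sfg K.
Proof.
move=> h; elim: n K => [|n IH] K Kn.
  by apply: sfg0 => u uK; rewrite -[u]scale1r Kn//; exact: mem_topm.
apply: (@sfg_maps R X X R (fun x => mklin (@mul_linear R x X)) s).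
  move=> x I xs IK; apply: IH => _ r /IK[u uK <-] rn.
  rewrite -[LHS]/(r *: (x *: u)) scaleAC scalerA; apply: Kn uK _.
  have xa : (x : R^o) \in a by exact: mem_gen_seq.
  exact: (@ideal_mulM R a R^o (ideal_pow a n) x r xa rn).
by move=> J JK; apply: h => u x /JK[_]; apply.
Qed.

End AnnihilatedFinite.

(** * Annihilation and the local-global principle *)

Section Kills.
Context (R : comPzRingType).
Implicit Types (V H : lmodType R) (a b : ideal R).

Definition kills b n V : Prop :=
  forall c : R, c \in ideal_pow b n -> forall v : V, c *: v = 0.

Lemma not_kills b n V : ~ kills b n V <->
  exists2 x : V, x \in ideal_mul (ideal_pow b n) (topm V) & x != 0.
Proof.
split=> [nk|[x xb x0] kV]; last first.
  move/eqP: x0; apply; apply/botmP; move: xb; apply: ideal_mul_sub => c v cb _.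
  by apply/botmP; exact: kV.
apply: contrapT => h; apply: nk => c cb v; apply: contrapT => cv.
apply: h; exists (c *: v); last exact/eqP.
exact: ideal_mulM cb (mem_topm v).
Qed.

(** The largest of the powers that kill the generators kills everything. *)
Lemma torsion_kills a V : finitely_generated V -> torsion a V ->
  exists n, kills a n V.
Proof.
move=> [s sV] tV; have [n nP] := choice tV.
exists (\max_(v <- s) n v)%N => c cn v.
have sub : {subset submod_gen [set` s] <= colon (botm V) c}.
  apply: gen_seq_sub => u us; apply/colonP/botmP; apply: nP.
  by apply: ideal_pow_sub cn; exact: leq_bigmax_seq.
by have /sub/colonP/botmP := sV v.
Qed.

(** Local annihilation at [p] by the powers of [b], in terms of the module
    before localization. *)
Definition kills_at (p : spec R) b n H : Prop :=
  forall c : R, c \in ideal_pow b n -> forall v : H,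
    exists2 t : R, t \notin (p : ideal R) & t *: (c *: v) = 0.

(** Only the finitely many associated primes have to be inspected: a nonzero
    element [c v] has a multiple whose annihilator is one of them, and the
    annihilator [p] leaves no room for a [t] outside [p]. *)
Lemma kills_local_global b H : noetherian R -> finite_set (Ass H) ->
  (forall p, exists n, kills_at p b n H) -> exists n, kills b n H.
Proof.
move=> nR finA loc.
have h (P : set R) : exists n, forall p : spec R,
    P = [set x | x \in (p : ideal R)]%classic -> kills_at p b n H.
  have [[p0 Pp0]|np] := pselect (exists p : spec R,
      P = [set x | x \in (p : ideal R)]%classic); last first.
    by exists 0%N => p Pp; case: np; exists p.
  have [n nP] := loc p0; exists n => p; rewrite Pp0 => pp0.
  suff -> : p = p0 by [].
  apply: spec_ext => x.
  have e : (x \in (p0 : ideal R)) = (x \in (p : ideal R)) :> Prop :=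
    congr1 (fun A : set R => A x) pp0.
  by apply/idP/idP; rewrite e.
have [n nP] := choice h.
have /finite_seqP[s sE] := finA.
exists (\max_(P <- s) n P)%N => c cb v; apply/eqP; apply: contrapT => /negP cv.
have [r [p rp]] := ann_prime_exists nR cv.
have /AssP : exists (q : spec R) (w : H),
    [set x | x \in (p : ideal R)]%classic = [set x | x \in (q : ideal R)]%classic
    /\ is_ann q w by exists p, (r *: (c *: v)).
rewrite sE => /= ps.
have nle : (n [set x | x \in (p : ideal R)]%classic <= \max_(P <- s) n P)%N.
  exact: leq_bigmax_seq ps isT.
have cn := ideal_pow_sub nle cb.
have [t tp tE] := nP _ p erefl c cn (r *: v).
by case/negP: tp; apply/rp; rewrite [r *: _]scaleAC.
Qed.

End Kills.

Section KillsLocalization.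
Context (R : comPzRingType) (p : spec R) (b : ideal R).

Lemma toloc_pow n (c : R) : c \in ideal_pow b n ->
  (toloc p c : (locR p)^o) \in ideal_pow (ideal_loc p b) n.
Proof.
elim: n c => [|n IH] c; first by move=> _; exact: mem_topm.
pose J := ideal_pow (ideal_loc p b) n.+1.
pose P (r : R^o) : Prop := (toloc p r : (locR p)^o) \in J.
have P0 : P 0 by exact: (rpred0 J).
have PZD d u v : P u -> P v -> P (d *: u + v).
  move=> Pu Pv; rewrite /P tolocD regZ tolocM; apply: (rpredD (S := J)) => //.
  exact: (rpredZ (toloc p d) Pu).
suff sub : {subset ideal_pow b n.+1 <= mksubmod P0 PZD}.
  by move=> /sub/(mksubmodP P0 PZD).
apply: ideal_mul_sub => x u xb un; apply/(mksubmodP P0 PZD).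
rewrite /P regZ tolocM.
apply: (@ideal_mulM _ (ideal_loc p b) (locR p)^o (ideal_pow (ideal_loc p b) n)).
  by apply: sub_submod_gen; exists x.
exact: IH.
Qed.

Lemma ideal_pow_loc n :
  {subset ideal_pow (ideal_loc p b) n <= ideal_loc p (ideal_pow b n)}.
Proof.
elim: n => [|n IH] z.
  move=> _; rewrite -[z]mulr1; apply: (rpredZ (z : locR p)).
  by apply: sub_submod_gen; exists 1; first exact: mem_topm.
pose J := ideal_loc p (ideal_pow b n.+1).
have key (r : R) : r \in b ->
    {subset ideal_loc p (ideal_pow b n) <= colon J (toloc p r)}.
  move=> rb; apply: submod_gen_sub => u [r' rb' ->]; apply/colonP.
  have -> : toloc p r *: (toloc p r' : (locR p)^o) = toloc p (r * r').
    by rewrite tolocM.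
  by apply: sub_submod_gen; exists (r * r') => //; exact: (@ideal_mulM R b R^o _ r r').
refine (@ideal_mul_sub _ (ideal_loc p b) (locR p)^o _ J _ z) => x u xb un.
apply: (annmodP u J x).1; move: x xb.
refine (@submod_gen_sub _ _ _ (annmod u J) _) => y [r rb ->].
apply: (annmodP u J _).2.
exact: (colonP _ _ _).1 (key r rb _ (IH _ un)).
Qed.

Context (H : lmodType R) (Y : lmodType (locR p)).
Hypothesis loc : is_loc H Y.

Lemma kills_loc n : kills b n H -> kills (ideal_loc p b) n Y.
Proof.
have [rho h] := loc.
move=> kH c cn y.
have sub : {subset ideal_loc p (ideal_pow b n) <= annmod y (botm Y)}.
  refine (@submod_gen_sub _ _ _ (annmod y (botm Y)) _) => _ [r rn ->].
  apply: (annmodP y _ _).2; apply/botmP; rewrite -[frac _ _]/(toloc p r).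
  have [t [x [tp xy]]] := locrel_surj h y.
  apply: (toloc_cancel tp); rewrite scaleAC; apply: (locrel_fun h).
  by rewrite -(kH r rn x); exact: locrelZ.
by have /ideal_pow_loc/sub/annmodP/botmP := cn.
Qed.

Lemma kills_at_loc n : kills (ideal_loc p b) n Y -> kills_at p b n H.
Proof.
have [rho h] := loc.
move=> kY c cn v; apply: (locrel_ker h).
have [y vy] := locrel_total h v.
by rewrite -(kY _ (toloc_pow cn) y); exact: locrelZ.
Qed.

Lemma fg_loc : finitely_generated H -> finitely_generated Y.
Proof.
have [rho h] := loc.
move=> [s sH]; have [g gP] := choice (locrel_total h).
exists (map g s) => y; pose G := submod_gen [set` map g s].
have [t [x [tp xy]]] := locrel_surj h y.
pose P x := exists2 z, rho x z & z \in G.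
have P0 : P 0 by exists 0; [exact: locrel00 h | exact: rpred0].
have PZD c u v : P u -> P v -> P (c *: u + v).
  move=> [z uz zG] [w vw wG]; exists (toloc p c *: z + w); first exact: locrelP.
  by rewrite rpredD//; exact: rpredZ.
have sub : {subset submod_gen [set` s] <= mksubmod P0 PZD}.
  apply: gen_seq_sub => u us; apply/(mksubmodP P0 PZD); exists (g u) => //.
  by apply: mem_gen_seq; exact: map_f.
have /sub/(mksubmodP P0 PZD)[z xz zG] := sH x.
have [u uE] := toloc_inv tp.
rewrite -[y]scale1r -uE -scalerA -(locrel_uniq h xz xy); exact: rpredZ.
Qed.

End KillsLocalization.

Lemma loccoh_torsion (R : comPzRingType) (R_noetherian : noetherian R)
    (a : ideal R) i (M : lmodType R) :
  torsion a (local_cohomology a i M).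
Proof.
have [s ->] := noetherian_gen a R_noetherian.
have [r [rL rt _ ri _]] := loccoh_isom R_noetherian s i M.
move=> v; have [w vw] := rt v; have [n nP] := gamma_pow (smod_svalP w).
exists n => x xn; apply: ri; have := linrelZ x rL vw.
by rewrite (_ : x *: w = 0)//; apply: smod_sval_inj; rewrite smod_svalZ nP.
Qed.

Section LocalGlobal.
Context (R : comPzRingType) (R_noetherian : noetherian R).

(** In a torsion module, an element whose annihilator is a prime ideal is killed by
    [a], so that only the submodule killed by [a] has to be considered. *)
Lemma finite_Ass_of_killed (H : lmodType R) (a : ideal R) : torsion a H ->
  (forall K : submodClosed H,
     (forall (u : H) (r : R), u \in K -> r \in a -> r *: u = 0) -> sfg K) ->
  finite_set (Ass H).
Proof.
move=> tH hK.
pose P (u : H) := forall r : R, r \in a -> r *: u = 0.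
have P0 : P 0 by move=> r _; exact: scaler0.
have PZD c u v : P u -> P v -> P (c *: u + v).
  by move=> Pu Pv r ra; rewrite scalerDr scaleAC Pu// Pv// scaler0 addr0.
pose U := mksubmod P0 PZD.
have nU : noeth_mod (smod U).
  apply: noeth_smod => K KU; apply: hK => u r /KU/(mksubmodP P0 PZD); exact.
apply: sub_finite_set (finite_Ass R_noetherian nU) => Q /AssP[p [v [QE pv]]].
have [p1 pM] := specP p.
have ap (r : R) : r \in a -> r \in (p : ideal R).
  move=> ra; have [n nP] := tH v.
  have : r ^+ n \in (p : ideal R) by apply/pv/nP; exact: mem_pow.
  elim: n {nP} => [|n IH]; first by rewrite expr0 (negPf p1).
  by rewrite exprS => /pM[].
have vU : v \in U by apply/(mksubmodP P0 PZD) => r /ap/pv.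
apply/AssP; exists p, (exist _ v vU); split=> // x.
split=> [/pv xv|xv]; first by apply: smod_sval_inj; rewrite smod_svalZ.
by apply/pv; have := congr1 sval xv; rewrite smod_svalZ.
Qed.

(** The elements killed by [a] are finitely generated, hence there are finitely
    many associated primes; a power of [a] kills the module at each of them, so a
    power of [a] kills it, and the elements killed by a power are finitely
    generated. *)
Lemma loccoh_fg_local_global (a : ideal R) i (M : lmodType R) :
    finitely_generated M ->
    (forall j, (j < i)%N -> finitely_generated (local_cohomology a j M)) ->
    (forall p : spec R, finitely_generated
      (local_cohomology (ideal_loc p a) i (locmod p M))) ->
  finitely_generated (local_cohomology a i M).
Proof.
have [s aE] := noetherian_gen a R_noetherian; subst a.
move=> fgM fgj fgp; set a := submod_gen _ in fgj fgp *.
set H := local_cohomology a i M.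
have nG j : (j < i)%N -> noeth_mod (smod (gamma s (iter j (loc_coker s) M))).
  move=> ji; have iso := isom_sym (loccoh_isom R_noetherian s j M).
  exact: isom_noeth iso (fg_noeth R_noetherian (fgj j ji)).
have [r [rL rt _ ri rj]] := loccoh_isom R_noetherian s i M.
have hK (K : submodClosed H) :
    (forall u x, u \in K -> x \in s -> x *: u = 0) -> sfg K.
  move=> Ks; pose X := iter i (loc_coker s) M.
  pose rho (u : H) (w : X) := exists2 v, r u v & sval v = w.
  have rhoL : linrel rho.
    split=> [|c u w u' w' [v uv <-] [v' uv' <-]]; first by exists 0; first exact: rL.1.
    by exists (c *: v + v'); [exact: rL.2 | exact: smod_svalD].
  apply: (sfg_rel rhoL) => [u _|I hI|J JK].
  - by have [v uv] := rt u; exists (sval v), v.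
  - apply: (killed_sfg R_noetherian (fg_noeth R_noetherian fgM) nG).
    move=> w x /hI[u uK [v uv <-]] xs; have := linrelZ x rL uv.
    by rewrite (Ks u x uK xs) -smod_svalZ => /rj ->.
  - apply: sfg0 => u /JK[_ [v uv v0]]; apply: ri.
    by have <- : v = 0 by exact: smod_sval_inj.
have tH : torsion a H by exact: (loccoh_torsion R_noetherian).
have finA : finite_set (Ass H).
  apply: (finite_Ass_of_killed tH) => K Ka; apply: hK => u x uK xs.
  by apply: Ka => //; exact: mem_gen_seq.
have loc p : exists n, kills_at p a n H.
  have tY := @loccoh_torsion _ (locR_noetherian (p := p) R_noetherian)
    (ideal_loc p a) i (locmod p M).
  have [n kn] := torsion_kills (fgp p) tY.
  by exists n; exact: kills_at_loc (loccoh_is_loc p a i M R_noetherian) n kn.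
have [n kn] := kills_local_global R_noetherian finA loc.
apply: noeth_fg => K; apply: (killed_pow_sfg hK (n := n)) => u x _ xn.
exact: kn.
Qed.

End LocalGlobal.

Lemma einf_least (B : nat -> Prop) i : (forall j, (j < i)%N -> ~ B j) -> B i ->
  einf [set Some i | i in [set i | B i]]%classic = Some i.
Proof.
move=> lti Bi; have := einfP [set Some i | i in [set i | B i]]%classic.
case: einf => [m [[m' Bm [<-]] minm]|none]; last by case: (none i); exists i.
congr Some; apply/eqP; rewrite eqn_leq minm ?andbT; last by exists i.
by rewrite leqNgt; apply/negP => /lti; apply.
Qed.

(** Call a degree bad when [B], or locally [Bp], holds for it. A locally bad degree
    is bad, so no local infimum is smaller than the global one; and it suffices to
    detect badness locally in the least bad degree, where the infimum is attained. *)
Lemma einf_local (T : Type) (B : nat -> Prop) (Bp : T -> nat -> Prop) :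
    (forall p i, Bp p i -> B i) ->
    (forall i, (forall j, (j < i)%N -> ~ B j) -> B i -> exists p, Bp p i) ->
  einf [set Some i | i in [set i | B i]]%classic =
  einf [set e | exists p, e = einf [set Some i | i in [set i | Bp p i]]]%classic.
Proof.
move=> BpB Bloc.
have := einfP [set e | exists p,
  e = einf [set Some i | i in [set i | Bp p i]]]%classic.
have lower p m : einf [set Some i | i in [set i | Bp p i]]%classic = Some m -> B m.
  move=> e; have := einfP [set Some i | i in [set i | Bp p i]]%classic.
  by rewrite e => -[[m' /= /BpB Bm [<-]] _].
have least i : (forall j, (j < i)%N -> ~ B j) -> B i -> exists p,
    Some i = einf [set Some i | i in [set i | Bp p i]]%classic.
  move=> lti Bi; have [p Bpi] := Bloc i lti Bi; exists p.
  by apply/esym/einf_least => // j /lti nB /BpB.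
case: (einf [set e | _]%classic) => [m [[p /esym/lower Bm] minm]|none].
  apply: einf_least => // j; elim/ltn_ind: j => j IH jm Bj.
  have [|q qE] := least j _ Bj.
    by move=> j' j'j; apply: IH => //; exact: ltn_trans jm.
  have : (m <= j)%N by apply: minm; exists q.
  by rewrite leqNgt jm.
have := einfP [set Some i | i in [set i | B i]]%classic.
case: einf => [i [[i' Bi [<-]] mini]|//].
have [|q qE] := least i' _ Bi; last by case: (none i'); exists q.
move=> j ji Bj; have : (i' <= j)%N by apply: mini; exists j.
by rewrite leqNgt ji.
Qed.

Theorem theorem1p1 (R : comPzRingType) (a b : ideal R) (M : lmodType R)
    (R_noetherian : noetherian R) (b_sub_a : {subset b <= a})
    (M_fg : finitely_generated M) :
  ((forall i : nat, bfindim a b M = Some i ->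
      finite_set (Ass (local_cohomology a i M))) ->
    bfindim a b M =
      einf [set e | exists p : spec R,
        e = bfindim (ideal_loc p a) (ideal_loc p b) (locmod p M)]%classic) /\
  findim a M =
    einf [set e | exists p : spec R,
      e = findim (ideal_loc p a) (locmod p M)]%classic.
Proof.
split=> [finA|].
  apply: einf_local => [p i nk n|i lti nk].
    apply/not_kills => kH; have /not_kills := nk n; apply.
    exact: kills_loc (loccoh_is_loc p a i M R_noetherian) n kH.
  have {}finA : finite_set (Ass (local_cohomology a i M)).
    by apply: finA; exact: einf_least.
  apply: contrapT => np; suff [n kn] : exists n, kills b n (local_cohomology a i M).
    by have /not_kills := nk n; apply.
  apply: (kills_local_global R_noetherian finA) => p.
  suff [n kn] : exists n, kills (ideal_loc p b) n
      (local_cohomology (ideal_loc p a) i (locmod p M)).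
    by exists n; exact: kills_at_loc (loccoh_is_loc p a i M R_noetherian) n kn.
  apply: contrapT => nk'; apply: np; exists p => n; apply/not_kills => kn.
  by apply: nk'; exists n.
apply: einf_local => [p i nfg fgH|i lti nfg].
  exact/nfg/fg_loc/fgH/loccoh_is_loc.
apply: contrapT => np; apply: nfg; apply: (loccoh_fg_local_global R_noetherian M_fg).
  by move=> j /lti/contrapT.
move=> p; apply: contrapT => nfg; apply: np.
by exists p.
Qed.
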